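(* Let $\Delta$ be a consistently oriented connectivity complex with vertex set $\{1,\dots,N_V\}$, let $Q_{\mathrm{ref}} \in \mathcal{M}_+(\Delta)$ be a reference mesh, and let $\mathcal{M} = \mathcal{M}(\Delta;Q_{\mathrm{ref}})$ be the manifold of planar triangular meshes. Let $\varphi$ be the penalty function, either in the version without cut-off or in the version with cut-off (both given in the context), with all parameters $\alpha_j > 0$, $j=1,\dots,4$. Let $\underline{a}<\overline{a}$ and $\underline{b}<\overline{b}$ be real numbers, and let $$D := \{\, Q=[q_1,\dots,q_{N_V}] \in \mathcal{M} \;:\; q_i \in [\underline{a},\overline{a}]\times[\underline{b},\overline{b}] \text{ for all } i=1,\dots,N_V \,\}.$$ Suppose that $Q_{\mathrm{ref}} \in D$ and that $r \in L^\infty([\underline{a},\overline{a}]\times[\underline{b},\overline{b}])$. Let $I_D$ be the function with $I_D(Q)=0$ for $Q \in D$ and $I_D(Q)=+\infty$ for $Q\in\mathcal{M}\setminus D$. Then the problem $$\begin{aligned}\text{Minimize}\quad & \int_{\Omega_Q} y \,dx + I_D(Q) + \varphi(Q;Q_{\mathrm{ref}}) \quad\text{with respect to } Q \in \mathcal{M},\ y \in S^1_0(\Omega_Q)\\ \text{subject to}\quad & \int_{\Omega_Q} \nabla y\cdot\nabla v\,dx = \int_{\Omega_Q} r\,v\,dx \quad\text{for all } v \in S^1_0(\Omega_Q)\end{aligned}$$ has at least one globally optimal solution in $\mathcal{M}$.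
   Context: **Connectivity complex.** An abstract simplicial complex $\Delta$ over $V=\{1,\dots,N_V\}$ is a non-empty collection of non-empty subsets of $V$ (faces), closed under taking non-empty subsets, with vertex set $V$; a $k$-face is a face with $k+1$ elements. $\Delta$ is a connectivity complex if it is a pure $2$-complex (every face lies in some $2$-face, there are no $k$-faces with $k>2$) and is $2$-path connected (any two distinct $2$-faces are joined by a finite sequence of $2$-faces such that consecutive ones intersect in a $1$-face). It is consistently oriented if each $2$-face carries an orientation $[i_0,i_1,i_2]$ and any two $2$-faces sharing a $1$-face induce opposite orientations on it. **Manifold of planar triangular meshes.** For $Q=[q_1,\dots,q_{N_V}]\in\mathbb{R}^{2\times N_V}$ set $\Sigma_\Delta(Q)=\{\mathrm{conv}\{q_{i_0},\dots,q_{i_k}\} : \{i_0,\dots,i_k\}\in\Delta\}$. The signed area of an oriented $2$-face is $A_Q(i_0,i_1,i_2)=\tfrac12\det[\,q_{i_1}-q_{i_0},\ q_{i_2}-q_{i_1}]$. $\mathcal{M}_+(\Delta)$ is the set of $Q\in\mathbb{R}^{2\times N_V}$ such that (i) $\Sigma_\Delta(Q)$ is a geometric simplicial complex (a finite collection of simplices closed under taking faces, any two of which intersect either in the empty set or in a common face) whose associated abstract simplicial complex is $\Delta$ (vertex $i$ corresponding to $q_i$), and (ii) all $2$-faces have positive signed area. Given $Q_{\mathrm{ref}}\in\mathcal{M}_+(\Delta)$, $\mathcal{M}=\mathcal{M}(\Delta;Q_{\mathrm{ref}})$ is the set of $Q\in\mathcal{M}_+(\Delta)$ which can be joined to $Q_{\mathrm{ref}}$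 by a continuous path inside $\mathcal{M}_+(\Delta)$. It carries the topology (and the structure of an open submanifold) inherited from $\mathbb{R}^{2\times N_V}$. **Mesh quantities.** The $2$-faces are numbered $1,\dots,N_T$, the $k$-th being $[i_0^k,i_1^k,i_2^k]$. $V_\partial$ and $E_\partial$ are the sets of boundary vertices and boundary edges ($1$-faces contained in exactly one $2$-face; boundary vertices are their endpoints), with cardinalities $\#V_\partial,\#E_\partial$. Edge lengths are $E^\ell_Q(i_0,i_1,i_2)=\|q_{i_{\ell\oplus1}}-q_{i_{\ell\oplus2}}\|$, $\ell=0,1,2$ ($\oplus$ is addition modulo $3$, $\|\cdot\|$ Euclidean), and $$\frac{1}{\psi_Q(i_0,i_1,i_2)}=\frac{(E^0_Q)^2+(E^1_Q)^2+(E^2_Q)^2}{4\sqrt3\,A_Q}\quad\text{(all evaluated at }(i_0,i_1,i_2)).$$ Regularized vertex–edge distance: $d_Q(i_0;[j_0,j_1])=\min\{\|q_{i_0}-q\|_{1,\mu} : q\in\mathrm{conv}\{q_{j_0},q_{j_1}\}\}$, where $\|\cdot\|_{1,\mu}$ ($\mu>0$ fixed) is a fixed continuous regularization of the $1$-norm, evaluated in the coordinates of an orthonormal frame aligned with the edge $[q_{j_0},q_{j_1}]$, satisfying $0\le\|x\|_{1,\mu}\le\|x\|_1$, vanishing only at $x=0$, and such that $Q\mapsto d_Q(i_0;[j_0,j_1])$ is of class $C^3$ on $\mathcal{M}_+(\Delta)$ for $[j_0,j_1]\in E_\partial$, $i_0\in V_\partial\setminus\{j_0,j_1\}$. **Penalty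 function without cut-off.** $$\varphi(Q;Q_{\mathrm{ref}})=\sum_{k=1}^{N_T}\frac{1}{N_T}\frac{\alpha_1}{\psi_Q(i_0^k,i_1^k,i_2^k)}+\frac{\alpha_2}{\sum_{k=1}^{N_T}A_Q(i_0^k,i_1^k,i_2^k)}+\sum_{[j_0,j_1]\in E_\partial}\ \sum_{\substack{i_0\in V_\partial\\ i_0\ne j_0,j_1}}\frac{1}{\#E_\partial\,\#V_\partial}\frac{\alpha_3}{d_Q(i_0;[j_0,j_1])}+\frac{\alpha_4}{2}\|Q-Q_{\mathrm{ref}}\|_F^2,$$ with $\|\cdot\|_F$ the Frobenius norm. **Version with cut-off:** the same formula with $\frac{1}{d_Q(i_0;[j_0,j_1])}$ in the third term replaced by $\chi\bigl(\frac{1}{d_Q(i_0;[j_0,j_1])}\bigr)$, where $\chi:[0,\infty)\to\mathbb{R}$ is of class $C^3$, $\chi(s)=0$ on some interval $[0,\underline{s}]$ and $\chi(s)=s$ for $s\ge\overline{s}$. **Finite elements.** $\Omega_Q$ is the domain covered by the mesh with vertex positions $Q$ (the union of its triangles). $S^1_0(\Omega_Q)$ is the space of globally continuous functions on $\Omega_Q$ which are affine on each triangle and vanish on $\partial\Omega_Q$. For $Q\in D$ one has $\Omega_Q\subset[\underline{a},\overline{a}]\times[\underline{b},\overline{b}]$; for $Q\notin D$ the objective is understood to be $+\infty$. *)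

(* Defs.v *)
From HB Require Import structures.
From mathcomp Require Import all_boot all_order all_algebra.
From mathcomp Require Import all_classical all_reals all_analysis.

Set Implicit Arguments.
Unset Strict Implicit.
Unset Printing Implicit Defensive.

Import Order.TTheory GRing.Theory Num.Theory.
Import numFieldNormedType.Exports.

Local Open Scope classical_set_scope.
Local Open Scope ring_scope.

Section Complex.
Context (N : nat).
Implicit Types (Delta : {set {set 'I_N}}) (F G : {set 'I_N}).

Definition abstract_complex Delta : Prop :=
  [/\ Delta != finset.set0,
      finset.set0 \notin Delta,
      (forall F G, F \in Delta -> G \subset F -> G != finset.set0 ->
         G \in Delta)
    & finset.cover Delta = [set: 'I_N]%SET].

Definition kfaces Delta (k : nat) : {set {set 'I_N}} :=
  [set F in Delta | #|F| == k.+1]%SET.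

Definition pure2 Delta : Prop :=
  (forall F, F \in Delta -> exists2 G, G \in kfaces Delta 2 & F \subset G) /\
  (forall k, (2 < k)%N -> kfaces Delta k = finset.set0).

Definition adjacent2 Delta : rel {set 'I_N} := fun F G =>
  [&& F \in kfaces Delta 2, G \in kfaces Delta 2
    & F :&: G \in kfaces Delta 1]%SET.

Definition path_connected2 Delta : Prop :=
  forall F G, F \in kfaces Delta 2 -> G \in kfaces Delta 2 -> F != G ->
    connect (adjacent2 Delta) F G.

Definition connectivity_complex Delta : Prop :=
  [/\ abstract_complex Delta, pure2 Delta & path_connected2 Delta].

(* The k-th oriented 2-face is [tri k 0, tri k 1, tri k 2]. Indices in 'I_3
   are added modulo 3. *)
Context (NT : nat).
Implicit Type tri : 'I_NT -> 'I_3 -> 'I_N.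

Definition face tri (k : 'I_NT) : {set 'I_N} := [set tri k l | l : 'I_3]%SET.

Definition enumerates_2faces Delta tri : Prop :=
  injective (face tri) /\
  (forall F, F \in kfaces Delta 2 <-> exists k, F = face tri k).

(* [i, j] is the orientation which the k-th 2-face induces on {i, j}. *)
Definition induces tri (k : 'I_NT) (i j : 'I_N) : bool :=
  [exists l : 'I_3, (tri k l == i) && (tri k (l + 1) == j)].

Definition consistently_oriented tri : Prop :=
  forall (k k' : 'I_NT) (i j : 'I_N), k != k' ->
    induces tri k i j -> [set i; j]%SET \subset face tri k' ->
    induces tri k' j i.

(* Each boundary edge occurs once, as the pair (j0, j1) oriented by the unique
   2-face that contains it. *)
Definition boundary_edges tri : {set 'I_N * 'I_N} :=
  [set e | [exists k, induces tri k e.1 e.2] &&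
    (#|[set k | [set e.1; e.2]%SET \subset face tri k]%SET| == 1%N)]%SET.

Definition boundary_vertices tri : {set 'I_N} :=
  [set i | [exists e in boundary_edges tri, (i == e.1) || (i == e.2)]]%SET.

End Complex.

Section Geometry.
Context (R : realType).
Notation plane := (R * R)%type.
Implicit Types (x y : plane) (W s t : set plane) (S : set (set plane)).

Definition dot x y : R := x.1 * y.1 + x.2 * y.2.

Definition enorm x : R := Num.sqrt (dot x x).

Definition conv_hull W : set plane := smallest (@convex_set R plane) W.

Definition affinely_independent (k : nat) (p : 'I_k.+1 -> plane) : Prop :=
  forall c : 'I_k.+1 -> R,
    \sum_i c i = 0 -> \sum_i c i *: p i = 0 -> forall i, c i = 0.

Definition simplex_on W s : Prop :=
  exists (k : nat) (p : 'I_k.+1 -> plane),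
    [/\ affinely_independent p, W = range p & s = conv_hull W].

Definition face_of t s : Prop :=
  exists W W', [/\ simplex_on W s, W' `<=` W, W' !=set0 & t = conv_hull W'].

Definition geometric_complex S : Prop :=
  [/\ finite_set S,
      (forall s, S s -> exists W, simplex_on W s),
      (forall s t, S s -> face_of t s -> S t)
    & (forall s t, S s -> S t -> s `&` t = set0 \/
         (face_of (s `&` t) s /\ face_of (s `&` t) t))].

Definition associated_complex S : set (set plane) :=
  [set W | exists2 s, S s & simplex_on W s].

End Geometry.

Section Manifold.
Context (R : realType) (N NT : nat).
Context (Delta : {set {set 'I_N}}) (tri : 'I_NT -> 'I_3 -> 'I_N).
Implicit Types (Q : 'M[R]_(2, N)).

Definition vtx Q (i : 'I_N) : R * R := (Q 0 i, Q 1 i).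

Definition Sigma Q : set (set (R * R)) :=
  [set conv_hull (vtx Q @` [set` F]) | F in [set` Delta]].

Definition area Q (i0 i1 i2 : 'I_N) : R :=
  2^-1 * \det (row_mx (col i1 Q - col i0 Q) (col i2 Q - col i1 Q)).

Definition tri_area Q (k : 'I_NT) : R := area Q (tri k 0) (tri k 1) (tri k 2).

Definition Mplus : set 'M[R]_(2, N) :=
  [set Q | [/\ geometric_complex (Sigma Q),
               injective (vtx Q),
               associated_complex (Sigma Q) =
                 [set vtx Q @` [set` F] | F in [set` Delta]]
             & forall k, 0 < tri_area Q k]].

Definition Mesh (Qref : 'M[R]_(2, N)) : set 'M[R]_(2, N) :=
  [set Q | exists gamma : R -> 'M[R]_(2, N),
    [/\ {within `[0, 1], continuous gamma},
        (forall t, t \in `[0, 1] -> Mplus (gamma t)),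
        gamma 0 = Qref & gamma 1 = Q]].

End Manifold.

(* On an open subset [U] of a finite-dimensional space this is the class
   C^k on [U]: directional derivatives are taken in all directions. *)
Fixpoint class_C (R : realType) (V : normedModType R) (k : nat) (U : set V)
    (f : V -> R) : Prop :=
  (forall x, U x -> {for x, continuous f}) /\
  (if k is k'.+1 then
     forall v : V, (forall x, U x -> derivable f x v) /\
                   class_C k' U (fun x => 'D_v f x)
   else True).

Section Penalty.
Context (R : realType) (N NT : nat).
Context (Delta : {set {set 'I_N}}) (tri : 'I_NT -> 'I_3 -> 'I_N).
Implicit Types (Q : 'M[R]_(2, N)) (nrm : R * R -> R) (chi : R -> R).

Definition edge_length Q (k : 'I_NT) (l : 'I_3) : R :=
  enorm (vtx Q (tri k (l + 1)) - vtx Q (tri k (l + 2))).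

Definition inv_psi Q (k : 'I_NT) : R :=
  (edge_length Q k 0 ^+ 2 + edge_length Q k 1 ^+ 2 + edge_length Q k 2 ^+ 2) /
  (4 * Num.sqrt 3 * tri_area tri Q k).

(* Coordinates of [x] in the positively oriented orthonormal frame whose first
   vector points from q_j0 to q_j1. *)
Definition edge_coords Q (j0 j1 : 'I_N) (x : R * R) : R * R :=
  let e := vtx Q j1 - vtx Q j0 in
  let t := (enorm e)^-1 *: e in
  (dot t x, dot (- t.2, t.1) x).

(* The infimum is a minimum: a continuous [nrm] is minimized over a compact
   segment. *)
Definition edge_dist nrm Q (i0 j0 j1 : 'I_N) : R :=
  inf [set nrm (edge_coords Q j0 j1 (vtx Q i0 - q))
      | q in conv_hull [set vtx Q j0; vtx Q j1]].

Definition regularized_norm1 nrm : Prop :=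
  [/\ continuous nrm,
      (forall x, 0 <= nrm x <= `|x.1| + `|x.2|),
      (forall x, nrm x = 0 -> x = 0)
    & (forall (e : 'I_N * 'I_N) (i0 : 'I_N),
         e \in boundary_edges tri -> i0 \in boundary_vertices tri ->
         i0 != e.1 -> i0 != e.2 ->
         class_C 3 (@Mplus R N NT Delta tri)
           (fun Q => edge_dist nrm Q i0 e.1 e.2))].

(* Class C^3 on [0, +oo[ means being the restriction of a C^3 function. *)
Definition cutoff chi : Prop :=
  (exists2 g : R -> R, class_C 3 [set: R^o] g
     & forall s : R, 0 <= s -> g s = chi s) /\
  (exists s0 s1 : R, [/\ 0 < s0, s0 < s1,
     (forall s : R, 0 <= s -> s <= s0 -> chi s = 0)
   & (forall s : R, s1 <= s -> chi s = s)]).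

Definition frobenius Q : R := Num.sqrt (\sum_i \sum_j Q i j ^+ 2).

Section Formula.
Context (alpha1 alpha2 alpha3 alpha4 : R) (nrm : R * R -> R).
Context (Qref : 'M[R]_(2, N)).

Definition penalty_with (h : R -> R) Q : R :=
  \sum_(k < NT) NT%:R^-1 * (alpha1 * inv_psi Q k)
  + alpha2 / (\sum_(k < NT) tri_area tri Q k)
  + \sum_(e in boundary_edges tri)
      \sum_(i0 in boundary_vertices tri | (i0 != e.1) && (i0 != e.2))
        (#|boundary_edges tri|%:R * #|boundary_vertices tri|%:R)^-1 *
        (alpha3 * h (edge_dist nrm Q i0 e.1 e.2)^-1)
  + alpha4 / 2 * frobenius (Q - Qref) ^+ 2.

Definition penalty : 'M[R]_(2, N) -> R := penalty_with id.

Definition penalty_cutoff chi : 'M[R]_(2, N) -> R := penalty_with chi.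

End Formula.
End Penalty.

Section Problem.
Context (R : realType) (N NT : nat).
Context (Delta : {set {set 'I_N}}) (tri : 'I_NT -> 'I_3 -> 'I_N).
Context (Qref : 'M[R]_(2, N)).
Implicit Types (Q : 'M[R]_(2, N)) (y v r : R * R -> R).

Notation mplane := (measurableTypeR R * measurableTypeR R)%type.

Definition lebesgue2 : {measure set mplane -> \bar R} :=
  (@lebesgue_measure R \x @lebesgue_measure R)%E.

Definition triangle Q (k : 'I_NT) : set (R * R) :=
  conv_hull (vtx Q @` [set` face tri k]).

Definition Omega Q : set (R * R) := \bigcup_(k in [set: 'I_NT]) triangle Q k.

Definition frontier (A : set (R * R)) : set (R * R) :=
  closure A `\` interior A.

(* A function on [Omega Q] is identified with its extension by zero. *)
Definition S10 Q : set (R * R -> R) :=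
  [set y | [/\ {within Omega Q, continuous y},
               (forall k, exists (g : R * R) (c : R),
                  forall x, triangle Q k x -> y x = dot g x + c),
               (forall x, frontier (Omega Q) x -> y x = 0)
             & (forall x, ~ Omega Q x -> y x = 0)]].

(* Defined everywhere in [Omega Q] except on the edges, a null set. *)
Definition grad y (x : R * R) : R * R :=
  ('D_((1, 0) : R * R) y x, 'D_((0, 1) : R * R) y x).

Definition state_equation r Q y : Prop :=
  forall v, S10 Q v ->
    \int[lebesgue2]_(x in Omega Q) (dot (grad y x) (grad v x)) =
    \int[lebesgue2]_(x in Omega Q) (r x * v x).

Definition rectangle (a a' b b' : R) : set (R * R) :=
  [set x | a <= x.1 <= a' /\ b <= x.2 <= b'].

Definition box_meshes (a a' b b' : R) : set 'M[R]_(2, N) :=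
  [set Q | Mesh Delta tri Qref Q /\
           forall i, rectangle a a' b b' (vtx Q i)].

Definition in_Linfty r (B : set (R * R)) : Prop :=
  ((r \_ B : R * R -> R) : mplane -> R) \in Lfun lebesgue2 +oo%E.

Definition indicator_oo (D : set 'M[R]_(2, N)) Q : \bar R :=
  if `[< D Q >] then 0%E else +oo%E.

Definition feasible r Q y : Prop :=
  [/\ Mesh Delta tri Qref Q, S10 Q y & state_equation r Q y].

Definition objective (D : set 'M[R]_(2, N)) (phi : 'M[R]_(2, N) -> R) Q y :
    \bar R :=
  ((\int[lebesgue2]_(x in Omega Q) y x)%:E + indicator_oo D Q + (phi Q)%:E)%E.

Definition global_minimizer r D phi Q y : Prop :=
  feasible r Q y /\
  (forall Q' y', feasible r Q' y' ->
     (objective D phi Q y <= objective D phi Q' y')%E).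

End Problem.

(* Main.v *)
Require Import Defs.
From mathcomp Require Import all_boot all_order all_algebra.
From mathcomp Require Import all_classical all_reals all_analysis.
From mathcomp Require Import measurable_realfun ess_sup_inf ring lra.
Import Order.TTheory GRing.Theory Num.Theory.
Import numFieldNormedType.Exports.
Local Open Scope classical_set_scope.
Local Open Scope ring_scope.

Set Implicit Arguments.
Unset Strict Implicit.
Unset Printing Implicit Defensive.

(* Direct method in the nodal coordinates. A mesh with positive areas is proper
   iff any two of its triangles are separated by a line which touches them at
   most in their common vertices; hence M_+ is open, and a limit of meshes in
   one path component that lies in M_+ lies in that component. Along a
   minimizing sequence the discrete solutions are bounded by a Poincare
   inequality which uses only the enclosing box, so the integral of y is
   bounded and the penalty is bounded above. The shape and area terms then keep
   the triangles of a limit mesh nondegenerate, and the vertex-edge distances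
   keep boundary vertices off the boundary edges. In the limit the triangles are
   still weakly separated, and an interior vertex is surrounded by its star, so
   that no vertex can enter a foreign triangle: the limit mesh lies in M_+.
   Stiffness and load depend continuously on the vertex positions (dominated
   convergence), so a limit of discrete solutions solves the limit problem. *)

(** The definition of [Mplus] speaks of convex hulls and abstract complexes, which do not pass to
    limits, so the geometry is rewritten with barycentric coordinates: they are affine in the point
    and, while areas stay positive, continuous in the mesh. The order of the estimates matters. The
    integral of [y] may be negative, so it has to be bounded before the penalty is, hence without
    any control on the shapes of the triangles. This is why the Poincare inequality measures [y] by
    lengths of vertical slices of triangles, whose integrals are areas. Weak separation of a limit
    mesh still forbids that a triangle meets the interior of another one. What it does allow, a
    boundary vertex resting on a foreign edge, is excluded by the vertex-edge distance if that edge
    lies on the boundary, and otherwise because two triangles fill a neighbourhood of an inner edge.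
    Geometric limits are taken along ultrafilters, on which bounded quantities such as separating
    normals converge at once; dominated convergence requires sequences. *)

(** * Indices modulo 3 *)

Section Ord3.

Lemma ord3P (P : 'I_3 -> Prop) : P 0 -> P 1 -> P 2 -> forall l, P l.
Proof.
move=> P0 P1 P2 [[|[|[|m]]] Hm] //.
- by rewrite (_ : Ordinal Hm = 0) //; apply: val_inj.
- by rewrite (_ : Ordinal Hm = 1) //; apply: val_inj.
- by rewrite (_ : Ordinal Hm = 2) //; apply: val_inj.
Qed.

Lemma ord3_addE : (((0 + 1)%R = 1%R :> 'I_3) * ((0 + 2)%R = 2%R :> 'I_3) *
  ((1 + 1)%R = 2%R :> 'I_3) * ((1 + 2)%R = 0%R :> 'I_3) * ((2 + 1)%R = 0%R :> 'I_3)
  * ((2 + 2)%R = 1%R :> 'I_3))%type.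
Proof. by do !split; apply: val_inj. Qed.

Lemma sum3E (V : nmodType) (f : 'I_3 -> V) : \sum_l f l = f 0 + f 1 + f 2.
Proof.
rewrite !big_ord_recl big_ord0 addr0 addrA.
by congr (f _ + f _ + f _); apply: val_inj.
Qed.

Lemma ord3_shift (l m : 'I_3) : [\/ m = l, m = l + 1 | m = l + 2].
Proof.
by move: l m; apply: ord3P; apply: ord3P; rewrite ?ord3_addE;
  first [exact: Or31 | exact: Or32 | exact: Or33].
Qed.

Lemma ord3_shift_neq (l : 'I_3) : [/\ l != l + 1, l != l + 2 & l + 1 != l + 2].
Proof. by move: l; apply: ord3P; rewrite ?ord3_addE. Qed.

Lemma ord3_add1_2 (l : 'I_3) : l + 1 + 1 = l + 2.
Proof. by move: l; apply: ord3P; rewrite ?ord3_addE. Qed.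

Lemma ord3_add1_3 (l : 'I_3) : l + 1 + 2 = l.
Proof. by move: l; apply: ord3P; rewrite ?ord3_addE. Qed.

Lemma ord3_add2_1 (l : 'I_3) : l + 2 + 1 = l.
Proof. by move: l; apply: ord3P; rewrite ?ord3_addE. Qed.

Lemma ord3_add2_2 (l : 'I_3) : l + 2 + 2 = l + 1.
Proof. by move: l; apply: ord3P; rewrite ?ord3_addE. Qed.

Lemma sum3_shift (V : nmodType) (f : 'I_3 -> V) (l : 'I_3) :
  \sum_m f m = f l + f (l + 1) + f (l + 2).
Proof.
rewrite sum3E; move: l; apply: ord3P; rewrite !ord3_addE //.
  by rewrite [RHS]addrC addrA.
by rewrite -[RHS]addrA [RHS]addrC.
Qed.

End Ord3.

(** * Barycentric coordinates in the plane *)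

Section Plane.
Context {R : realType}.
Notation plane := (R * R)%type.
Implicit Types (u v w x y : plane) (A : set plane).

Definition cross u v : R := u.1 * v.2 - u.2 * v.1.

Lemma fstD_pair x y : (x + y).1 = x.1 + y.1. Proof. by []. Qed.
Lemma sndD_pair x y : (x + y).2 = x.2 + y.2. Proof. by []. Qed.
Lemma fstN_pair x : (- x).1 = - x.1. Proof. by []. Qed.
Lemma sndN_pair x : (- x).2 = - x.2. Proof. by []. Qed.
Lemma fstZ_pair (c : R) x : (c *: x).1 = c * x.1. Proof. by []. Qed.
Lemma sndZ_pair (c : R) x : (c *: x).2 = c * x.2. Proof. by []. Qed.
Lemma fst0_pair : (0 : plane).1 = 0. Proof. by []. Qed.
Lemma snd0_pair : (0 : plane).2 = 0. Proof. by []. Qed.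

Definition pairE := (fstD_pair, sndD_pair, fstN_pair, sndN_pair, fstZ_pair,
  sndZ_pair, fst0_pair, snd0_pair).

Lemma dotDr w x y : dot w (x + y) = dot w x + dot w y.
Proof. by rewrite /dot !pairE; ring. Qed.

Lemma dotZr w (c : R) x : dot w (c *: x) = c * dot w x.
Proof. by rewrite /dot !pairE; ring. Qed.

Lemma dotBr w x y : dot w (x - y) = dot w x - dot w y.
Proof. by rewrite /dot !pairE; ring. Qed.

Lemma dotC x y : dot x y = dot y x.
Proof. by rewrite /dot; ring. Qed.

Lemma dotZl w (c : R) x : dot (c *: x) w = c * dot x w.
Proof. by rewrite /dot !pairE; ring. Qed.

Lemma dot0r w : dot w 0 = 0.
Proof. by rewrite /dot !pairE; ring. Qed.

Lemma dot0l w : dot 0 w = 0.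
Proof. by rewrite /dot !pairE; ring. Qed.

Lemma dot_ge0 x : 0 <= dot x x.
Proof. by rewrite /dot -!expr2 addr_ge0 // sqr_ge0. Qed.

Lemma dot_eq0 x : dot x x = 0 -> x = 0.
Proof.
rewrite /dot -!expr2 => /eqP; rewrite paddr_eq0 ?sqr_ge0 // !sqrf_eq0.
by case: x => x1 x2 /= /andP[/eqP-> /eqP->].
Qed.

Lemma dot_sum w (I : finType) (F : I -> plane) :
  dot w (\sum_i F i) = \sum_i dot w (F i).
Proof.
by apply: (big_morph (dot w)); [exact: dotDr | exact: dot0r].
Qed.

Lemma convex_setP A : @convex_set R plane A <->
  forall x y (t : R), A x -> A y -> 0 <= t -> t <= 1 -> A (t *: x + (1 - t) *: y).
Proof.
split=> [cA x y t Ax Ay t0 t1|cA x y k].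
  have := cA x y (Itv01 t0 t1).
  by rewrite !inE => /(_ Ax Ay).
rewrite !inE => Ax Ay; exact: (cA x y k%:num Ax Ay).
Qed.

(** Membership is asked only of points with positive weight; this is what lets [conv_hull_bary] read
    off faces from vanishing coordinates. *)
Lemma convex_sum A (I : finType) (c : I -> R) (p : I -> plane) :
  @convex_set R plane A -> (forall i, 0 <= c i) -> \sum_i c i = 1 ->
  (forall i, 0 < c i -> A (p i)) -> A (\sum_i c i *: p i).
Proof.
move=> /convex_setP cA c0 c1 Ap.
(* Partial sums of the weights do not add up to one, so the induction runs on normalized partial
   combinations. *)
suff H (r : seq I) : 0 < \sum_(i <- r) c i ->
    A ((\sum_(i <- r) c i)^-1 *: \sum_(i <- r) c i *: p i).
  by have := H (index_enum I); rewrite c1 invr1 scale1r; apply.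
elim: r => [|i r IH]; first by rewrite big_nil ltxx.
rewrite !big_cons.
set S := \sum_(j <- r) c j; set z := \sum_(j <- r) c j *: p j.
have S0 : 0 <= S by apply: sumr_ge0.
have [Sz|Sn0] := eqVneq S 0.
  have z0 : z = 0.
    rewrite /z big_seq big1 // => j jr; suff -> : c j = 0 by rewrite scale0r.
    move/eqP: Sz; rewrite /S psumr_eq0 // => /allP /(_ _ jr) /= /eqP.
    exact.
  rewrite Sz z0 !addr0 => ci0.
  by rewrite scalerA mulVf ?gt_eqF // scale1r; apply: Ap.
have Sgt0 : 0 < S by rewrite lt_def Sn0.
move=> _; have Az := IH Sgt0.
have [ci0|cin0] := eqVneq (c i) 0; first by rewrite ci0 scale0r !add0r.
have ci_gt0 : 0 < c i by rewrite lt_def cin0 c0.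
have cS : c i + S != 0 by rewrite gt_eqF // addr_gt0.
rewrite [X in A X](_ : _ = (c i / (c i + S)) *: p i + (1 - c i / (c i + S)) *: (S^-1 *: z)).
  apply: cA => //; first exact: Ap.
    by rewrite divr_ge0 // addr_ge0.
  by rewrite ler_pdivrMr ?mul1r ?lerDl // addr_gt0.
rewrite scalerDr !scalerA; congr (_ *: _ + _ *: _); first by rewrite mulrC.
by field; rewrite Sn0.
Qed.

Section Triangle.
Variable p : 'I_3 -> plane.

Definition area2 := cross (p 1 - p 0) (p 2 - p 1).

(** Ratio of two signed areas: that of the triangle in which [x] replaces vertex [l], and that of
    the whole triangle. *)
Definition bary l x := cross (p (l + 1) - x) (p (l + 2) - x) / area2.

Definition bary_grad l : plane :=
  area2^-1 *: ((p (l + 1)).2 - (p (l + 2)).2, (p (l + 2)).1 - (p (l + 1)).1).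

Definition bary_const l := cross (p (l + 1)) (p (l + 2)) / area2.

Definition tri_hull : set plane := [set x | forall l, 0 <= bary l x].

Lemma bary_affine l x : bary l x = dot (bary_grad l) x + bary_const l.
Proof.
by rewrite /bary /bary_grad /bary_const dotZl /dot /cross !pairE /=; ring.
Qed.

Lemma area2_shift l : area2 = cross (p (l + 1) - p l) (p (l + 2) - p l).
Proof.
by rewrite /area2 /cross !pairE; move: l; apply: ord3P; rewrite !ord3_addE; ring.
Qed.

Lemma bary_conv l x y (t : R) :
  bary l (t *: x + (1 - t) *: y) = t * bary l x + (1 - t) * bary l y.
Proof. by rewrite !bary_affine dotDr !dotZr; ring. Qed.

Lemma bary_lincomb l (I : finType) (c : I -> R) (q : I -> plane) :
  \sum_i c i = 1 -> bary l (\sum_i c i *: q i) = \sum_i c i * bary l (q i).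
Proof.
move=> c1; rewrite bary_affine dot_sum.
rewrite -[X in _ + X]mul1r -c1 mulr_suml -big_split /=.
by apply: eq_bigr => i _; rewrite bary_affine mulrDr dotZr.
Qed.

Hypothesis area_neq0 : area2 != 0.

Lemma bary_sum x : \sum_l bary l x = 1.
Proof.
rewrite sum3E /bary !ord3_addE -!mulrDl.
by apply: (mulIf area_neq0); rewrite mulfVK // mul1r /area2 /cross !pairE; ring.
Qed.

Lemma bary_comb x : \sum_l bary l x *: p l = x.
Proof.
rewrite sum3E /bary !ord3_addE [RHS]surjective_pairing.
rewrite [LHS]surjective_pairing !pairE.
by congr pair; apply: (mulIf area_neq0);
  move: area_neq0; rewrite /area2 /cross !pairE => h; field.
Qed.

Lemma bary_vertex l m : bary l (p m) = (l == m)%:R.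
Proof.
case: (ord3_shift l m) => ->; rewrite /bary.
- by rewrite -area2_shift divff // eqxx.
- case: (ord3_shift_neq l) => /negbTE -> _ _.
  by rewrite subrr /cross !pairE mulr0n; ring.
- case: (ord3_shift_neq l) => _ /negbTE -> _.
  by rewrite subrr /cross !pairE mulr0n; ring.
Qed.

Lemma bary_lincomb_vertex (c : 'I_3 -> R) l :
  \sum_m c m = 1 -> bary l (\sum_m c m *: p m) = c l.
Proof.
move=> c1; rewrite bary_lincomb // (bigD1 l) //= bary_vertex eqxx mulr1.
rewrite big1 ?addr0 // => m; rewrite bary_vertex eq_sym => /negbTE ->.
by rewrite mulr0.
Qed.

Lemma tri_hull_vertex m : tri_hull (p m).
Proof. by move=> l; rewrite bary_vertex ler0n. Qed.

(** The right-hand side is convex and contains the vertices in [F]. Conversely, [x] is the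
    combination of the vertices with its own coordinates as weights, and those outside [F] have
    weight zero. *)
Lemma conv_hull_bary (F : set 'I_3) x :
  conv_hull (p @` F) x <-> tri_hull x /\ (forall l, ~ F l -> bary l x = 0).
Proof.
split=> [|[xT xF]].
  suff H : conv_hull (p @` F) `<=` [set x | tri_hull x /\ forall l, ~ F l -> bary l x = 0].
    exact: H.
  apply: smallest_sub.
    apply/convex_setP => y z t [yT yF] [zT zF] t0 t1; split=> l.
      by rewrite bary_conv addr_ge0 // mulr_ge0 // subr_ge0.
    by move=> Fl; rewrite bary_conv yF // zF // !mulr0 addr0.
  move=> _ [m Fm <-]; split; first exact: tri_hull_vertex.
  by move=> l Fl; rewrite bary_vertex; case: eqP => // lm; case: Fl; rewrite lm.
move=> C [cC sC]; rewrite -(bary_comb x); apply: convex_sum => //.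
  exact: bary_sum.
move=> l lx; apply: sC; exists l => //; apply: contrapT => Fl.
by move: lx; rewrite xF // ltxx.
Qed.

End Triangle.
End Plane.

(** * Convex hulls and the vertices of simplices *)

Section Simplices.
Context {R : realType}.
Notation plane := (R * R)%type.
Implicit Types (W s : set plane) (x y : plane).

Lemma conv_hull_mono W W' : W `<=` W' -> conv_hull W `<=` conv_hull W'.
Proof. by move=> WW' x Wx A [cA W'A]; apply: Wx; split=> // y /WW' /W'A. Qed.

Lemma sub_conv_hull W : W `<=` conv_hull W.
Proof. exact: sub_smallest. Qed.

Lemma conv_hull_convex W x y (t : R) : conv_hull W x -> conv_hull W y ->
  0 <= t -> t <= 1 -> conv_hull W (t *: x + (1 - t) *: y).
Proof.
move=> Wx Wy t0 t1 A [cA sA].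
by apply: (proj1 (convex_setP A) cA) => //; [apply: Wx | apply: Wy].
Qed.

Lemma conv_hull0 : conv_hull (set0 : set plane) = set0.
Proof.
by apply/seteqP; split=> // x; apply: smallest_sub => //; apply/convex_setP.
Qed.

Lemma conv_hull_range (I : finType) (p : I -> plane) x : conv_hull (range p) x ->
  exists c : I -> R, [/\ forall i, 0 <= c i, \sum_i c i = 1 &
    x = \sum_i c i *: p i].
Proof.
suff H : conv_hull (range p) `<=` [set x | exists c : I -> R,
    [/\ forall i, 0 <= c i, \sum_i c i = 1 & x = \sum_i c i *: p i]] by exact: H.
apply: smallest_sub.
  apply/convex_setP => _ _ t [c [c0 c1 ->]] [d [d0 d1 ->]] t0 t1.
  exists (fun i => t * c i + (1 - t) * d i); split.
  - by move=> i; rewrite addr_ge0 // mulr_ge0 // subr_ge0.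
  - by rewrite big_split /= -!mulr_sumr c1 d1; ring.
  - rewrite !scaler_sumr -big_split /=; apply: eq_bigr => i _.
    by rewrite !scalerA -scalerDl.
move=> _ [i _ <-]; exists (fun j => (j == i)%:R); split.
- by move=> j; rewrite ler0n.
- by rewrite (bigD1 i) //= eqxx big1 ?addr0 // => j /negbTE ->.
- rewrite (bigD1 i) //= eqxx scale1r big1 ?addr0 // => j /negbTE ->.
  by rewrite scale0r.
Qed.

(** Vertices are extreme points, stated as convexity of the punctured simplex: this form applies
    directly to hulls, which are smallest convex sets. *)
Lemma simplex_vertex_extreme (k : nat) (p : 'I_k.+1 -> plane) i :
  affinely_independent p ->
  @convex_set R plane (conv_hull (range p) `\ p i).
Proof.
move=> pind; apply/convex_setP => x y t [px xi] [py yi] t0 t1.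
split; first exact: conv_hull_convex.
move=> /= E.
have [c [c0 c1 xE]] := conv_hull_range px.
have [d [d0 d1 yE]] := conv_hull_range py.
(* The coefficients of the combination minus those of the vertex [p i]; affine independence makes
   this difference vanish. *)
pose e j : R := t * c j + (1 - t) * d j - (j == i)%:R.
have dlt1 : \sum_(j < k.+1) (j == i)%:R = 1 :> R.
  by rewrite (bigD1 i) //= eqxx big1 ?addr0 // => j /negbTE ->.
have dltp : \sum_(j < k.+1) (j == i)%:R *: p j = p i.
  rewrite (bigD1 i) //= eqxx scale1r big1 ?addr0 // => j /negbTE ->.
  by rewrite scale0r.
have e0 : forall j, e j = 0.
  apply: pind.
    by rewrite /e big_split /= sumrN dlt1 big_split /= -!mulr_sumr c1 d1; ring.
  rewrite /e; under eq_bigr do rewrite scalerBl scalerDl -!scalerA.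
  rewrite big_split /= sumrN dltp big_split /= -!scaler_sumr -xE -yE E.
  by rewrite subrr.
have [tz|tn0] := eqVneq t 0.
  by apply: yi; rewrite -E tz scale0r add0r subr0 scale1r.
apply: xi; rewrite xE -dltp; apply: eq_bigr => j _; congr (_ *: _).
have [ji|ji] := eqVneq j i; last first.
  move: (e0 j); rewrite /e (negbTE ji) subr0 => /eqP.
  rewrite paddr_eq0 ?mulr_ge0 ?subr_ge0 // mulf_eq0 (negbTE tn0) /=.
  by move=> /andP[/eqP].
have cz : forall j, j != i -> c j = 0.
  move=> j' ji'; move: (e0 j'); rewrite /e (negbTE ji') subr0 => /eqP.
  rewrite paddr_eq0 ?mulr_ge0 ?subr_ge0 // mulf_eq0 (negbTE tn0) /=.
  by move=> /andP[/eqP].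
by move: c1; rewrite (bigD1 i) //= big1 ?addr0 // ji => ->.
Qed.

(** Were a vertex of [W] missing from [W'], the simplex without it would be a convex set containing
    [W'], hence the hull of [W'], to which the vertex belongs. *)
Lemma simplex_vertices_sub W W' s : simplex_on W s -> simplex_on W' s -> W `<=` W'.
Proof.
move=> [k [p [pind -> ->]]] [k' [p' [_ -> sE]]] _ [i _ <-].
apply: contrapT => iW'.
have : conv_hull (range p') `<=` conv_hull (range p) `\ p i.
  apply: smallest_sub; first exact: simplex_vertex_extreme.
  move=> y W'y; split; last by move=> /= yi; apply: iW'; rewrite -yi.
  by rewrite sE; apply: sub_conv_hull.
move=> /(_ (p i)); rewrite -sE => H.
by have [_] := H (sub_conv_hull (imageP p I)); exact.
Qed.

Lemma simplex_vertices_inj W W' s : simplex_on W s -> simplex_on W' s -> W = W'.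
Proof.
by move=> Ws W's; apply/seteqP; split;
  [exact: simplex_vertices_sub W's | exact: simplex_vertices_sub Ws].
Qed.

End Simplices.

(** * Admissible meshes in terms of barycentric coordinates *)

Section MeshFaces.
Context {R : realType} {N NT : nat}.
Context (Delta : {set {set 'I_N}}) (tri : 'I_NT -> 'I_3 -> 'I_N).
Notation plane := (R * R)%type.
Implicit Types (Q : 'M[R]_(2, N)) (x y : plane) (k l : 'I_NT) (F G : {set 'I_N}).

Definition pt Q k (m : 'I_3) : plane := vtx Q (tri k m).

Lemma tri_areaE Q k : tri_area tri Q k = 2^-1 * area2 (pt Q k).
Proof.
rewrite /tri_area /area; congr (_ * _).
rewrite (expand_det_row _ 0) !big_ord_recl big_ord0 /cofactor !det_mx11.
rewrite !mxE /=.
have s0 : fintype.split (0 : 'I_(1 + 1)) = inl 0.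
  by case: splitP => j /=; [rewrite (ord1 j) | rewrite add1n].
have s1 : fintype.split (1 : 'I_(1 + 1)) = inr 0.
  by case: splitP => j /=; rewrite (ord1 j).
have -> : lift ord0 ord0 = 1 :> 'I_2 by apply: val_inj.
have -> : lift 1 0 = 0 :> 'I_2 by apply: val_inj.
rewrite s0 s1 !mxE /area2 /cross /pt /vtx !pairE /= expr1.
rewrite (_ : (-1) ^+ (0 + 0) = 1) ?expr0 //.
ring.
Qed.

Lemma mem_face k m : tri k m \in face tri k.
Proof. exact: imset_f. Qed.

Lemma faceP k i : reflect (exists m, i = tri k m) (i \in face tri k).
Proof. by apply: (iffP imsetP) => [[m _ ->]|[m ->]]; exists m. Qed.

Hypothesis cc : connectivity_complex Delta.
Hypothesis en : enumerates_2faces Delta tri.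

Lemma face_kfaces k : face tri k \in kfaces Delta 2.
Proof. by apply: (en.2 _).2; exists k. Qed.

Lemma face_in_Delta k F : F \subset face tri k -> F != finset.set0 -> F \in Delta.
Proof.
move: cc => [[_ _ sub _] _ _] Fk F0; apply: sub Fk F0.
by have := face_kfaces k; rewrite inE => /andP[].
Qed.

Lemma Delta_nonempty F : F \in Delta -> F != finset.set0.
Proof. by move: cc => [[_ h _ _] _ _] FD; apply: contraNneq h => <-. Qed.

Lemma Delta_sub_face F : F \in Delta -> exists k, F \subset face tri k.
Proof.
move: cc => [_ [pure _] _] /pure[G G2 FG].
by have [k GE] := (en.2 G).1 G2; exists k; rewrite -GE.
Qed.

Lemma card_face k : #|face tri k| = 3%N.
Proof.
by have := face_kfaces k; rewrite inE => /andP[_ /eqP].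
Qed.

Lemma tri_inj k : injective (tri k).
Proof.
move=> m m'; have /imset_injP H : #|face tri k| == #|'I_3|
  by rewrite card_face card_ord.
exact: H.
Qed.

Lemma vertex_in_face i : exists k m, i = tri k m.
Proof.
move: cc => [[_ _ _ cov] _ _].
have : i \in finset.cover Delta by rewrite cov inE.
move=> /finset.bigcupP[F FD iF]; have [k Fk] := Delta_sub_face FD.
by have /faceP[m ->] := fintype.subsetP Fk _ iF; exists k, m.
Qed.

Definition triT Q k : set plane := tri_hull (pt Q k).

Definition pos_areas Q := forall k, 0 < tri_area tri Q k.

(** The complex condition reduced to pairs of 2-faces: a common point is supported on common
    vertices only. *)
Definition meets_properly Q := forall k l, k != l -> forall x,
  triT Q k x -> triT Q l x -> forall m, tri k m \notin face tri l ->
  bary (pt Q k) m x = 0.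

Lemma area2_gt0 Q k : pos_areas Q -> 0 < area2 (pt Q k).
Proof. by move=> /(_ k); rewrite tri_areaE pmulr_rgt0 // invr_gt0. Qed.

Lemma area2_neq0 Q k : pos_areas Q -> area2 (pt Q k) != 0.
Proof. by move=> /(area2_gt0 k) /gt_eqF ->. Qed.

Lemma vtx_face_image Q k F : F \subset face tri k ->
  vtx Q @` [set` F] = pt Q k @` [set m | tri k m \in F].
Proof.
move=> Fk; apply/seteqP; split=> _ [i /= iF <-].
  by have /faceP[m im] := fintype.subsetP Fk _ iF; exists m; rewrite /= ?/pt -?im.
by exists (tri k i).
Qed.

Lemma conv_face Q k F x : pos_areas Q -> F \subset face tri k ->
  conv_hull (vtx Q @` [set` F]) x <->
  triT Q k x /\ (forall m, tri k m \notin F -> bary (pt Q k) m x = 0).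
Proof.
move=> pos Fk; rewrite (vtx_face_image _ Fk) conv_hull_bary ?area2_neq0 //.
split=> -[xT xF]; split=> // m mF; apply: xF; exact/negP.
Qed.

Lemma conv_face_full Q k x : pos_areas Q ->
  conv_hull (vtx Q @` [set` face tri k]) x <-> triT Q k x.
Proof.
move=> pos; rewrite (conv_face _ pos (subxx _)); split=> [[]//|xT].
by split=> // m; rewrite mem_face.
Qed.

Lemma face_vtx_inj Q k m m' : pos_areas Q -> pt Q k m = pt Q k m' -> m = m'.
Proof.
move=> pos E; have := bary_vertex (area2_neq0 k pos) m m'.
rewrite -E bary_vertex ?area2_neq0 // eqxx; case: eqP => // _ /eqP.
by rewrite oner_eq0.
Qed.

(** Affine independence holds because the coordinates of triangle [k] are affine and dual to its
    vertices: applied to a vanishing combination they return its coefficients. *)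
Lemma simplex_face Q k F : pos_areas Q -> F \subset face tri k ->
  F != finset.set0 ->
  simplex_on (vtx Q @` [set` F]) (conv_hull (vtx Q @` [set` F])).
Proof.
move=> pos Fk F0; have : (0 < #|F|)%N by rewrite card_gt0.
case E : #|F| => [//|n] _.
have f_ (i : 'I_n.+1) : exists m, tri k m = enum_val (cast_ord (esym E) i).
  have /faceP[m ->] := fintype.subsetP Fk _ (enum_valP (cast_ord (esym E) i)).
  by exists m.
pose f i := projT1 (cid (f_ i)).
have fE i : tri k (f i) = enum_val (cast_ord (esym E) i) by rewrite /f; case: cid.
have f_inj : injective f.
  move=> i j /(congr1 (tri k)); rewrite !fE => /enum_val_inj.
  by move=> /cast_ord_inj.
exists n, (pt Q k \o f); split=> //.
- move=> c c0 cp i.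
  pose d : 'I_n.+1 -> R := fun j => c j * bary (pt Q k) (f i) (pt Q k (f j)).
  have ci : c i = \sum_j d j.
    rewrite (bigD1 i) //= /d bary_vertex ?area2_neq0 // eqxx mulr1 big1 ?addr0 //.
    move=> j ji; rewrite bary_vertex ?area2_neq0 // (inj_eq f_inj) eq_sym.
    by rewrite (negbTE ji) mulr0.
  rewrite ci /d; under eq_bigr do rewrite bary_affine mulrDr -dotZr.
  rewrite big_split /= -mulr_suml c0 mul0r addr0 -dot_sum.
  by rewrite (_ : \sum_i _ = 0) ?dot0r.
- apply/seteqP; split=> _ [i /= iF <-].
    exists (cast_ord E (enum_rank_in iF i)) => //=.
    by rewrite /pt fE cast_ordK enum_rankK_in.
  by exists (tri k (f i)) => //=; rewrite fE enum_valP.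
Qed.

(** Coordinates indexed by global vertices, so that those of different triangles can be compared; on
    triangle [k] this is the hat function of [i]. *)
Definition weight Q k (i : 'I_N) x : R := \sum_(m | tri k m == i) bary (pt Q k) m x.

Lemma weight_tri Q k m x : weight Q k (tri k m) x = bary (pt Q k) m x.
Proof. by rewrite /weight (big_pred1 m) // => m'; rewrite /= (inj_eq (@tri_inj k)). Qed.

Lemma weight_notin Q k i x : i \notin face tri k -> weight Q k i x = 0.
Proof.
move=> ik; rewrite /weight big_pred0 // => m; apply/negbTE.
by apply: contraNneq ik => <-; exact: mem_face.
Qed.

Lemma weight_sum Q k x : pos_areas Q -> \sum_i weight Q k i x = 1.
Proof.
move=> pos; rewrite -(bary_sum (area2_neq0 k pos) x).
by rewrite (partition_big (tri k) xpredT).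
Qed.

Lemma weight_comb Q k x : pos_areas Q -> \sum_i weight Q k i x *: vtx Q i = x.
Proof.
move=> pos; rewrite -[RHS](bary_comb (area2_neq0 k pos) x).
rewrite [RHS](partition_big (tri k) xpredT) //=; apply: eq_bigr => i _.
by rewrite /weight scaler_suml; apply: eq_bigr => m /eqP <-.
Qed.

(** Write [x] with its weights in [k]. Vertices outside [l] drop out by [meets_properly], and a
    coordinate of [l] applied to the rest returns the weight in [k]. The same fact later makes nodal
    interpolation well defined. *)
Lemma weight_eq Q k l x i : pos_areas Q -> meets_properly Q ->
  triT Q k x -> triT Q l x -> weight Q k i x = weight Q l i x.
Proof.
move=> pos INT xk xl; have [<-//|kl] := eqVneq k l.
have [/faceP[m ->]|il] := boolP (i \in face tri l); last first.
  rewrite [RHS]weight_notin //.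
  have [/faceP[m im]|] := boolP (i \in face tri k); last exact: weight_notin.
  by rewrite im weight_tri (INT _ _ kl) // -im.
rewrite weight_tri -[in RHS](weight_comb k x pos).
rewrite bary_lincomb ?weight_sum // (bigD1 (tri l m)) //=.
rewrite -[vtx Q _]/(pt Q l m) bary_vertex ?area2_neq0 // eqxx mulr1.
rewrite big1 ?addr0 // => j jm.
have [/faceP[m' jm']|jl] := boolP (j \in face tri l).
  rewrite jm' -[vtx Q _]/(pt Q l m') bary_vertex ?area2_neq0 //.
  have mm' : m != m' by apply: contraNneq jm => ->; rewrite jm'.
  by rewrite (negbTE mm') mulr0.
have [/faceP[m' jm']|] := boolP (j \in face tri k); last first.
  by move=> ?; rewrite weight_notin // mul0r.
by rewrite jm' weight_tri (INT _ _ kl) ?mul0r // -jm'.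
Qed.

(** A vertex has weight one in its own triangle, hence by [weight_eq] also in any other triangle
    that contains it. *)
Lemma proper_vertex Q i k : pos_areas Q -> meets_properly Q ->
  triT Q k (vtx Q i) -> i \in face tri k.
Proof.
move=> pos INT ik; have [l [m im]] := vertex_in_face i; subst i.
have il : triT Q l (pt Q l m) by apply: tri_hull_vertex; exact: area2_neq0.
apply: contraT => /weight_notin H; have := H Q (pt Q l m).
rewrite (weight_eq _ pos INT ik il) weight_tri bary_vertex ?area2_neq0 // eqxx.
by move=> /eqP; rewrite oner_eq0.
Qed.

Lemma proper_vtx_inj Q : pos_areas Q -> meets_properly Q -> injective (vtx Q).
Proof.
move=> pos INT i j ij; have [l [m im]] := vertex_in_face i; subst i.
have il : triT Q l (pt Q l m) by apply: tri_hull_vertex; exact: area2_neq0.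
have /faceP[m' jm] : j \in face tri l by apply: (proper_vertex pos INT); rewrite -ij.
by rewrite jm; congr tri; apply: (face_vtx_inj pos (k := l)); rewrite /pt -jm.
Qed.

Lemma conv_faceI Q k l F G : pos_areas Q -> meets_properly Q ->
  F \subset face tri k -> G \subset face tri l ->
  conv_hull (vtx Q @` [set` F]) `&` conv_hull (vtx Q @` [set` G]) =
  conv_hull (vtx Q @` [set` F :&: G]%SET).
Proof.
move=> pos INT Fk Gl; apply/seteqP; split=> [x [xF xG]|x]; last first.
  move=> xFG; split; apply: conv_hull_mono xFG; apply: classical_sets.image_subset => i /=;
  by rewrite inE => /andP[].
have FGk : (F :&: G)%SET \subset face tri k.
  by apply: fintype.subset_trans Fk; exact: finset.subsetIl.
have [xk xF0] := (conv_face x pos Fk).1 xF.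
have [xl xG0] := (conv_face x pos Gl).1 xG.
apply/(conv_face x pos FGk); split=> // m.
rewrite inE negb_and => /orP[/xF0//|mG].
rewrite -weight_tri (weight_eq _ pos INT xk xl).
have [/faceP[m' E]|/weight_notin -> //] := boolP (tri k m \in face tri l).
by rewrite E weight_tri xG0 // -E.
Qed.

(** In a geometric complex two triangles meet in a face of both; its vertices are determined by it,
    so they are common, and all other coordinates vanish on it. Conversely [conv_faceI] identifies
    the intersection of two faces with the hull of their common vertices. *)
Lemma Mplus_proper Q : Mplus Delta tri Q <-> pos_areas Q /\ meets_properly Q.
Proof.
split=> [[[_ _ _ geo] inj _ pos]|[pos INT]].
  split=> // k l kl x xk xl m ml.
  pose S k := conv_hull (vtx Q @` [set` face tri k]).
  have SD k' : Sigma Delta Q (S k').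
    exists (face tri k') => //=; apply: (face_in_Delta (subxx _)).
    by rewrite -finset.card_gt0 card_face.
  have Ssimp k' : simplex_on (vtx Q @` [set` face tri k']) (S k').
    by apply: (simplex_face pos (subxx _)); rewrite -finset.card_gt0 card_face.
  have Sx : (S k `&` S l) x by split; apply/(conv_face_full _ _ pos).
  have [S0|[fk fl]] := geo _ _ (SD k) (SD l); first by rewrite S0 in Sx.
  (* [face_of] speaks of sets of points; since a simplex determines its vertices, such a face comes
     from a set of indices. *)
  have sub k' : face_of (S k `&` S l) (S k') -> exists F, [/\ F \subset face tri k',
      F != finset.set0 & S k `&` S l = conv_hull (vtx Q @` [set` F])].
    move=> [W [W' [Ws W'W W'0 ->]]].
    have WE := simplex_vertices_inj Ws (Ssimp k').
    exists [set i in face tri k' | `[< W' (vtx Q i) >]]%SET; split.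
    - by apply/fintype.subsetP => i; rewrite inE => /andP[].
    - case: W'0 => y W'y; have := W'W _ W'y; rewrite WE => -[i /= ik yi].
      apply/finset.set0Pn; exists i; rewrite inE ik /=; apply/asboolP.
      by rewrite yi.
    - congr conv_hull; apply/seteqP; split=> [y W'y|_ [i /= + <-]].
        have := W'W _ W'y; rewrite WE => -[i /= ik yi]; exists i => //=.
        by rewrite inE ik /=; apply/asboolP; rewrite yi.
      by rewrite inE => /andP[_ /asboolP].
  have [F [Fk F0 FE]] := sub _ fk.
  have [G [Gl G0 GE]] := sub _ fl.
  have Fs := simplex_face pos Fk F0; have Gs := simplex_face pos Gl G0.
  rewrite -FE in Fs; rewrite -GE in Gs.
  have FG := simplex_vertices_inj Fs Gs.
  move: Sx; rewrite FE => /(conv_face x pos Fk)[_]; apply.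
  apply: contra ml => mF; apply: (fintype.subsetP Gl).
  have : (vtx Q @` [set` G]) (vtx Q (tri k m)) by rewrite -FG; exists (tri k m).
  by move=> [i /= iG /inj <-].
have inj := proper_vtx_inj pos INT.
have simp F : F \in Delta -> simplex_on (vtx Q @` [set` F]) (conv_hull (vtx Q @` [set` F])).
  move=> FD; have [k Fk] := Delta_sub_face FD.
  by apply: simplex_face Fk (Delta_nonempty FD).
have sub F W' : W' `<=` vtx Q @` [set` F] -> W' !=set0 -> exists F',
    [/\ F' \subset F, F' != finset.set0 & W' = vtx Q @` [set` F']].
  move=> W'W [y W'y]; exists [set i in F | `[< W' (vtx Q i) >]]%SET; split.
  - by apply/fintype.subsetP => i; rewrite inE => /andP[].
  - have [i /= ik yi] := W'W _ W'y.
    apply/finset.set0Pn; exists i; rewrite inE ik /=; apply/asboolP.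
    by rewrite yi.
  - apply/seteqP; split=> [z W'z|_ [i /= + <-]].
      have [i /= ik yi] := W'W _ W'z; exists i => //=.
      by rewrite inE ik /=; apply/asboolP; rewrite yi.
    by rewrite inE => /andP[_ /asboolP].
split=> //.
  split.
  - exact: finite_image.
  - by move=> _ [F /= FD <-]; exists (vtx Q @` [set` F]); exact: simp.
  - move=> _ t [F /= FD <-] [W [W' [Ws W'W W'0 ->]]].
    have WE := simplex_vertices_inj Ws (simp _ FD); rewrite WE in W'W.
    have [F' [F'F F'0 ->]] := sub _ _ W'W W'0.
    have [k Fk] := Delta_sub_face FD.
    exists F' => //=; apply: (face_in_Delta _ F'0); exact: fintype.subset_trans Fk.
  - move=> _ _ [F /= FD <-] [G /= GD <-].
    have [k Fk] := Delta_sub_face FD; have [l Gl] := Delta_sub_face GD.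
    rewrite (conv_faceI pos INT Fk Gl).
    have [->|FG0] := eqVneq (F :&: G)%SET finset.set0.
      left; rewrite (_ : [set` _] = set0) ?image_set0 ?conv_hull0 //.
      by apply/seteqP; split=> // i /=; rewrite inE.
    right; have [i iFG] := finset.set0Pn _ FG0; split.
      exists (vtx Q @` [set` F]), (vtx Q @` [set` F :&: G]%SET); split=> //.
      + exact: simp.
      + by apply: classical_sets.image_subset => j /=; rewrite inE => /andP[].
      + by exists (vtx Q i), i.
    exists (vtx Q @` [set` G]), (vtx Q @` [set` F :&: G]%SET); split=> //.
    + exact: simp.
    + by apply: classical_sets.image_subset => j /=; rewrite inE => /andP[].
    + by exists (vtx Q i), i.
apply/seteqP; split=> [W [_ [F /= FD <-] Ws]|_ [F /= FD <-]].
  by exists F => //=; apply: simplex_vertices_inj (simp _ FD) Ws.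
by exists (conv_hull (vtx Q @` [set` F])); [exists F | exact: simp].
Qed.

End MeshFaces.

(** * Gordan's alternative in the plane *)

Section Gordan.
Context {R : realType}.
Notation plane := (R * R)%type.

Lemma sum_pair (I : finType) (F : I -> plane) :
  \sum_i F i = (\sum_i (F i).1, \sum_i (F i).2).
Proof.
rewrite [LHS]surjective_pairing; congr pair.
  exact: (big_morph (@fst R R) fstD_pair fst0_pair).
exact: (big_morph (@snd R R) sndD_pair snd0_pair).
Qed.

Lemma cvg_sumr (T : Type) (F : set_system T) (FF : Filter F) (I : finType)
    (f : I -> T -> R) (l : I -> R) :
  (forall i, f i t @[t --> F] --> l i) ->
  \sum_i f i t @[t --> F] --> \sum_i l i.
Proof.
by move=> fl; apply: (@cvg_big R I _ _ xpredT add_continuous).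
Qed.

Lemma continuous_sum (T : topologicalType) (I : finType) (f : I -> T -> R) :
  (forall i, continuous (f i)) -> continuous (fun x => \sum_i f i x).
Proof. by move=> cf x; apply: cvg_sumr => i; exact: cf. Qed.

(* If 0 is not in the convex hull of the vectors, its nearest point in the hull
   is the required functional. *)
Lemma gordan (I : finType) (P : pred I) (z : I -> plane) :
  (forall c : I -> R, (forall i, 0 <= c i) -> (forall i, ~~ P i -> c i = 0) ->
     \sum_i c i = 1 -> \sum_i c i *: z i != 0) ->
  exists w : plane, forall i, P i -> 0 < dot w (z i).
Proof.
move=> nz; have [[i0 Pi0]|/forallNP noP] := pselect (exists i, P i); last first.
  by exists 0 => i /noP.
pose n := #|I|.
pose cf (v : 'rV[R]_n) i : R := v 0 (enum_rank i).
(* The simplex of coefficients supported on [P], encoded as row vectors to obtain compactness from a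
   product of intervals. *)
pose A := [set v : 'rV[R]_n | (forall j, `[0, 1]%classic (v 0 j)) /\
  (\sum_i cf v i = 1 /\ forall i, ~~ P i -> cf v i = 0)].
have ccf i : continuous (cf^~ i) by exact: coord_continuous.
have cA : compact A.
  apply: (@subclosed_compact _ A
    [set v : 'rV[R]_n | forall j, `[0, 1]%classic (v 0 j)]).
  - apply: closedI; [|apply: closedI].
    + rewrite [X in closed X](_ : _ = \bigcap_(j in [set: 'I_n])
          ((fun v : 'rV[R]_n => v 0 j) @^-1` `[0, 1]%classic)).
        apply: closed_bigI => j _; apply: preimage_closed.
          by move=> ? _; exact: coord_continuous.
        exact: interval_closed.
      by apply/seteqP; split=> [v vA j _|v vA j]; [exact: vA | exact: (vA j)].
    + apply: (@preimage_closed _ _ (fun v => \sum_i cf v i) [set x : R | x = 1]).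
        by move=> ? _; exact: continuous_sum.
      exact: closed_eq.
    + rewrite [X in closed X](_ : _ = \bigcap_(i in [set i | ~~ P i])
          ((cf^~ i) @^-1` [set x : R | x = 0])).
        apply: closed_bigI => j _; apply: preimage_closed.
          by move=> v _; exact: (ccf j v).
        exact: closed_eq.
      by apply/seteqP; split=> [v vA j|v vA j]; exact: vA.
  - have h := @rV_compact R n (fun=> `[0, 1]%classic) (fun _ => @segment_compact _ _ _).
    exact: h.
  - by move=> v [].
pose comb (c : I -> R) := \sum_i c i *: z i.
pose f v := dot (comb (cf v)) (comb (cf v)).
have fc : continuous f.
  have E v : f v = (\sum_i cf v i * (z i).1) * (\sum_i cf v i * (z i).1) +
     (\sum_i cf v i * (z i).2) * (\sum_i cf v i * (z i).2).
    by rewrite /f /comb sum_pair /dot.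
  rewrite (_ : f = fun v => (\sum_i cf v i * (z i).1) * (\sum_i cf v i * (z i).1) +
     (\sum_i cf v i * (z i).2) * (\sum_i cf v i * (z i).2)); last exact/funext.
  have H (b : I -> R) : continuous (fun v => \sum_i cf v i * b i).
    apply: continuous_sum => i v; exact: (cvgM (ccf i v) (cvg_cst (b i))).
  move=> v; exact: (cvgD (cvgM (H _ v) (H _ v)) (cvgM (H _ v) (H _ v))).
have A0 : A !=set0.
  exists (\row_j (j == enum_rank i0)%:R); split=> [j|].
    by rewrite /= mxE in_itv /=; case: eqP => _; rewrite ?lexx ?ler01.
  split.
    rewrite (bigD1 i0) //= /cf mxE eqxx big1 ?addr0 // => i.
    by rewrite mxE (inj_eq enum_rank_inj) => /negbTE ->.
  move=> i; rewrite /cf mxE (inj_eq enum_rank_inj).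
  by case: eqP => // ->; rewrite Pi0.
have [v + vmin] := compact_EVT_min A0 cA (continuous_subspaceT fc).
rewrite inE => -[v01 [v1 vP]].
set w := comb (cf v).
have v0 i : 0 <= cf v i by have := v01 (enum_rank i); rewrite /= in_itv /= => /andP[].
have w0 : 0 < dot w w.
  rewrite lt_def dot_ge0 andbT; apply/eqP => /dot_eq0 /eqP.
  by apply/negP; apply: nz.
(* Minimality gives the stronger bound [dot w w <= dot w (z i)]. *)
exists w => i Pi; apply: (lt_le_trans w0).
rewrite leNgt; apply/negP => wi.
have key t : 0 <= t -> t <= 1 ->
    dot w w <= dot ((1 - t) *: w + t *: z i) ((1 - t) *: w + t *: z i).
  move=> t0 t1.
  pose c j := (1 - t) * cf v j + t * (j == i)%:R.
  pose u : 'rV[R]_n := \row_j c (enum_val j).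
  have cfu j : cf u j = c j by rewrite /cf mxE enum_rankK.
  have c0 j : 0 <= c j.
    by rewrite addr_ge0 // mulr_ge0 ?ler0n // subr_ge0.
  have c1 : \sum_j c j = 1.
    rewrite big_split /= -!mulr_sumr v1 (bigD1 i) //= eqxx big1.
      by rewrite addr0 !mulr1 subrK.
    by move=> j /negbTE ->.
  have uA : A u.
    split=> [j|]; last split.
    - rewrite /= in_itv /= mxE c0 /= -c1 (bigD1 (enum_val j)) //= lerDl.
      exact: sumr_ge0.
    - by under eq_bigr do rewrite cfu.
    - move=> j nP; rewrite cfu /c vP // mulr0 add0r.
      by case: eqP nP => [->|]; rewrite ?Pi ?mulr0.
  have := vmin u; rewrite inE => /(_ uA).
  suff -> : f u = dot ((1 - t) *: w + t *: z i) ((1 - t) *: w + t *: z i) by [].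
  suff E : comb (cf u) = (1 - t) *: w + t *: z i by rewrite /f E.
  rewrite /comb /w /comb scaler_sumr.
  have -> : t *: z i = \sum_j (t * (j == i)%:R) *: z j.
    rewrite (bigD1 i) //= eqxx mulr1 big1 ?addr0 // => j /negbTE ->.
    by rewrite mulr0 scale0r.
  by rewrite -big_split /=; apply: eq_bigr => j _; rewrite cfu scalerA -scalerDl.
(* A small step t from the nearest point w towards z i would decrease the norm
   if dot w (z i) < dot w w. *)
pose b := dot w (z i); pose d := dot w w; pose e := dot (z i) (z i).
have e0 : 0 <= e by exact: dot_ge0.
have bd : b < d by [].
(* Without the last summand of the denominator this would be the minimizer along the line, possibly
   beyond 1; the extra [d - b] ensures [t <= 1] and a positive denominator. *)
pose t := (d - b) / (d + e - 2 * b + (d - b)).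
have den : 0 <= d + e - 2 * b.
  suff -> : d + e - 2 * b = dot (w - z i) (w - z i) by exact: dot_ge0.
  by rewrite /d /e /b /dot !pairE; ring.
have den' : 0 < d + e - 2 * b + (d - b) by lra.
have t0 : 0 < t by rewrite divr_gt0 // subr_gt0.
have t1 : t <= 1 by rewrite ler_pdivrMr // mul1r; lra.
have := key t (ltW t0) t1.
have -> : dot ((1 - t) *: w + t *: z i) ((1 - t) *: w + t *: z i) =
  d - 2 * t * (d - b) + t * (t * (d + e - 2 * b)).
  by rewrite /d /e /b /dot !pairE; ring.
have tE : t * (d + e - 2 * b) = (d - b) - t * (d - b).
  by rewrite /t; field; rewrite gt_eqF.
rewrite tE -/d; have : 0 < t * (d - b) by rewrite mulr_gt0 // subr_gt0.
have : 0 <= t * (t * (d - b))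
  by apply: mulr_ge0 (ltW t0) (mulr_ge0 (ltW t0) _); rewrite subr_ge0 ltW.
lra.
Qed.

End Gordan.

(** * Strict separation of triangles *)

Section Separation.
Context {R : realType} {N NT : nat}.
Context (Delta : {set {set 'I_N}}) (tri : 'I_NT -> 'I_3 -> 'I_N).
Notation plane := (R * R)%type.
Implicit Types (Q : 'M[R]_(2, N)) (x y : plane) (k l : 'I_NT) (F G : {set 'I_N}).
Hypothesis cc : connectivity_complex Delta.
Hypothesis en : enumerates_2faces Delta tri.
Hypothesis co : consistently_oriented tri.

Local Notation pt := (@pt R N NT tri).
Local Notation triT := (@triT R N NT tri).

(** The weak inequality, applied to two shared vertices in both orders, puts all shared vertices on
    one level line of [w]; every other pair is separated strictly. *)
Definition separating Q k l (w : plane) := forall m m',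
  dot w (pt Q l m') <= dot w (pt Q k m) /\
  ((tri k m \notin face tri l) || (tri l m' \notin face tri k) ->
   dot w (pt Q l m') < dot w (pt Q k m)).

Lemma nonshared_vertex k l : k != l -> exists m, tri k m \notin face tri l.
Proof.
move=> kl; apply/existsP; apply: contraNT kl => /existsPn sub.
apply/eqP/en.1/eqP; rewrite eqEcard !(card_face en) leqnn andbT.
by apply/fintype.subsetP => i /faceP[m ->]; have := sub m; rewrite negbK.
Qed.

Lemma induces_next k m : induces tri k (tri k m) (tri k (m + 1)).
Proof. by apply/existsP; exists m; rewrite !eqxx. Qed.

(* Since the areas are positive, two triangles lie on opposite sides of a
   common edge. *)
Lemma shared_edge_separated Q k l m : pos_areas tri Q -> k != l ->
  tri k m \in face tri l -> tri k (m + 1) \in face tri l ->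
  exists w, separating Q k l w.
Proof.
move=> pos kl ml m1l.
have /existsP[n /andP[/eqP nE /eqP n1E]] :
    induces tri l (tri k (m + 1)) (tri k m).
  apply: (co kl (induces_next k m)).
  by apply/fintype.subsetP => i; rewrite !inE => /orP[] /eqP ->.
pose d := vtx Q (tri k (m + 1)) - vtx Q (tri k m).
exists (- d.2, d.1).
have dotE x : dot (- d.2, d.1) x = cross d x by rewrite /dot /cross /=; ring.
have m2l : tri k (m + 2) \notin face tri l.
  have [m' m'l] := nonshared_vertex kl; move: m'l.
  by case: (ord3_shift m m') => -> //; rewrite ?ml ?m1l.
have n2k : tri l (n + 2) \notin face tri k.
  have lk : l != k by rewrite eq_sym.
  have [m' m'l] := nonshared_vertex lk; move: m'l.
  by case: (ord3_shift n m') => -> //; rewrite ?nE ?n1E mem_face.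
have e1 : cross d (vtx Q (tri k (m + 1))) = cross d (vtx Q (tri k m)).
  by rewrite /d /cross !pairE; ring.
have e2 : cross d (vtx Q (tri k m)) < cross d (vtx Q (tri k (m + 2))).
  have := area2_gt0 k pos; rewrite (area2_shift _ m) => h.
  rewrite -subr_gt0 (_ : _ - _ = cross (pt Q k (m + 1) - pt Q k m)
    (pt Q k (m + 2) - pt Q k m)); first exact: h.
  by rewrite /pt /d /cross !pairE; ring.
have e3 : cross d (vtx Q (tri l (n + 2))) < cross d (vtx Q (tri k m)).
  have := area2_gt0 l pos; rewrite (area2_shift _ n) => h.
  rewrite -subr_gt0 (_ : _ - _ = cross (pt Q l (n + 1) - pt Q l n)
    (pt Q l (n + 2) - pt Q l n)); first exact: h.
  by rewrite /pt nE n1E /d /cross !pairE; ring.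
move=> i j; rewrite !dotE /pt.
case: (ord3_shift m i) => ->; case: (ord3_shift n j) => ->;
  rewrite ?nE ?n1E ?e1 ?mem_face ?ml ?m1l /=; split=> //.
all: try by rewrite ltW // (lt_trans e3).
all: by move=> _; rewrite ?e2 ?e3 // (lt_trans e3).
Qed.

(** Any two vertices of a triangle are consecutive in one order or the other, so without a common
    edge at most one vertex is shared. *)
Lemma shared_vertex_unique k l m n :
  ~~ [exists m, (tri k m \in face tri l) && (tri k (m + 1) \in face tri l)] ->
  tri k m \in face tri l -> tri l n \in face tri k -> tri k m = tri l n.
Proof.
move=> /existsPn one ml /faceP[m' E]; rewrite E.
have m'l : tri k m' \in face tri l by rewrite -E mem_face.
congr tri; case: (ord3_shift m m') => // m'E.
  by have := one m; rewrite ml -m'E m'l.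
by have := one m'; rewrite m'l m'E ord3_add2_1 ml.
Qed.

(** A common edge is itself the separating line. Otherwise Gordan's alternative is applied to the
    differences over pairs of vertices that are not both shared: a vanishing convex combination
    would be a common point with weight on a vertex that is not shared. The one shared vertex gives
    equality. *)
Lemma proper_separated Q k l : pos_areas tri Q -> meets_properly tri Q -> k != l ->
  exists w, separating Q k l w.
Proof.
move=> pos INT kl.
have [/existsP[m /andP[ml m1l]]|one] :=
  boolP [exists m, (tri k m \in face tri l) && (tri k (m + 1) \in face tri l)].
  exact: shared_edge_separated ml m1l.
pose P (ij : 'I_3 * 'I_3) :=
  (tri k ij.1 \notin face tri l) || (tri l ij.2 \notin face tri k).
pose z (ij : 'I_3 * 'I_3) : plane := pt Q k ij.1 - pt Q l ij.2.
have [c c0 cP c1|w wP] := @gordan _ _ P z.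
  apply/eqP => cz.
  (* The marginals of [c] are the coordinates of the common point [x] in the two triangles. *)
  pose al i := \sum_j c (i, j); pose be j := \sum_i c (i, j).
  pose x := \sum_i al i *: pt Q k i.
  have xE : x = \sum_j be j *: pt Q l j.
    apply: subr0_eq; rewrite -[RHS]cz /x /al /be.
    under eq_bigr do rewrite scaler_suml.
    under [X in _ - X]eq_bigr do rewrite scaler_suml.
    rewrite [X in _ - X]exchange_big /= !pair_big /= -sumrB.
    by apply: eq_bigr => -[i j] _; rewrite /z scalerBr.
  have al1 : \sum_i al i = 1.
    by rewrite /al pair_big /= -c1; apply: eq_bigr => -[].
  have be1 : \sum_j be j = 1.
    by rewrite /be exchange_big pair_big /= -c1; apply: eq_bigr => -[].
  have bk i : bary (pt Q k) i x = al i.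
    by rewrite bary_lincomb_vertex // (area2_neq0 k pos).
  have bl j : bary (pt Q l) j x = be j.
    by rewrite xE bary_lincomb_vertex // (area2_neq0 l pos).
  have xk : triT Q k x by move=> i; rewrite bk sumr_ge0.
  have xl : triT Q l x by move=> i; rewrite bl sumr_ge0.
  have lk : l != k by rewrite eq_sym.
  suff c_eq0 ij : c ij = 0 by move: c1; rewrite big1 // => /eqP; rewrite eq_sym oner_eq0.
  have [/orP[ik|jl]|/cP //] := boolP (P ij).
    have := INT _ _ kl _ xk xl _ ik; rewrite bk /al => /eqP.
    rewrite psumr_eq0 // => /allP /(_ ij.2); rewrite mem_index_enum => /(_ isT) /=.
    by case: ij {ik} => i j /= /eqP.
  have := INT _ _ lk _ xl xk _ jl; rewrite bl /be => /eqP.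
  rewrite psumr_eq0 // => /allP /(_ ij.1); rewrite mem_index_enum => /(_ isT) /=.
  by case: ij {jl} => i j /= /eqP.
exists w => m m'.
have H : P (m, m') -> dot w (pt Q l m') < dot w (pt Q k m).
  by move=> /wP; rewrite /z /= dotBr subr_gt0.
split; last exact: H.
have [/H/ltW //|] := boolP (P (m, m')); rewrite /P /= negb_or !negbK => /andP[ml m'k].
by rewrite /pt (shared_vertex_unique one ml m'k).
Qed.

(** For a common point, the gaps [dot w (pt Q k i) - dot w (pt Q l j)] averaged with the products of
    its coordinates give zero. All terms are nonnegative, so a strict gap forces a vanishing
    weight. *)
Lemma separated_proper Q : pos_areas tri Q ->
  (forall k l, k != l -> exists w, separating Q k l w) -> meets_properly tri Q.
Proof.
move=> pos sep k l kl x xk xl m ml; have [w wP] := sep _ _ kl.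
have E : \sum_i \sum_j bary (pt Q k) i x * bary (pt Q l) j x *
    (dot w (pt Q k i) - dot w (pt Q l j)) = 0.
  transitivity (\sum_i bary (pt Q k) i x * (dot w (pt Q k i) - dot w x)).
    apply: eq_bigr => i _.
    under eq_bigr do rewrite -mulrA mulrBr.
    rewrite -mulr_sumr; congr (_ * _).
    rewrite sumrB -mulr_suml bary_sum ?(area2_neq0 l pos) // mul1r; congr (_ - _).
    rewrite -[in RHS](bary_comb (area2_neq0 l pos) x) dot_sum.
    by apply: eq_bigr => j _; rewrite dotZr.
  under eq_bigr do rewrite mulrBr.
  rewrite sumrB -mulr_suml bary_sum ?(area2_neq0 k pos) // mul1r; apply/eqP.
  rewrite subr_eq0 -[in X in _ == X](bary_comb (area2_neq0 k pos) x) dot_sum.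
  by apply/eqP/eq_bigr => j _; rewrite dotZr.
have ge0 i j : 0 <= bary (pt Q k) i x * bary (pt Q l) j x *
    (dot w (pt Q k i) - dot w (pt Q l j)).
  apply: mulr_ge0; first by apply: mulr_ge0; [exact: xk | exact: xl].
  by rewrite subr_ge0; case: (wP i j).
apply/eqP; apply: contraT => bm.
suff : \sum_j bary (pt Q l) j x = 0.
  by rewrite bary_sum ?(area2_neq0 l pos) // => /eqP; rewrite oner_eq0.
apply: big1 => j _; move/eqP: E; rewrite psumr_eq0; last first.
  by move=> i _; apply: sumr_ge0.
move=> /allP /(_ m); rewrite mem_index_enum => /(_ isT) /=.
rewrite psumr_eq0 // => /allP /(_ j); rewrite mem_index_enum => /(_ isT) /=.
rewrite mulf_eq0 => /orP[|].
  by rewrite mulf_eq0 (negbTE bm) /= => /eqP.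
by rewrite subr_eq0 gt_eqF //; case: (wP m j) => _; apply; rewrite ml.
Qed.

Lemma Mplus_separated Q : Mplus Delta tri Q <->
  pos_areas tri Q /\ forall k l, k != l -> exists w, separating Q k l w.
Proof.
rewrite (Mplus_proper cc en); split=> -[pos H]; split=> //.
  by move=> k l; exact: proper_separated.
exact: separated_proper.
Qed.

End Separation.

(** * The star of an interior vertex *)

Section Star.
Context {R : realType} {N NT : nat}.
Context (Delta : {set {set 'I_N}}) (tri : 'I_NT -> 'I_3 -> 'I_N).
Notation plane := (R * R)%type.
Implicit Types (Q : 'M[R]_(2, N)) (x y : plane) (k l : 'I_NT) (F G : {set 'I_N}).
Hypothesis cc : connectivity_complex Delta.
Hypothesis en : enumerates_2faces Delta tri.
Hypothesis co : consistently_oriented tri.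

Local Notation pt := (@pt R N NT tri).
Local Notation triT := (@triT R N NT tri).

Lemma interior_edge k m : (tri k m, tri k (m + 1)) \notin boundary_edges tri ->
  exists k' n, [/\ k' != k, tri k' n = tri k (m + 1) & tri k' (n + 1) = tri k m].
Proof.
rewrite inE /= negb_and => /orP[/existsPn /(_ k)|].
  by rewrite induces_next.
set K := [set _ | _]%SET => cK.
have kK : k \in K.
  rewrite inE; apply/fintype.subsetP => i.
  by rewrite !inE => /orP[] /eqP ->; rewrite mem_face.
have [k' k'K kk'] : exists2 k', k' \in K & k' != k.
  apply/exists_inP; apply: contraR cK => /exists_inPn h.
  apply/eqP; rewrite -(cards1 k); apply: eq_card => k'; rewrite [RHS]inE.
  by apply/idP/eqP => [/h|->//]; rewrite negbK => /eqP.
rewrite inE in k'K; have kk'2 : k != k' by rewrite eq_sym.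
have /existsP[n /andP[/eqP E1 /eqP E2]] := co kk'2 (induces_next tri k m) k'K.
by exists k', n.
Qed.

Lemma boundary_edge_vertices e : e \in boundary_edges tri ->
  e.1 \in boundary_vertices tri /\ e.2 \in boundary_vertices tri.
Proof.
by move=> eB; split; rewrite inE; apply/existsP; exists e; rewrite eB eqxx ?orbT.
Qed.

Lemma boundary_vertexP i : reflect
  (exists2 e, e \in boundary_edges tri & i = e.1 \/ i = e.2)
  (i \in boundary_vertices tri).
Proof.
rewrite inE; apply: (iffP existsP) => [[e /andP[eB /orP[] /eqP ie]]|[e eB ie]].
- by exists e; [|left].
- by exists e; [|right].
- by exists e; rewrite eB; case: ie => ->; rewrite eqxx ?orbT.
Qed.

Lemma boundary_edge_face e : e \in boundary_edges tri ->
  exists k m, e.1 = tri k m /\ e.2 = tri k (m + 1).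
Proof.
rewrite inE => /andP[/existsP[k /existsP[m /andP[/eqP E1 /eqP E2]]] _].
by exists k, m.
Qed.

Section FixQ.
Variable Q : 'M[R]_(2, N).
Hypothesis pos : pos_areas tri Q.

Let a0 k : area2 (pt Q k) != 0 := area2_neq0 k pos.

(** Both coordinates are affine and vanish on the line through the common edge, hence are
    proportional. The negative factor says that leaving [k] through the edge means entering the side
    of [k']. *)
Lemma bary_across k m k' n y :
  tri k' n = tri k (m + 1) -> tri k' (n + 1) = tri k m ->
  bary (pt Q k') (n + 2) y =
    - (area2 (pt Q k) / area2 (pt Q k')) * bary (pt Q k) (m + 2) y.
Proof.
move=> E1 E2; rewrite /bary !ord3_add2_1 !ord3_add2_2 /pt E1 E2.
rewrite -[X in _ = - (X / _) * _]/(area2 (pt Q k)).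
rewrite /cross !pairE; field; by rewrite ?a0.
Qed.

Lemma bary_along k m k' n x :
  tri k' n = tri k (m + 1) -> tri k' (n + 1) = tri k m ->
  bary (pt Q k) (m + 2) x = 0 ->
  bary (pt Q k') n x = bary (pt Q k) (m + 1) x /\
  bary (pt Q k') (n + 1) x = bary (pt Q k) m x.
Proof.
move=> E1 E2 x0; pose c i := bary (pt Q k) i x.
have c1 : \sum_i c i = 1 by exact: bary_sum.
have xE i : bary (pt Q k') i x = c m * (i == n + 1)%:R + c (m + 1) * (i == n)%:R.
  rewrite -{1}(bary_comb (a0 k) x) bary_lincomb //.
  rewrite (sum3_shift _ m) -/(c _) (_ : bary _ (m + 2) x = 0) // mul0r addr0.
  have -> : pt Q k m = pt Q k' (n + 1) by rewrite /pt E2.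
  have -> : pt Q k (m + 1) = pt Q k' n by rewrite /pt E1.
  by rewrite !bary_vertex.
case: (ord3_shift_neq n) => /negbTE h _ _.
by rewrite !xE !eqxx h eq_sym h !mulr0 !mulr1 add0r addr0.
Qed.

Lemma bary_cvg (T : Type) (F : set_system T) (FF : Filter F) (u : T -> plane) x k m :
  (u t).1 @[t --> F] --> x.1 -> (u t).2 @[t --> F] --> x.2 ->
  bary (pt Q k) m (u t) @[t --> F] --> bary (pt Q k) m x.
Proof.
move=> u1 u2; rewrite bary_affine; under eq_cvg do rewrite bary_affine.
apply: cvgD; last exact: cvg_cst.
by apply: cvgD; apply: cvgM => //; exact: cvg_cst.
Qed.

(** The infinite sector at vertex [m] spanned by triangle [k]: the coordinate of [m] itself is left
    free. *)
Definition in_cone k m y := 0 <= bary (pt Q k) (m + 1) y /\ 0 <= bary (pt Q k) (m + 2) y.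

(** Inside a sector both inequalities are stable. On a bounding ray, the neighbour across the
    corresponding edge takes over; it exists because edges at an interior vertex are not on the
    boundary. Only the apex has to be excluded. *)
Lemma cone_open i k m x (T : Type) (F : set_system T) (FF : Filter F) (u : T -> plane) :
  i \notin boundary_vertices tri -> tri k m = i -> in_cone k m x -> x <> vtx Q i ->
  (u t).1 @[t --> F] --> x.1 -> (u t).2 @[t --> F] --> x.2 ->
  \forall t \near F, exists k' m', tri k' m' = i /\ in_cone k' m' (u t).
Proof.
move=> iB kmi [x1 x2] xi u1 u2.
have cvp k' m' : 0 < bary (pt Q k') m' x -> \forall t \near F, 0 < bary (pt Q k') m' (u t).
  by apply: cvgr_gt; exact: bary_cvg.
have [x1z|x1n] := eqVneq (bary (pt Q k) (m + 1) x) 0.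
  have [x2z|x2n] := eqVneq (bary (pt Q k) (m + 2) x) 0.
    exfalso; apply: xi.
    have := bary_sum (a0 k) x; rewrite (sum3_shift _ m) x1z x2z !addr0 => bm.
    rewrite -(bary_comb (a0 k) x) (sum3_shift _ m) x1z x2z bm !scale0r !addr0.
    by rewrite scale1r /pt kmi.
  have x2p : 0 < bary (pt Q k) (m + 2) x by rewrite lt_def x2n.
  have [k' [n [_ E1 E2]]] : exists k' n, [/\ k' != k,
      tri k' n = tri k (m + 2 + 1) & tri k' (n + 1) = tri k (m + 2)].
    apply: interior_edge; apply: contra iB => /boundary_edge_vertices[_] /=.
    by rewrite ord3_add2_1 kmi.
  have [_ b2] := bary_along E1 E2 (etrans (congr1 (fun z => bary (pt Q k) z x) (ord3_add2_2 m)) x1z).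
  have p2 : 0 < bary (pt Q k') (n + 1) x by rewrite b2.
  have kn : tri k' n = i by rewrite E1 ord3_add2_1.
  apply: filterS2 (cvp _ _ x2p) (cvp _ _ p2) => t h1 h2.
  have [h|h] := leP 0 (bary (pt Q k) (m + 1) (u t)).
    by exists k, m; split=> //; split=> //; exact: ltW.
  exists k', n; split=> //; split; first exact: ltW.
  rewrite (bary_across _ E1 E2) ord3_add2_2 mulNr -mulrN mulr_ge0 ?oppr_ge0 ?ltW //.
  by rewrite divr_gt0 // (area2_gt0 _ pos).
have x1p : 0 < bary (pt Q k) (m + 1) x by rewrite lt_def x1n.
have [x2z|x2n] := eqVneq (bary (pt Q k) (m + 2) x) 0; last first.
  have x2p : 0 < bary (pt Q k) (m + 2) x by rewrite lt_def x2n.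
  apply: filterS2 (cvp _ _ x1p) (cvp _ _ x2p) => t h1 h2.
  by exists k, m; split=> //; split; exact: ltW.
have [k' [n [_ E1 E2]]] : exists k' n, [/\ k' != k,
    tri k' n = tri k (m + 1) & tri k' (n + 1) = tri k m].
  apply: interior_edge; apply: contra iB => /boundary_edge_vertices[] /=.
  by rewrite kmi.
have [b2 _] := bary_along E1 E2 x2z.
have p2 : 0 < bary (pt Q k') n x by rewrite b2.
apply: filterS2 (cvp _ _ x1p) (cvp _ _ p2) => t h1 h2.
have [h|h] := leP 0 (bary (pt Q k) (m + 2) (u t)).
  by exists k, m; split=> //; split=> //; exact: ltW.
exists k', (n + 1); rewrite E2; split=> //; rewrite /in_cone ord3_add1_2 ord3_add1_3.
split; last exact: ltW.
rewrite (bary_across _ E1 E2) mulNr -mulrN mulr_ge0 ?oppr_ge0 ?ltW //.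
by rewrite divr_gt0 // (area2_gt0 _ pos).
Qed.

(** The sectors at a vertex are finitely many closed sets. *)
Lemma filter_not_cone i x (T : Type) (F : set_system T) (FF : Filter F) (u : T -> plane) :
  (u t).1 @[t --> F] --> x.1 -> (u t).2 @[t --> F] --> x.2 ->
  ~ (exists k m, tri k m = i /\ in_cone k m x) ->
  \forall t \near F, ~ (exists k m, tri k m = i /\ in_cone k m (u t)).
Proof.
move=> u1 u2 nx.
have cvn k' m' : bary (pt Q k') m' x < 0 -> \forall t \near F, bary (pt Q k') m' (u t) < 0.
  by apply: cvgr_lt; exact: bary_cvg.
have H (km : 'I_NT * 'I_3) : F [set t | ~ (tri km.1 km.2 = i /\ in_cone km.1 km.2 (u t))].
  case: km => k m /=; have [kmi|kmi] := eqVneq (tri k m) i; last first.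
    by apply: nearW => t [/eqP]; rewrite (negbTE kmi).
  have [h1|h1] := ltP (bary (pt Q k) (m + 1) x) 0.
    by apply: filterS (cvn _ _ h1) => t h [_ []]; rewrite leNgt h.
  have [h2|h2] := ltP (bary (pt Q k) (m + 2) x) 0.
    by apply: filterS (cvn _ _ h2) => t h [_ [_ h3]]; move: h; rewrite ltNge h3.
  by exfalso; apply: nx; exists k, m.
apply: filterS (filter_forall FF H) => t Ht [k [m kmi]].
by apply: (Ht (k, m)).
Qed.

(** Along a segment from a point of one sector to [y], the covered parameters form a nonempty, open
    and closed set. The segment must miss the apex, where openness fails, so its start is chosen off
    the line through [y] and the apex. *)
Lemma star_cover i : i \notin boundary_vertices tri ->
  forall y, exists k m, tri k m = i /\ in_cone k m y.
Proof.
move=> iB y; have [k0 [m0 ikm]] := vertex_in_face cc en i.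
have cone0 k m : tri k m = i -> in_cone k m (vtx Q i).
  move=> kmi; rewrite -kmi /in_cone -/(pt Q k m) !bary_vertex //.
have [->|yi] := eqVneq y (vtx Q i).
  by exists k0, m0; split=> //; exact: cone0.
(* The two edge vectors of [k0] at the vertex are independent, so one of them is not parallel to
   [y - vtx Q i]. *)
have [v [vcone vy]] : exists v, in_cone k0 m0 v /\ cross (v - vtx Q i) (y - vtx Q i) != 0.
  have [h|h] := eqVneq (cross (pt Q k0 (m0 + 1) - vtx Q i) (y - vtx Q i)) 0; last first.
    exists (pt Q k0 (m0 + 1)); split=> //; rewrite /in_cone !bary_vertex //.
  exists (pt Q k0 (m0 + 2)); split.
    by rewrite /in_cone !bary_vertex //.
  apply: contraNneq yi => h2.
  have A0 := a0 k0; rewrite (area2_shift _ m0) {2 4}/pt -ikm in A0.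
  rewrite -subr_eq0; move: A0 h h2.
  set e := y - vtx Q i; set e1 := _ - vtx Q i; set e2 := _ - vtx Q i => A0 h h2.
  have E1 : cross e1 e2 * e.1 = 0.
    rewrite (_ : _ * _ = e1.1 * cross e2 e * -1 + e2.1 * cross e1 e).
      by rewrite h h2; ring.
    by rewrite /cross; ring.
  have E2 : cross e1 e2 * e.2 = 0.
    rewrite (_ : _ * _ = e1.2 * cross e2 e * -1 + e2.2 * cross e1 e).
      by rewrite h h2; ring.
    by rewrite /cross; ring.
  move/eqP: E1; move/eqP: E2; rewrite !mulf_eq0 (negbTE A0) /= => /eqP e20 /eqP e10.
  apply/eqP; rewrite [LHS]surjective_pairing; exact: (congr2 pair e10 e20).
pose p (t : R) := (1 - t) *: v + t *: y.
have p1 (t : R) : (p s).1 @[s --> t] --> (p t).1.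
  by rewrite /p !pairE; apply: cvgD; apply: cvgM; try exact: cvg_cst;
    [apply: cvgB; [exact: cvg_cst|exact: cvg_id] | exact: cvg_id].
have p2 (t : R) : (p s).2 @[s --> t] --> (p t).2.
  by rewrite /p !pairE; apply: cvgD; apply: cvgM; try exact: cvg_cst;
    [apply: cvgB; [exact: cvg_cst|exact: cvg_id] | exact: cvg_id].
have pi t : p t <> vtx Q i.
  move=> pti; move: vy; rewrite -pti (_ : cross _ _ = 0) ?eqxx //.
  by rewrite /p /cross !pairE; ring.
pose P := [set t : R | exists k m, tri k m = i /\ in_cone k m (p t)].
pose B := `[0, 1]%classic `&` P.
suff BE : B = `[0, 1]%classic.
  have : B 1 by rewrite BE /= in_itv /= ler01 lexx.
  by move=> [_]; rewrite /P /p /= subrr scale0r add0r scale1r.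
apply: (@segment_connected R 0 1).
- exists 0; split; first by rewrite /= in_itv /= ler01 lexx.
  by exists k0, m0; split=> //; rewrite /p subr0 scale1r scale0r addr0.
- exists (interior P); first exact: open_interior.
  apply/seteqP; split=> t [t01 Pt]; split=> //; last exact: interior_subset.
  have [k [m [kmi kmc]]] := Pt.
  exact: (cone_open (F := nbhs t) _ iB kmi kmc (@pi t) (p1 t) (p2 t)).
- exists P => //; rewrite -(setCK P); apply: open_closedC; rewrite openE => t nP.
  exact: (filter_not_cone (F := nbhs t) _ (p1 t) (p2 t) nP).
Qed.

Lemma cone_tri k m y : in_cone k m y -> 0 <= bary (pt Q k) m y -> triT Q k y.
Proof.
move=> [y1 y2] y0 l; case: (ord3_shift m l) => -> //.
Qed.

(** Close to the vertex its own coordinates are near one, so there the sectors of [star_cover]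
    coincide with the triangles. *)
Lemma interior_vertex_covered i x (T : Type) (F : set_system T) (FF : Filter F)
    (u : T -> plane) : i \notin boundary_vertices tri -> x = vtx Q i ->
  (u t).1 @[t --> F] --> x.1 -> (u t).2 @[t --> F] --> x.2 ->
  \forall t \near F, exists2 k, triT Q k (u t) & i \in face tri k.
Proof.
move=> iB xi u1 u2.
have H (km : 'I_NT * 'I_3) : F [set t | tri km.1 km.2 = i -> 0 < bary (pt Q km.1) km.2 (u t)].
  case: km => k m /=; have [kmi|kmi] := eqVneq (tri k m) i; last first.
    by apply: nearW => t /eqP; rewrite (negbTE kmi).
  have h0 : 0 < bary (pt Q k) m x.
    by rewrite xi -kmi -/(pt Q k m) bary_vertex // eqxx ltr01.
  have : \forall t \near F, 0 < bary (pt Q k) m (u t).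
    by move: h0; apply: cvgr_gt; exact: bary_cvg.
  by apply: filterS => t ht _.
apply: filterS (filter_forall FF H) => t Ht.
have [k [m [kmi kmc]]] := star_cover iB (u t).
exists k; last by rewrite -kmi mem_face.
by apply: cone_tri kmc _; apply: ltW; exact: (Ht (k, m)).
Qed.

(** Near a relatively interior point of the edge the coordinates of its end points stay positive in
    both triangles, and the sign of the third one decides between them. *)
Lemma interior_edge_covered k m k' n x (T : Type) (F : set_system T) (FF : Filter F)
    (u : T -> plane) :
  tri k' n = tri k (m + 1) -> tri k' (n + 1) = tri k m ->
  bary (pt Q k) (m + 2) x = 0 -> 0 < bary (pt Q k) m x -> 0 < bary (pt Q k) (m + 1) x ->
  (u t).1 @[t --> F] --> x.1 -> (u t).2 @[t --> F] --> x.2 ->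
  \forall t \near F, triT Q k (u t) \/ triT Q k' (u t).
Proof.
move=> E1 E2 x0 xm xm1 u1 u2.
have cvp k1 m' : 0 < bary (pt Q k1) m' x -> \forall t \near F, 0 < bary (pt Q k1) m' (u t).
  by apply: cvgr_gt; exact: bary_cvg.
have [b1 b2] := bary_along E1 E2 x0.
have xn : 0 < bary (pt Q k') n x by rewrite b1.
have xn1 : 0 < bary (pt Q k') (n + 1) x by rewrite b2.
apply: filterS2 (filterI (cvp _ _ xm) (cvp _ _ xm1)) (filterI (cvp _ _ xn) (cvp _ _ xn1)).
move=> t [h1 h2] [h3 h4].
have [h|h] := leP 0 (bary (pt Q k) (m + 2) (u t)); [left|right].
  by apply: (@cone_tri k m); [split=> //|]; exact: ltW.
apply: (@cone_tri k' n); [split|]; try exact: ltW.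
rewrite (bary_across _ E1 E2) mulNr -mulrN mulr_ge0 ?oppr_ge0 ?ltW //.
by rewrite divr_gt0 // (area2_gt0 _ pos).
Qed.

End FixQ.
End Star.

(** * Weakly separated meshes are proper *)

Section WeakSeparation.
Context {R : realType} {N NT : nat}.
Context (Delta : {set {set 'I_N}}) (tri : 'I_NT -> 'I_3 -> 'I_N).
Notation plane := (R * R)%type.
Implicit Types (Q : 'M[R]_(2, N)) (x y w : plane) (k l : 'I_NT) (F G : {set 'I_N}).
Hypothesis cc : connectivity_complex Delta.
Hypothesis en : enumerates_2faces Delta tri.
Hypothesis co : consistently_oriented tri.

Local Notation pt := (@pt R N NT tri).
Local Notation triT := (@triT R N NT tri).

(** Strict inequalities are lost in a limit; the nonzero normal is what survives. *)
Definition weakly_separated Q k l := exists2 w : plane, w != 0 &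
  forall m m', dot w (pt Q l m') <= dot w (pt Q k m).

Definition off_boundary Q := forall e i, e \in boundary_edges tri ->
  i \in boundary_vertices tri -> i != e.1 -> i != e.2 ->
  ~ conv_hull [set vtx Q e.1; vtx Q e.2] (vtx Q i).

Variable Q : 'M[R]_(2, N).
Hypothesis pos : pos_areas tri Q.
Hypothesis wsep : forall k l, k != l -> weakly_separated Q k l.
Hypothesis offb : off_boundary Q.

Let a0 k : area2 (pt Q k) != 0 := area2_neq0 k pos.

(** [dot w x] is an average of levels of vertices of [k], all at least [dot w x], and of levels of
    vertices of [l], all at most [dot w x]. Hence the vertices with nonzero weight lie on the
    separating line. *)
Lemma weakly_separated_level k l w x i j :
  (forall m m', dot w (pt Q l m') <= dot w (pt Q k m)) ->
  triT Q k x -> triT Q l x -> bary (pt Q k) i x != 0 -> bary (pt Q l) j x != 0 ->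
  dot w (pt Q k i) = dot w x /\ dot w (pt Q l j) = dot w x.
Proof.
move=> wP xk xl xi xj.
have xkE : dot w x = \sum_i bary (pt Q k) i x * dot w (pt Q k i).
  rewrite -{1}(bary_comb (a0 k) x) dot_sum.
  by apply: eq_bigr => i' _; rewrite dotZr.
have xlE : dot w x = \sum_i bary (pt Q l) i x * dot w (pt Q l i).
  rewrite -{1}(bary_comb (a0 l) x) dot_sum.
  by apply: eq_bigr => i' _; rewrite dotZr.
have lek m : dot w x <= dot w (pt Q k m).
  rewrite xlE -[leRHS]mul1r -(bary_sum (a0 l) x) mulr_suml.
  by apply: ler_sum => j' _; rewrite ler_wpM2l.
have lel m : dot w (pt Q l m) <= dot w x.
  rewrite xkE -[leLHS]mul1r -(bary_sum (a0 k) x) mulr_suml.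
  by apply: ler_sum => j' _; rewrite ler_wpM2l.
have sk : \sum_i bary (pt Q k) i x * (dot w (pt Q k i) - dot w x) = 0.
  under eq_bigr do rewrite mulrBr.
  by rewrite sumrB -mulr_suml bary_sum // mul1r -xkE subrr.
have sl : \sum_i bary (pt Q l) i x * (dot w x - dot w (pt Q l i)) = 0.
  under eq_bigr do rewrite mulrBr.
  by rewrite sumrB -mulr_suml bary_sum // mul1r -xlE subrr.
split; apply/eqP.
  move/eqP: sk; rewrite psumr_eq0; last first.
    by move=> m _; rewrite mulr_ge0 // subr_ge0.
  move=> /allP /(_ i); rewrite mem_index_enum => /(_ isT) /=.
  by rewrite mulf_eq0 (negbTE xi) subr_eq0.
move/eqP: sl; rewrite psumr_eq0; last first.
  by move=> m _; rewrite mulr_ge0 // subr_ge0.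
move=> /allP /(_ j); rewrite mem_index_enum => /(_ isT) /=.
by rewrite mulf_eq0 (negbTE xj) subr_eq0 eq_sym.
Qed.

Lemma perp_parallel w d e : w != 0 -> d != 0 -> dot w d = 0 -> dot w e = 0 ->
  e = (dot e d / dot d d) *: d.
Proof.
move=> w0 d0 wd we.
have dd : dot d d != 0 by apply: contraNneq d0 => /dot_eq0 ->.
have ww : dot w w != 0 by apply: contraNneq w0 => /dot_eq0 ->.
have ed : cross e d = 0.
  have : dot w w * cross e d = 0.
    rewrite (_ : _ * _ = dot w e * cross w d - dot w d * cross w e).
      by rewrite wd we; ring.
    by rewrite /dot /cross; ring.
  by move=> /eqP; rewrite mulf_eq0 (negbTE ww) => /eqP.
have : dot d d *: e = dot e d *: d.
  rewrite [LHS]surjective_pairing [RHS]surjective_pairing !pairE; congr pair.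
    apply/eqP; rewrite -subr_eq0; apply/eqP.
    rewrite (_ : _ - _ = cross e d * d.2); first by rewrite ed mul0r.
    by rewrite /dot /cross; ring.
  apply/eqP; rewrite -subr_eq0; apply/eqP.
  rewrite (_ : _ - _ = - cross e d * d.1); first by rewrite ed oppr0 mul0r.
  by rewrite /dot /cross; ring.
by move=> E; rewrite mulrC -scalerA -E scalerA mulVf // scale1r.
Qed.

Lemma level_all k w c : (forall m, dot w (pt Q k m) = c) -> w = 0.
Proof.
move=> H; have := a0 k; rewrite (area2_shift _ 0).
set u := pt Q k (0 + 1) - _; set v := pt Q k (0 + 2) - _ => uv.
have wu : dot w u = 0 by rewrite dotBr !H subrr.
have wv : dot w v = 0 by rewrite dotBr !H subrr.
have w1 : w.1 * cross u v = 0.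
  rewrite (_ : _ * _ = dot w u * v.2 - dot w v * u.2) .
    by rewrite wu wv; ring.
  by rewrite /dot /cross; ring.
have w2 : w.2 * cross u v = 0.
  rewrite (_ : _ * _ = dot w v * u.1 - dot w u * v.1) .
    by rewrite wu wv; ring.
  by rewrite /dot /cross; ring.
move/eqP: w1; move/eqP: w2; rewrite !mulf_eq0 (negbTE uv) !orbF => /eqP w2 /eqP w1.
by rewrite [LHS]surjective_pairing; exact: (congr2 pair w1 w2).
Qed.

(** Otherwise all three vertices of [l] would lie on the separating line. *)
Lemma weakly_separated_interior k l x : k != l -> triT Q k x ->
  (forall m, 0 < bary (pt Q l) m x) -> False.
Proof.
move=> kl xk xl.
have xl' : triT Q l x by move=> m; exact: ltW.
have [w w0 wP] := wsep kl.
have [i xi] : exists i, bary (pt Q k) i x != 0.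
  apply/existsP; apply: contraT => /existsPn h.
  have := bary_sum (a0 k) x; rewrite big1 => [|i _].
    by move=> /eqP; rewrite eq_sym oner_eq0.
  by apply/eqP; have := h i; rewrite negbK.
suff : w = 0 by move/eqP; rewrite (negbTE w0).
apply: (@level_all l _ (dot w x)) => j.
by have [] := weakly_separated_level wP xk xl' xi (lt0r_neq0 (xl j)).
Qed.

(** A small move towards the centroid turns a point of a closed triangle into an interior point, to
    which [weakly_separated_interior] applies. *)
Let centroid k : plane := \sum_m 3%:R^-1 *: pt Q k m.

Let centroid_bary k m : bary (pt Q k) m (centroid k) = 3%:R^-1.
Proof.
rewrite bary_lincomb_vertex // sum3E.
by field.
Qed.

Let toward x y (s : R) : plane := (1 - s) *: x + s *: y.

Let toward_bary k m x y s : bary (pt Q k) m (toward x y s) =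
  (1 - s) * bary (pt Q k) m x + s * bary (pt Q k) m y.
Proof. by rewrite /toward !bary_affine dotDr !dotZr; ring. Qed.

Let toward_interior k x s : 0 < s -> s <= 1 -> triT Q k x ->
  forall m, 0 < bary (pt Q k) m (toward x (centroid k) s).
Proof.
move=> s0 s1 xk m; rewrite toward_bary centroid_bary ltr_wpDl //.
  by rewrite mulr_ge0 // subr_ge0.
by rewrite mulr_gt0 // invr_gt0.
Qed.

Let toward_cvg1 x y : (toward x y s).1 @[s --> 0^'+] --> x.1.
Proof.
have id0 : s @[s --> (0 : R)^'+] --> (0 : R) by exact: cvg_at_right_filter.
have : (1 - s) * x.1 + s * y.1 @[s --> (0 : R)^'+] --> (1 - 0) * x.1 + 0 * y.1.
  by apply: cvgD; apply: cvgM => //; try exact: cvg_cst;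
    apply: cvgB => //; exact: cvg_cst.
by rewrite subr0 mul1r mul0r addr0.
Qed.

Let toward_cvg2 x y : (toward x y s).2 @[s --> 0^'+] --> x.2.
Proof.
have id0 : s @[s --> (0 : R)^'+] --> (0 : R) by exact: cvg_at_right_filter.
have : (1 - s) * x.2 + s * y.2 @[s --> (0 : R)^'+] --> (1 - 0) * x.2 + 0 * y.2.
  by apply: cvgD; apply: cvgM => //; try exact: cvg_cst;
    apply: cvgB => //; exact: cvg_cst.
by rewrite subr0 mul1r mul0r addr0.
Qed.

Let vtx_tri k i : i \in face tri k -> triT Q k (vtx Q i).
Proof. by move=> /faceP[m ->]; exact: tri_hull_vertex. Qed.

(** If [i] is not a vertex of [l], a point of the interior of [l] close to [i] would lie in a
    triangle of the star of [i], and that triangle differs from [l]. *)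
Lemma interior_vertex_proper i l : i \notin boundary_vertices tri ->
  triT Q l (vtx Q i) -> i \in face tri l.
Proof.
move=> iB il; apply: contraT => inl.
have cov := interior_vertex_covered cc en co pos _ iB erefl
  (@toward_cvg1 (vtx Q i) (centroid l)) (@toward_cvg2 (vtx Q i) (centroid l)).
have [s [[s0 s1] [k sk ik]]] : exists s : R, (0 < s /\ s <= 1) /\
    exists2 k, triT Q k (toward (vtx Q i) (centroid l) s) & i \in face tri k.
  apply: (@filter_ex _ (0 : R)^'+ _); apply: filterI; last exact: cov.
  near=> s; split; first by near: s; exact: nbhs_right_gt.
  by near: s; apply: nbhs_right_le.
have kl : k != l by apply: contraNneq inl => <-.
by have := weakly_separated_interior kl sk (toward_interior s0 s1 il).
Unshelve. all: by end_near. Qed.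

(** It remains to treat a boundary vertex. It cannot be interior to [l], so it lies on an edge:
    coinciding with an end point is ruled out by [no_coincidence], a boundary edge by [offb], and an
    inner edge because its two triangles cover points interior to a triangle of [i]. *)
Lemma weak_vertex_proper i l : triT Q l (vtx Q i) -> i \in face tri l.
Proof.
move=> il; apply: contraT => inl.
have [iB|/interior_vertex_proper/(_ il)] := boolP (i \in boundary_vertices tri); last first.
  by rewrite (negbTE inl).
have [k [m0 im0]] := vertex_in_face cc en i.
have ik : i \in face tri k by rewrite im0 mem_face.
have kl : k != l by apply: contraNneq inl => <-.
(* If [j] is an interior vertex, the previous lemma applies to it in triangle [k]; if it is a
   boundary vertex, [i] would lie on a boundary edge ending in [j]. *)
have no_coincidence j : vtx Q i = vtx Q j -> i = j.
  move=> ij; apply/eqP; apply: contraT => nij.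
  have jk : j \notin face tri k.
    apply: contra nij => /faceP[m jm]; rewrite im0 jm; apply/eqP; congr tri.
    by apply: (face_vtx_inj pos (k := k)); rewrite /pt -jm -im0.
  have [jB|jB] := boolP (j \in boundary_vertices tri); last first.
    have := interior_vertex_proper (l := k) jB; rewrite -ij => /(_ (vtx_tri ik)).
    by rewrite (negbTE jk).
  have [e eB je] := boundary_vertexP _ _ jB.
  have [k1 [m1 [e1 e2]]] := boundary_edge_face eB.
  have ek j' : j' = e.1 \/ j' = e.2 -> j' \in face tri k1.
    by case=> ->; rewrite ?e1 ?e2 mem_face.
  have ie : i != e.1 /\ i != e.2.
    apply/andP; apply: contraT; rewrite negb_and !negbK => ie; exfalso.
    have /faceP[m mE] : i \in face tri k1.
      by apply: ek; case/orP: ie => /eqP; [left|right].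
    have /faceP[m' mE'] := ek _ je.
    move: nij; rewrite mE mE' => /negP; apply; apply/eqP; congr tri.
    by apply: (face_vtx_inj pos (k := k1)); rewrite /pt -mE -mE'.
  exfalso; apply: (offb eB iB ie.1 ie.2); rewrite ij.
  by apply: sub_conv_hull; case: je => ->; [left|right].
have [n n0] : exists n, bary (pt Q l) (n + 2) (vtx Q i) = 0.
  have [/existsP[n /eqP n0]|/existsPn h] :=
    boolP [exists n, bary (pt Q l) (n + 2) (vtx Q i) == 0]; first by exists n.
  have := weakly_separated_interior kl (vtx_tri ik); move=> H; exfalso; apply: H => m.
  rewrite lt_def il andbT; have := h (m + 1).
  by rewrite (_ : m + 1 + 2 = m) // ord3_add1_3.
have iE : vtx Q i = bary (pt Q l) n (vtx Q i) *: pt Q l n +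
    bary (pt Q l) (n + 1) (vtx Q i) *: pt Q l (n + 1).
  by rewrite -{1}(bary_comb (a0 l) (vtx Q i)) (sum3_shift _ n) n0 scale0r addr0.
have sum1 : bary (pt Q l) n (vtx Q i) + bary (pt Q l) (n + 1) (vtx Q i) = 1.
  by have := bary_sum (a0 l) (vtx Q i); rewrite (sum3_shift _ n) n0 addr0.
have in_ j : j \in face tri l -> i <> j by move=> jl E; move: inl; rewrite E jl.
have [bn|bn] := eqVneq (bary (pt Q l) n (vtx Q i)) 0.
  exfalso; apply: (in_ _ (mem_face tri l (n + 1))); apply: no_coincidence.
  by move: sum1 iE; rewrite bn add0r => ->; rewrite scale0r add0r scale1r.
have [bn1|bn1] := eqVneq (bary (pt Q l) (n + 1) (vtx Q i)) 0.
  exfalso; apply: (in_ _ (mem_face tri l n)); apply: no_coincidence.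
  by move: sum1 iE; rewrite bn1 addr0 => ->; rewrite scale0r addr0 scale1r.
have pn : 0 < bary (pt Q l) n (vtx Q i) by rewrite lt_def bn il.
have pn1 : 0 < bary (pt Q l) (n + 1) (vtx Q i) by rewrite lt_def bn1 il.
have [eB|] := boolP ((tri l n, tri l (n + 1)) \in boundary_edges tri).
  exfalso; apply: (offb eB iB); try by apply/eqP; apply: in_; exact: mem_face.
  rewrite iE; have -> : bary (pt Q l) (n + 1) (vtx Q i) = 1 - bary (pt Q l) n (vtx Q i).
    by rewrite -sum1 addrAC subrr add0r.
  apply: conv_hull_convex; rewrite ?il //.
  - by apply: sub_conv_hull; left.
  - by apply: sub_conv_hull; right.
  - by rewrite -sum1 lerDl il.
move=> /(interior_edge co)[l' [n' [_ E1 E2]]].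
have cov := interior_edge_covered pos _ E1 E2 n0 pn pn1
  (@toward_cvg1 (vtx Q i) (centroid k)) (@toward_cvg2 (vtx Q i) (centroid k)).
have [s [[s0 s1] sl]] : exists s : R, (0 < s /\ s <= 1) /\
    (triT Q l (toward (vtx Q i) (centroid k) s) \/
     triT Q l' (toward (vtx Q i) (centroid k) s)).
  apply: (@filter_ex _ (0 : R)^'+ _); apply: filterI; last exact: cov.
  near=> s; split; first by near: s; exact: nbhs_right_gt.
  by near: s; apply: nbhs_right_le.
have sint := toward_interior s0 s1 (vtx_tri ik).
have lk : l != k by rewrite eq_sym.
case: sl => sl; first by have := weakly_separated_interior lk sl sint.
(* The neighbour across the edge may be [k] itself; then [i] is a vertex of it and yet has two
   positive coordinates there. *)
have [l'k|l'k] := eqVneq l' k; last first.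
  by have := weakly_separated_interior l'k sl sint.
have [b1 b2] := bary_along pos E1 E2 n0.
exfalso; have [m mE] : exists m, i = tri l' m by exists m0; rewrite l'k.
have : 0 < bary (pt Q l') n' (vtx Q i) by rewrite b1.
have : 0 < bary (pt Q l') (n' + 1) (vtx Q i) by rewrite b2.
rewrite mE -/(pt Q l' m) !bary_vertex // !ltr0n !lt0b => /eqP <- /eqP E.
by case: (ord3_shift_neq n'); rewrite {1}E eqxx.
Unshelve. all: by end_near. Qed.

(** Suppose a common point [x] has weight on an unshared vertex [p] of [k]. Then [p] and the
    vertices of [l] that carry [x] are collinear. Three such vertices would degenerate [l], and a
    single one would lie in [k] against [weak_vertex_proper]. With two, the position of [p] on their
    line always places some vertex in a foreign triangle. *)
Lemma weak_proper : meets_properly tri Q.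
Proof.
move=> k l kl x xk xl m ml; apply/eqP; apply: contraT => xm.
have [w w0 wP] := wsep kl.
have xlev j : bary (pt Q l) j x != 0 -> dot w (pt Q l j) = dot w (pt Q k m).
  by move=> xj; have [-> ->] := weakly_separated_level wP xk xl xm xj.
have no_vertex j : triT Q k (pt Q l j) -> 0 < bary (pt Q k) m (pt Q l j) -> False.
  move=> jk; have /faceP[i iE] := weak_vertex_proper jk.
  have -> : pt Q l j = pt Q k i by rewrite /pt iE.
  rewrite bary_vertex // ltr0n lt0b => /eqP mi.
  by move: ml; rewrite mi -iE mem_face.
have xm0 : 0 < bary (pt Q k) m x by rewrite lt_def xm xk.
have [n n2] : exists n, bary (pt Q l) (n + 2) x = 0.
  have [/existsP[n /eqP n0]|/existsPn h] :=
    boolP [exists n, bary (pt Q l) (n + 2) x == 0]; first by exists n.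
  suff wz : w = 0 by rewrite wz eqxx in w0.
  apply: (@level_all l _ (dot w (pt Q k m))) => j; apply: xlev.
  by have := h (j + 1); rewrite ord3_add1_3.
have xE : x = bary (pt Q l) n x *: pt Q l n + bary (pt Q l) (n + 1) x *: pt Q l (n + 1).
  by rewrite -{1}(bary_comb (a0 l) x) (sum3_shift _ n) n2 scale0r addr0.
have sum1 : bary (pt Q l) n x + bary (pt Q l) (n + 1) x = 1.
  by have := bary_sum (a0 l) x; rewrite (sum3_shift _ n) n2 addr0.
have [bn|bn] := eqVneq (bary (pt Q l) n x) 0.
  have xr : x = pt Q l (n + 1).
    by move: sum1 xE; rewrite bn add0r => ->; rewrite scale0r add0r scale1r.
  by exfalso; apply: (no_vertex (n + 1)); rewrite -xr.
have [bn1|bn1] := eqVneq (bary (pt Q l) (n + 1) x) 0.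
  have xr : x = pt Q l n.
    by move: sum1 xE; rewrite bn1 addr0 => ->; rewrite scale0r addr0 scale1r.
  by exfalso; apply: (no_vertex n); rewrite -xr.
have lev0 := xlev _ bn; have lev1 := xlev _ bn1.
set p := pt Q k m in lev0 lev1 *; set r0 := pt Q l n in lev0 xE *.
set r1 := pt Q l (n + 1) in lev1 xE *.
set sg := bary (pt Q l) (n + 1) x in bn1 xE sum1 *.
have sg0 : 0 < sg by rewrite lt_def bn1 xl.
have bnE : bary (pt Q l) n x = 1 - sg by rewrite -sum1 addrK.
have sg1 : sg < 1 by rewrite -subr_gt0 -bnE lt_def bn xl.
rewrite bnE in xE.
have d0 : r1 - r0 != 0.
  rewrite subr_eq0; apply/eqP => /(face_vtx_inj pos) /eqP.
  by case: (ord3_shift_neq n) => /negbTE; rewrite eq_sym => ->.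
have [t pE] : exists t, p = r0 + t *: (r1 - r0).
  exists (dot (p - r0) (r1 - r0) / dot (r1 - r0) (r1 - r0)).
  apply/eqP; rewrite addrC -subr_eq; apply/eqP; apply: perp_parallel w0 d0 _ _.
    by rewrite dotBr lev0 lev1 subrr.
  by rewrite dotBr lev0 subrr.
have pm1 : bary (pt Q k) m p = 1 by rewrite bary_vertex // eqxx.
(* If [p] lies outside the edge, its nearer end point lies between [p] and [x], hence in [k] with
   positive weight at [p]. Otherwise [p] lies in [l]. *)
have [t0|t0] := ltP t 0.
  have th0 : 0 < sg - t by rewrite subr_gt0 (lt_trans t0).
  have thp : 0 < sg / (sg - t) by rewrite divr_gt0.
  have thl : sg / (sg - t) <= 1 by rewrite ler_pdivrMr // mul1r lerBrDr gerDl ltW.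
  have rE : r0 = (sg / (sg - t)) *: p + (1 - sg / (sg - t)) *: x.
    rewrite pE xE; rewrite [LHS]surjective_pairing [RHS]surjective_pairing !pairE.
    by congr pair; field; rewrite gt_eqF.
  exfalso; apply: (no_vertex n); rewrite -/r0 rE.
    move=> i; rewrite bary_conv addr_ge0 // mulr_ge0 ?subr_ge0 ?(ltW thp) //.
    by rewrite bary_vertex // ler0n.
  rewrite bary_conv pm1 mulr1 ltr_pwDl // mulr_ge0 ?subr_ge0 //; exact: ltW.
have [t1|t1] := ltP 1 t.
  have th0 : 0 < t - sg by rewrite subr_gt0 (lt_trans sg1).
  have thp : 0 < (1 - sg) / (t - sg) by rewrite divr_gt0 // subr_gt0.
  have thl : (1 - sg) / (t - sg) <= 1 by rewrite ler_pdivrMr // mul1r lerB // ltW.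
  have rE : r1 = ((1 - sg) / (t - sg)) *: p + (1 - (1 - sg) / (t - sg)) *: x.
    rewrite pE xE; rewrite [LHS]surjective_pairing [RHS]surjective_pairing !pairE.
    by congr pair; field; rewrite gt_eqF.
  exfalso; apply: (no_vertex (n + 1)); rewrite -/r1 rE.
    move=> i; rewrite bary_conv addr_ge0 // mulr_ge0 ?subr_ge0 ?(ltW thp) //.
    by rewrite bary_vertex // ler0n.
  rewrite bary_conv pm1 mulr1 ltr_pwDl // mulr_ge0 ?subr_ge0 //; exact: ltW.
have pl : triT Q l p.
  have -> : p = t *: r1 + (1 - t) *: r0.
    by rewrite pE scalerBl scale1r scalerBr addrCA addrA.
  move=> i; rewrite bary_conv !bary_vertex // addr_ge0 // mulr_ge0 ?ler0n ?subr_ge0 //.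
by have := weak_vertex_proper pl; rewrite (negbTE ml).
Qed.

End WeakSeparation.

(** * Limits along ultrafilters *)

Section UltraLimits.
Context {R : realType}.

Lemma ultra_image_filter (T U : Type) (f : T -> U) (F : set_system T) :
  UltraFilter F -> UltraFilter (f @ F).
Proof.
move=> FU; split; first exact: fmap_proper_filter.
move=> G GP sub; apply/seteqP; split=> // A GA.
have [//|nFA] := @in_ultra_setVsetC _ _ (f @^-1` A) FU.
have GnA : G (~` A) by apply: sub.
have := filterI GA GnA; rewrite setICr => G0.
have h : ~ G set0 by exact: filter_not_empty.
by exfalso; apply: h; apply: G0.
Qed.

Lemma ultra_cvg (T : Type) (F : set_system T) (u : T -> R) (M : R) :
  UltraFilter F -> (forall t, `|u t| <= M) -> exists l : R, u @ F --> l.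
Proof.
move=> FU uM; have := @segment_compact R (- M) M; rewrite compact_ultra /=.
move=> /(_ (u @ F) (ultra_image_filter u FU)) [|l [_ lP]]; last by exists l.
have : F (u @^-1` `[- M, M]%classic); last by [].
by apply: filterE => t /=; rewrite in_itv /= -ler_norml.
Qed.

Lemma cvg_ler (T : Type) (F : set_system T) (FF : ProperFilter F) (f g : T -> R)
    (l l' : R) : f @ F --> l -> g @ F --> l' -> (forall t, f t <= g t) -> l <= l'.
Proof.
move=> fl gl fg; rewrite -subr_ge0.
apply: (cvgr_to_ge (f := fun t => g t - f t) (F := F)); first exact: cvgB.
by apply: nearW => t; rewrite subr_ge0.
Qed.

End UltraLimits.

Lemma within_eq_continuous (T S : topologicalType) (A : set T) (f g : T -> S) :
  (forall x, A x -> f x = g x) -> {within A, continuous f} -> {within A, continuous g}.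
Proof. by move=> fg; apply: subspace_eq_continuous => x; rewrite inE => /fg. Qed.

(** * Openness of [Mplus] and limits in a path component *)

Section MeshLimits.
Context {R : realType} {N NT : nat}.
Context (Delta : {set {set 'I_N}}) (tri : 'I_NT -> 'I_3 -> 'I_N).
Notation plane := (R * R)%type.
Implicit Types (Q : 'M[R]_(2, N)) (x y w : plane) (k l : 'I_NT).
Hypothesis cc : connectivity_complex Delta.
Hypothesis en : enumerates_2faces Delta tri.
Hypothesis co : consistently_oriented tri.

Local Notation pt := (@pt R N NT tri).
Local Notation triT := (@triT R N NT tri).

Section Convergence.
Context (T : Type) (F : set_system T) (FF : ProperFilter F).
Variables (q : T -> 'M[R]_(2, N)) (Q : 'M[R]_(2, N)).
Hypothesis qQ : forall i j, q t i j @[t --> F] --> Q i j.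

Lemma vtx1_cvg i : (vtx (q t) i).1 @[t --> F] --> (vtx Q i).1.
Proof. exact: qQ. Qed.

Lemma vtx2_cvg i : (vtx (q t) i).2 @[t --> F] --> (vtx Q i).2.
Proof. exact: qQ. Qed.

Lemma dot_vtx_cvg (u : T -> plane) w i :
  (u t).1 @[t --> F] --> w.1 -> (u t).2 @[t --> F] --> w.2 ->
  dot (u t) (vtx (q t) i) @[t --> F] --> dot w (vtx Q i).
Proof.
move=> u1 u2; apply: cvgD; apply: cvgM => //; [exact: vtx1_cvg|exact: vtx2_cvg].
Qed.

Lemma cross_cvg (u v : T -> plane) x y :
  (u t).1 @[t --> F] --> x.1 -> (u t).2 @[t --> F] --> x.2 ->
  (v t).1 @[t --> F] --> y.1 -> (v t).2 @[t --> F] --> y.2 ->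
  cross (u t) (v t) @[t --> F] --> cross x y.
Proof. by move=> u1 u2 v1 v2; apply: cvgB; apply: cvgM. Qed.

Lemma area2_cvg k : area2 (pt (q t) k) @[t --> F] --> area2 (pt Q k).
Proof.
by apply: cross_cvg; apply: cvgB; [exact: vtx1_cvg|exact: vtx1_cvg|
  exact: vtx2_cvg|exact: vtx2_cvg|exact: vtx1_cvg|exact: vtx1_cvg|
  exact: vtx2_cvg|exact: vtx2_cvg].
Qed.

Lemma tri_area_cvg k : tri_area tri (q t) k @[t --> F] --> tri_area tri Q k.
Proof.
rewrite tri_areaE; under eq_cvg do rewrite tri_areaE.
by apply: cvgM; [exact: cvg_cst|exact: area2_cvg].
Qed.

(** A common edge separates its two triangles in every mesh with positive areas. For other pairs the
    same [w] keeps the finitely many strict inequalities, and the only shared vertex gives equality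
    in every mesh. *)
Lemma Mplus_near : Mplus Delta tri Q -> \forall t \near F, Mplus Delta tri (q t).
Proof.
move=> /(Mplus_separated cc en co)[pos sep].
have posn : \forall t \near F, pos_areas tri (q t).
  apply: filter_forall => k; have := pos k; apply: cvgr_gt; exact: tri_area_cvg.
have sepn (kl : 'I_NT * 'I_NT) : F [set t | pos_areas tri (q t) -> kl.1 != kl.2 ->
    exists w, separating tri (q t) kl.1 kl.2 w].
  case: kl => k l /=; have [kl|kl] := boolP (k != l); last exact: nearW.
  have [/existsP[m /andP[ml m1l]]|one] :=
      boolP [exists m, (tri k m \in face tri l) && (tri k (m + 1) \in face tri l)].
    by apply: nearW => t post _; exact: (shared_edge_separated en co post kl ml m1l).
  have [w wP] := sep _ _ kl.
  have H (mm : 'I_3 * 'I_3) : F [set t |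
      (tri k mm.1 \notin face tri l) || (tri l mm.2 \notin face tri k) ->
      dot w (pt (q t) l mm.2) < dot w (pt (q t) k mm.1)].
    case: mm => m m' /=.
    have [h|h] := boolP ((tri k m \notin face tri l) || (tri l m' \notin face tri k));
      last exact: nearW.
    have h0 : 0 < dot w (pt Q k m) - dot w (pt Q l m').
      by rewrite subr_gt0; apply: (wP m m').2.
    have : \forall t \near F, 0 < dot w (pt (q t) k m) - dot w (pt (q t) l m').
      move: h0; apply: cvgr_gt; apply: cvgB; apply: dot_vtx_cvg; exact: cvg_cst.
    by apply: filterS => t; rewrite subr_gt0 => ht _.
  apply: filterS (filter_forall _ H) => t Ht _ _; exists w => m m'.
  have Hmm := Ht (m, m'); rewrite /= in Hmm.
  split=> //; have [/Hmm/ltW //|] :=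
    boolP ((tri k m \notin face tri l) || (tri l m' \notin face tri k)).
  rewrite negb_or !negbK => /andP[ml m'k].
  by rewrite /pt (shared_vertex_unique one ml m'k).
apply: filterS2 posn (filter_forall _ sepn) => t post sept.
by apply/(Mplus_separated cc en co); split=> // k l; exact: (sept (k, l)).
Qed.

End Convergence.

Lemma Mplus_open Q : Mplus Delta tri Q -> nbhs Q (Mplus Delta tri).
Proof.
move=> MQ; apply: (@Mplus_near _ (nbhs Q) _ id Q _ MQ) => i j.
exact: coord_continuous.
Qed.

Lemma entries_cvg (T : Type) (F : set_system T) (FF : Filter F)
    (q : T -> 'M[R]_(2, N)) Q :
  (forall i j, q t i j @[t --> F] --> Q i j) -> q @ F --> Q.
Proof.
move=> qQ; apply/cvgrPdist_lt => e e0.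
have H (ij : 'I_2 * 'I_N) : F [set t | `|Q ij.1 ij.2 - q t ij.1 ij.2| < e].
  by have := qQ ij.1 ij.2 => /cvgrPdist_lt; exact.
apply: filterS (filter_forall FF H) => t Ht.
rewrite [ltLHS]/Num.norm /= mx_normrE; apply/bigmax_ltP; split=> // ij _.
by rewrite !mxE; exact: Ht.
Qed.

Lemma Mesh_sub Qref Q : Mesh Delta tri Qref Q -> Mplus Delta tri Q.
Proof.
by move=> [g [_ gM _ <-]]; apply: gM; rewrite in_itv /= ler01 lexx.
Qed.

Lemma Mesh_limit Qref (T : Type) (F : set_system T) (FF : ProperFilter F)
    (q : T -> 'M[R]_(2, N)) Q :
  (forall i j, q t i j @[t --> F] --> Q i j) ->
  (forall t, Mesh Delta tri Qref (q t)) -> Mplus Delta tri Q ->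
  Mesh Delta tri Qref Q.
Proof.
move=> qQ qM MQ; have /nbhs_ballP[e /= e0 eM] := Mplus_open MQ.
have [t qt] : exists t, ball Q e (q t).
  apply: (@filter_ex _ F _); exact: (cvg_ball (entries_cvg _ qQ) e0).
have [g [gc gM g0 g1]] := qM t.
(* The path to a mesh [q t] in a ball inside [Mplus] is run at double speed and continued by the
   segment to [Q], which stays in the ball. *)
pose h (s : R) := (2 - 2 * s) *: q t + (2 * s - 1) *: Q.
pose f (s : R) := if s <= 2^-1 then g (2 * s) else h s.
have fh s : 2^-1 <= s -> f s = h s.
  rewrite le_eqVlt => /orP[/eqP <-|s2]; last by rewrite /f leNgt s2.
  rewrite /f lexx /h divff // g1 subrr scale0r addr0.
  by rewrite (_ : 2 - 1 = 1) ?scale1r //; ring.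
have half : (2^-1 : R) <= 1 by rewrite invf_le1 // ler1n.
exists f; split.
- have -> : `[0, 1]%classic = `[0, 2^-1]%classic `|` `[2^-1, 1]%classic :> set R.
    apply/seteqP; split=> s /=; rewrite !in_itv /=.
      by move=> /andP[s0 s1]; have [h2|/ltW h2] := leP s 2^-1; [left|right];
        rewrite ?s0 ?s1 ?h2.
    by move=> [/andP[-> /le_trans/(_ half) ->]//|/andP[s2 ->]];
      rewrite (le_trans _ s2) // invr_ge0.
  apply: withinU_continuous; [exact: interval_closed|exact: interval_closed| |].
    apply: (@within_eq_continuous R _ (`[0, 2^-1]%classic : set R) (fun s : R => g (2 * s)) f).
      by move=> s; rewrite /= in_itv /= => /andP[_ s2]; rewrite /f s2.
    apply/subspace_continuousP => s /=; rewrite in_itv /= => /andP[s0 s2].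
    have s01 : `[0, 1]%classic (2 * s).
      by rewrite /= in_itv /= mulr_ge0 //= -ler_pdivlMl // mulr1.
    have gcs := (subspace_continuousP _ _).1 gc _ s01.
    apply: cvg_trans gcs => A H; rewrite /= /within /= in H *.
    have c2 : (fun s : R => 2 * s) @ s --> 2 * s.
      by apply: cvgM; [exact: cvg_cst|exact: cvg_id].
    have H2 : nbhs s [set r : R | `[0, 1]%classic (2 * r) -> A (g (2 * r))].
      exact: (c2 _ H).
    suff : nbhs s [set r : R | `[0, 2^-1]%classic r -> A (g (2 * r))] by [].
    apply: filterS H2 => r /= Hr; rewrite in_itv /= => /andP[r0 r2].
    by apply: Hr; rewrite /= in_itv /= mulr_ge0 //= -ler_pdivlMl // mulr1.
  apply: (@within_eq_continuous R _ (`[2^-1, 1]%classic : set R) h f).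
    by move=> s; rewrite /= in_itv /= => /andP[s2 _]; rewrite fh.
  apply: continuous_subspaceT => s; apply: cvgD; apply: cvgZ; try exact: cvg_cst.
    by apply: cvgB; [exact: cvg_cst|apply: cvgM; [exact: cvg_cst|exact: cvg_id]].
  by apply: cvgB; [apply: cvgM; [exact: cvg_cst|exact: cvg_id]|exact: cvg_cst].
- move=> s; rewrite in_itv /= => /andP[s0 s1].
  have [s2|s2] := leP s 2^-1.
    rewrite /f s2; apply: gM; rewrite in_itv /= mulr_ge0 //=.
    by rewrite -ler_pdivlMl // mulr1.
  rewrite fh ?ltW //; apply: eM; rewrite -ball_normE /= /h.
  have -> : Q - ((2 - 2 * s) *: q t + (2 * s - 1) *: Q) = (2 - 2 * s) *: (Q - q t).
    by apply/matrixP => i j; rewrite !mxE; ring.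
  have hs : 1 < 2 * s by rewrite -ltr_pdivrMl // mulr1.
  rewrite normrZ ger0_norm; last by lra.
  rewrite -ball_normE /= in qt; apply: le_lt_trans qt.
  by rewrite ler_piMl //; lra.
- by rewrite /f invr_ge0 ler0n mulr0.
- by rewrite fh // /h mulr1 subrr scale0r add0r (_ : 2 - 1 = 1) ?scale1r //; ring.
Qed.

End MeshLimits.

(** * Vertex-edge distances *)

Section EdgeDistance.
Context {R : realType} {N : nat}.
Notation plane := (R * R)%type.
Implicit Types (Q : 'M[R]_(2, N)) (x y e : plane) (nrm : plane -> R).

Lemma conv_hull_pair x y z : conv_hull [set x; y] z ->
  exists s : R, [/\ 0 <= s, s <= 1 & z = s *: x + (1 - s) *: y].
Proof.
have -> : [set x; y] = range (fun b : bool => if b then x else y).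
  apply/seteqP; split=> [u [->|->]|_ [[] _ <-]]; first by exists true.
  - by exists false.
  - by left.
  - by right.
move=> /conv_hull_range[c [c0 c1 ->]]; rewrite big_bool /= in c1.
exists (c true); split=> //; first by rewrite -c1 lerDl.
by rewrite big_bool /= -c1 addrAC subrr add0r.
Qed.

Lemma normr_fst_enorm e : `|e.1| <= enorm e.
Proof.
rewrite -sqrtr_sqr; apply: ler_wsqrtr.
by rewrite /dot -!expr2 lerDl sqr_ge0.
Qed.

Lemma normr_snd_enorm e : `|e.2| <= enorm e.
Proof.
rewrite -sqrtr_sqr; apply: ler_wsqrtr.
by rewrite /dot -!expr2 lerDr sqr_ge0.
Qed.

Lemma enorm_gt0 e : e != 0 -> 0 < enorm e.
Proof.
move=> e0; rewrite sqrtr_gt0 lt_def dot_ge0 andbT.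
by apply: contraNneq e0 => /dot_eq0 ->.
Qed.

Lemma normr_unit1 e : `|((enorm e)^-1 *: e).1| <= 1.
Proof.
have [->|/enorm_gt0 e0] := eqVneq e 0; first by rewrite scaler0 normr0.
rewrite fstZ_pair normrM normfV (ger0_norm (ltW e0)) ler_pdivrMl // mulr1.
exact: normr_fst_enorm.
Qed.

Lemma normr_unit2 e : `|((enorm e)^-1 *: e).2| <= 1.
Proof.
have [->|/enorm_gt0 e0] := eqVneq e 0; first by rewrite scaler0 normr0.
rewrite sndZ_pair normrM normfV (ger0_norm (ltW e0)) ler_pdivrMl // mulr1.
exact: normr_snd_enorm.
Qed.

Lemma normr_dot_le (u x : plane) : `|u.1| <= 1 -> `|u.2| <= 1 ->
  `|dot u x| <= `|x.1| + `|x.2|.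
Proof.
move=> u1 u2; rewrite (le_trans (ler_normD _ _)) // !normrM.
by apply: lerD; rewrite ler_piMl.
Qed.

Lemma edge_coords_eq0 Q j0 j1 x : vtx Q j0 != vtx Q j1 ->
  edge_coords Q j0 j1 x = 0 -> x = 0.
Proof.
move=> j01; rewrite /edge_coords; set e := _ - _; set t := (_ *: e) => -[h1 h2].
have e0 : e != 0 by rewrite subr_eq0 eq_sym.
have t0 : t != 0 by rewrite scaler_eq0 invr_eq0 negb_or e0 andbT gt_eqF ?enorm_gt0.
have tt : dot t t != 0 by apply: contraNneq t0 => /dot_eq0 ->.
apply/eqP; rewrite -(inj_eq (scalerI tt)) scaler0; apply/eqP.
rewrite [LHS]surjective_pairing !pairE; congr pair.
  rewrite (_ : _ * _ = t.1 * dot t x - t.2 * dot (- t.2, t.1) x).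
    by rewrite h1 h2; ring.
  by rewrite /dot /=; ring.
rewrite (_ : _ * _ = t.2 * dot t x + t.1 * dot (- t.2, t.1) x).
  by rewrite h1 h2; ring.
by rewrite /dot /=; ring.
Qed.

Variable nrm : plane -> R.
Hypothesis nrm_cont : continuous nrm.
Hypothesis nrm_le : forall x, 0 <= nrm x <= `|x.1| + `|x.2|.
Hypothesis nrm0 : forall x, nrm x = 0 -> x = 0.

(** The factor 2 counts the two frame coordinates: frame vectors have entries of modulus at most 1,
    so each coordinate is bounded by the 1-norm of [x]. *)
Lemma edge_dist_le Q i j0 j1 (s : R) x : 0 <= s -> s <= 1 ->
  x = vtx Q i - (s *: vtx Q j0 + (1 - s) *: vtx Q j1) ->
  edge_dist nrm Q i j0 j1 <= (`|x.1| + `|x.2|) *+ 2.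
Proof.
move=> s0 s1 xE; apply: (@le_trans _ _ (nrm (edge_coords Q j0 j1 x))).
  apply: ge_inf.
    by exists 0 => _ [z _ <-]; case/andP: (nrm_le (edge_coords Q j0 j1 (vtx Q i - z))).
  exists (s *: vtx Q j0 + (1 - s) *: vtx Q j1); last by rewrite xE.
  by apply: conv_hull_convex => //; apply: sub_conv_hull; [left|right].
have /andP[_ h] := nrm_le (edge_coords Q j0 j1 x); apply: (le_trans h).
rewrite mulr2n; apply: lerD; apply: normr_dot_le => /=.
- exact: normr_unit1.
- exact: normr_unit2.
- by rewrite normrN; exact: normr_unit2.
- exact: normr_unit1.
Qed.

(** Continuity of [nrm] makes the infimum a minimum over the parameter of the edge, and a zero
    minimum would be a contact point. *)
Lemma edge_dist_gt0 Q i j0 j1 : vtx Q j0 != vtx Q j1 ->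
  ~ conv_hull [set vtx Q j0; vtx Q j1] (vtx Q i) -> 0 < edge_dist nrm Q i j0 j1.
Proof.
move=> j01 ni.
pose z (s : R) := s *: vtx Q j0 + (1 - s) *: vtx Q j1.
pose f (s : R) := nrm (edge_coords Q j0 j1 (vtx Q i - z s)).
have zc s : 0 <= s -> s <= 1 -> conv_hull [set vtx Q j0; vtx Q j1] (z s).
  by move=> s0 s1; apply: conv_hull_convex => //; apply: sub_conv_hull; [left|right].
have z1 (s : R) : (vtx Q i - z t).1 @[t --> s] --> (vtx Q i - z s).1.
  apply: cvgB; first exact: cvg_cst.
  by apply: cvgD; apply: cvgM; try exact: cvg_cst; [exact: cvg_id|
    apply: cvgB; [exact: cvg_cst|exact: cvg_id]].
have z2 (s : R) : (vtx Q i - z t).2 @[t --> s] --> (vtx Q i - z s).2.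
  apply: cvgB; first exact: cvg_cst.
  by apply: cvgD; apply: cvgM; try exact: cvg_cst; [exact: cvg_id|
    apply: cvgB; [exact: cvg_cst|exact: cvg_id]].
have fc : continuous f.
  move=> s; apply: continuous_comp; last exact: nrm_cont.
  have dc (u : plane) : dot u (vtx Q i - z t) @[t --> s] --> dot u (vtx Q i - z s).
    by apply: cvgD; apply: cvgM; try exact: cvg_cst; [exact: z1|exact: z2].
  exact: (cvg_pair (dc _) (dc _)).
have [c + cmin] := EVT_min (ler01 : (0 : R) <= 1) (continuous_subspaceT fc).
rewrite in_itv /= => /andP[c0 c1].
have fc0 : 0 < f c.
  rewrite lt_def; case/andP: (nrm_le (edge_coords Q j0 j1 (vtx Q i - z c))) => -> _.
  rewrite andbT; apply/eqP => /nrm0 /(edge_coords_eq0 j01) /eqP.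
  by rewrite subr_eq0 => /eqP iz; apply: ni; rewrite iz; exact: zc.
apply: (lt_le_trans fc0); apply: lb_le_inf.
  by exists (f c), (z c) => //; exact: zc.
move=> _ [p /conv_hull_pair[s [s0 s1 ->]] <-].
by apply: (cmin s); rewrite in_itv /= s0.
Qed.

End EdgeDistance.

(** * Mesh limits under bounds on shape, area and distances *)

Section MplusLimit.
Context {R : realType} {N NT : nat}.
Context (Delta : {set {set 'I_N}}) (tri : 'I_NT -> 'I_3 -> 'I_N).
Notation plane := (R * R)%type.
Implicit Types (Q : 'M[R]_(2, N)) (x y w : plane) (k l : 'I_NT).
Hypothesis cc : connectivity_complex Delta.
Hypothesis en : enumerates_2faces Delta tri.
Hypothesis co : consistently_oriented tri.
Variable nrm : plane -> R.
Hypothesis nrm_cont : continuous nrm.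
Hypothesis nrm_le : forall x, 0 <= nrm x <= `|x.1| + `|x.2|.
Hypothesis nrm0 : forall x, nrm x = 0 -> x = 0.

Local Notation pt := (@pt R N NT tri).
Local Notation triT := (@triT R N NT tri).

Lemma Mplus_edge_dist_gt0 Q e i : Mplus Delta tri Q -> e \in boundary_edges tri ->
  i != e.1 -> i != e.2 -> 0 < edge_dist nrm Q i e.1 e.2.
Proof.
move=> /(Mplus_proper cc en)[pos INT] eB i1 i2.
have [k [m [E1 E2]]] := boundary_edge_face eB.
have inj := proper_vtx_inj cc en pos INT.
apply: edge_dist_gt0 => //.
  rewrite (inj_eq inj) E1 E2 (inj_eq (tri_inj en (k := k))).
  by case: (ord3_shift_neq m).
move=> /conv_hull_pair[s [s0 s1 iE]].
have ik : triT Q k (vtx Q i).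
  by rewrite iE => m'; rewrite E1 E2 -!/(pt Q k _) bary_conv addr_ge0 // mulr_ge0 ?subr_ge0 //;
   rewrite bary_vertex ?ler0n // (area2_neq0 k pos).
have /faceP[n nE] := proper_vertex cc en pos INT ik.
have := bary_vertex (area2_neq0 k pos) n n.
rewrite -[X in bary _ _ X]/(vtx Q (tri k n)) -nE iE E1 E2.
rewrite -[X in _ *: X + _]/(pt Q k m) -[X in _ + _ *: X]/(pt Q k (m + 1)).
rewrite bary_conv !bary_vertex ?(area2_neq0 k pos) //.
have /negbTE -> : n != m by apply: contraNneq i1 => nm; rewrite nE nm E1.
have /negbTE -> : n != m + 1 by apply: contraNneq i2 => nm; rewrite nE nm E2.
by rewrite !mulr0 addr0 eqxx => /eqP; rewrite eq_sym oner_eq0.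
Qed.

Definition sum_sqr_edges Q k : R := edge_length tri Q k 0 ^+ 2 +
  edge_length tri Q k 1 ^+ 2 + edge_length tri Q k 2 ^+ 2.

Lemma edge_length_sqr Q' k m : edge_length tri Q' k m ^+ 2 =
  dot (pt Q' k (m + 1) - pt Q' k (m + 2)) (pt Q' k (m + 1) - pt Q' k (m + 2)).
Proof. by rewrite /edge_length /enorm sqr_sqrtr // dot_ge0. Qed.

Lemma sum_sqr_edges_ge0 Q' k : 0 <= sum_sqr_edges Q' k.
Proof. by rewrite !addr_ge0 // sqr_ge0. Qed.

Section Cvg.
Context (T : Type) (F : set_system T) (FF : ProperFilter F).
Variables (q : T -> 'M[R]_(2, N)) (Q : 'M[R]_(2, N)).
Hypothesis qQ : forall i j, q t i j @[t --> F] --> Q i j.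

Lemma sum_sqr_edges_cvg k : sum_sqr_edges (q t) k @[t --> F] --> sum_sqr_edges Q k.
Proof.
have H m : edge_length tri (q t) k m ^+ 2 @[t --> F] --> edge_length tri Q k m ^+ 2.
  rewrite edge_length_sqr; under eq_cvg do rewrite edge_length_sqr.
  by apply: cvgD; apply: cvgM; apply: cvgB; exact: qQ.
by apply: cvgD; [apply: cvgD|]; exact: H.
Qed.

Lemma inv_psi_cvg k : 0 < tri_area tri Q k ->
  inv_psi tri (q t) k @[t --> F] --> inv_psi tri Q k.
Proof.
move=> A0; apply: cvgM; first exact: sum_sqr_edges_cvg.
apply: cvgV.
  by rewrite mulf_neq0 ?gt_eqF // mulr_gt0 // sqrtr_gt0.
by apply: cvgM; [exact: cvg_cst|exact: tri_area_cvg].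
Qed.

End Cvg.

Section Limit.
Context (T : Type) (U : set_system T) (UU : UltraFilter U).
Variables (q : T -> 'M[R]_(2, N)) (Q : 'M[R]_(2, N)).
Hypothesis qQ : forall i j, q t i j @[t --> U] --> Q i j.

Lemma sum_sqr_edges_gt0 Q' k m n : pt Q' k m <> pt Q' k n -> 0 < sum_sqr_edges Q' k.
Proof.
move=> mn; rewrite lt_def sum_sqr_edges_ge0 andbT; apply: contra_notN mn.
rewrite /sum_sqr_edges !paddr_eq0 ?addr_ge0 ?sqr_ge0 // !edge_length_sqr !ord3_addE.
move=> /andP[/andP[/eqP/dot_eq0/subr0_eq E12 /eqP/dot_eq0/subr0_eq E20] _].
have H m' : pt Q' k m' = pt Q' k 0.
  by move: m'; apply: ord3P => //; rewrite ?E12 -?E20.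
by rewrite (H m) (H n).
Qed.

(** By the shape bound, a limit triangle of zero area has collapsed to a point. The total area
    leaves one nondegenerate triangle; a triangle sharing an edge with it keeps an edge of positive
    length, so it is nondegenerate too, and 2-path connectedness reaches all others. *)
Lemma pos_areas_limit (C d : R) : 0 < d -> (forall t, pos_areas tri (q t)) ->
  (forall t k, inv_psi tri (q t) k <= C) ->
  (forall t, d <= \sum_k tri_area tri (q t) k) -> pos_areas tri Q.
Proof.
move=> d0 qpos qC qd.
pose C' := `|C| * (4 * Num.sqrt 3).
have S3 : 0 < 4 * Num.sqrt 3 :> R by rewrite mulr_gt0 // sqrtr_gt0.
have SA k : sum_sqr_edges Q k <= C' * tri_area tri Q k.
  apply: (@cvg_ler _ _ U _ _ (fun t => C' * tri_area tri (q t) k) _ _ (@sum_sqr_edges_cvg _ U _ q Q qQ k)).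
    by apply: cvgM; [exact: cvg_cst|exact: tri_area_cvg].
  move=> t; rewrite -mulrA -ler_pdivrMr; last by apply: mulr_gt0 => //; exact: qpos.
  by apply: le_trans (qC t k) _; exact: ler_norm.
have A0 k : 0 <= tri_area tri Q k.
  apply: (cvgr_to_ge (tri_area_cvg _ qQ (k := k))); apply: nearW => t.
  by rewrite ltW //; exact: qpos.
have C0 : 0 <= C' by rewrite mulr_ge0 // ltW.
have pS k : 0 < sum_sqr_edges Q k -> 0 < tri_area tri Q k.
  move=> Sk; rewrite lt_def A0 andbT; apply/eqP => Az.
  by have := SA k; rewrite Az mulr0 leNgt Sk.
have Ad : d <= \sum_k tri_area tri Q k.
  apply: (cvgr_to_ge (f := fun t => \sum_k tri_area tri (q t) k) (F := U)); last exact: nearW.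
  by apply: cvg_sumr => k; exact: tri_area_cvg.
have [k0 k0A] : exists k0, 0 < tri_area tri Q k0.
  apply/existsP; apply: contraT => /existsPn h.
  move: (lt_le_trans d0 Ad); rewrite big1 ?ltxx // => k _.
  by apply/eqP; rewrite eq_le A0 andbT leNgt h.
have adj k l : adjacent2 Delta (face tri k) (face tri l) ->
    0 < tri_area tri Q k -> 0 < tri_area tri Q l.
  move=> /and3P[_ _]; rewrite inE => /andP[_ /eqP c2] kA.
  have /card_gt1P[i [j [+ + ij]]] : (1 < #|face tri k :&: face tri l|)%N by rewrite c2.
  rewrite !inE => /andP[/faceP[m1 E1] /faceP[n1 F1]] /andP[/faceP[m2 E2] /faceP[n2 F2]].
  apply: pS; apply: (@sum_sqr_edges_gt0 _ _ n1 n2); rewrite /pt -F1 -F2 E1 E2 => Eq.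
  have a0 : area2 (pt Q k) != 0 by apply: contraTneq kA => az; rewrite tri_areaE az mulr0 ltxx.
  have := bary_vertex a0 m1 m2; rewrite -[X in bary _ _ X]Eq bary_vertex // eqxx.
  case: eqP => [mm|_ /eqP]; last by rewrite oner_eq0.
  by move: ij; rewrite E1 E2 mm eqxx.
move=> k; have [->//|k0k] := eqVneq k k0.
have [_ _ pc] := cc.
have f0k : face tri k0 != face tri k by rewrite (inj_eq en.1) eq_sym.
have /connectP[p pP pk] := pc _ _ (face_kfaces en k0) (face_kfaces en k) f0k.
elim: p k0 k0A pP pk {k0k f0k} => [|G p IH] k1 k1A /= => [_ /en.1 -> //|/andP[kG pP] pk].
have [l GE] : exists l, G = face tri l by apply/en.2; case/and3P: kG.
by subst G; apply: (IH l) => //; exact: adj kG k1A.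
Qed.

(** Strictness at an unshared vertex makes the normals nonzero; scaled to unit length they converge
    along the ultrafilter to a unit vector. *)
Lemma weakly_separated_limit k l : k != l -> (forall t, Mplus Delta tri (q t)) ->
  weakly_separated tri Q k l.
Proof.
move=> kl qM.
have sep t : exists w : plane, (w.1 ^+ 2 + w.2 ^+ 2 = 1) /\
    forall m m', dot w (pt (q t) l m') <= dot w (pt (q t) k m).
  have [pos sep] := (Mplus_separated cc en co _).1 (qM t).
  have [w wP] := sep _ _ kl.
  have w0 : w != 0.
    apply: contraTneq isT => w0; have [m ml] := nonshared_vertex en kl.
    by have [_] := wP m 0; rewrite ml w0 !dot0l ltxx => /(_ isT).
  exists ((enorm w)^-1 *: w); split.
    have := enorm_gt0 w0; have : enorm w ^+ 2 = w.1 ^+ 2 + w.2 ^+ 2.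
      by rewrite sqr_sqrtr ?dot_ge0 // /dot -!expr2.
    rewrite !pairE !exprMn -mulrDr => <- w1; rewrite -exprMn mulVf ?expr1n //.
    by rewrite gt_eqF.
  move=> m m'; rewrite !dotZl ler_wpM2l //; first by rewrite invr_ge0 ltW ?enorm_gt0.
  by case: (wP m m').
pose w t := projT1 (cid (sep t)).
have w1 t : (w t).1 ^+ 2 + (w t).2 ^+ 2 = 1 by rewrite /w; case: cid => ? [].
have wP t m m' : dot (w t) (pt (q t) l m') <= dot (w t) (pt (q t) k m).
  by rewrite /w; case: cid => ? [].
have wb1 t : `|(w t).1| <= 1.
  by rewrite -(expr_le1 (n := 2)) // real_normK ?num_real // -(w1 t) lerDl sqr_ge0.
have wb2 t : `|(w t).2| <= 1.
  by rewrite -(expr_le1 (n := 2)) // real_normK ?num_real // -(w1 t) lerDr sqr_ge0.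
have [v1 c1] := ultra_cvg UU wb1; have [v2 c2] := ultra_cvg UU wb2.
exists (v1, v2).
  have : v1 ^+ 2 + v2 ^+ 2 = 1.
    have : (w t).1 ^+ 2 + (w t).2 ^+ 2 @[t --> U] --> v1 ^+ 2 + v2 ^+ 2.
      by apply: cvgD; apply: cvgM.
    under eq_cvg do rewrite w1; move=> h.
    exact: (cvg_unique (@norm_hausdorff _ _) h (cvg_cst _)).
  move=> h; apply/eqP => -[v10 v20]; move: h.
  by rewrite v10 v20 expr0n addr0 => /eqP; rewrite eq_sym oner_eq0.
move=> m m'; apply: (@cvg_ler _ _ U _ (fun t => dot (w t) (pt (q t) l m'))
  (fun t => dot (w t) (pt (q t) k m))) => //; exact: dot_vtx_cvg.
Qed.

(** Contact in the limit at parameter [s] makes the difference vectors at the same [s] tend to zero,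
    while [edge_dist_le] keeps them away from it. *)
Lemma off_boundary_limit (d : R) : 0 < d ->
  (forall t e i, e \in boundary_edges tri -> i \in boundary_vertices tri ->
     i != e.1 -> i != e.2 -> d <= edge_dist nrm (q t) i e.1 e.2) ->
  off_boundary tri Q.
Proof.
move=> d0 qd e i eB iB i1 i2 /conv_hull_pair[s [s0 s1 iE]].
pose x t := vtx (q t) i - (s *: vtx (q t) e.1 + (1 - s) *: vtx (q t) e.2).
pose z := vtx Q i - (s *: vtx Q e.1 + (1 - s) *: vtx Q e.2).
have x1 : (x t).1 @[t --> U] --> z.1.
  apply: cvgB; first exact: vtx1_cvg.
  by apply: cvgD; apply: cvgM; try exact: cvg_cst; exact: vtx1_cvg.
have x2 : (x t).2 @[t --> U] --> z.2.
  apply: cvgB; first exact: vtx2_cvg.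
  by apply: cvgD; apply: cvgM; try exact: cvg_cst; exact: vtx2_cvg.
have z0 : z = 0 by rewrite /z -iE subrr.
have : d <= (`|z.1| + `|z.2|) *+ 2.
  rewrite mulr2n; apply: (cvgr_to_ge (F := U)
    (f := fun t => (`|(x t).1| + `|(x t).2|) + (`|(x t).1| + `|(x t).2|))).
    by apply: cvgD; apply: cvgD; apply: cvg_norm.
  apply: nearW => t; apply: (le_trans (qd t e i eB iB i1 i2)).
  by rewrite -mulr2n; apply: edge_dist_le s0 s1 _.
by rewrite z0 !normr0 addr0 mul0rn leNgt d0.
Qed.

Lemma Mplus_limit (C d d' : R) : 0 < d -> 0 < d' ->
  (forall t, Mplus Delta tri (q t)) ->
  (forall t k, inv_psi tri (q t) k <= C) ->
  (forall t, d <= \sum_k tri_area tri (q t) k) ->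
  (forall t e i, e \in boundary_edges tri -> i \in boundary_vertices tri ->
     i != e.1 -> i != e.2 -> d' <= edge_dist nrm (q t) i e.1 e.2) ->
  Mplus Delta tri Q.
Proof.
move=> d0 d'0 qM qC qd qd'.
have pos : pos_areas tri Q.
  by apply: pos_areas_limit d0 _ qC qd => t; case: (qM t).
apply/(Mplus_proper cc en); split=> //.
apply: (weak_proper cc en co pos); first by move=> k l kl; exact: weakly_separated_limit.
exact: off_boundary_limit qd'.
Qed.

End Limit.

End MplusLimit.

(** * Nodal interpolation and the space [S10] *)

Section Interpolation.
Context {R : realType} {N NT : nat}.
Context (Delta : {set {set 'I_N}}) (tri : 'I_NT -> 'I_3 -> 'I_N).
Notation plane := (R * R)%type.
Implicit Types (Q : 'M[R]_(2, N)) (x y w : plane) (k l : 'I_NT) (c : 'I_N -> R).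
Hypothesis cc : connectivity_complex Delta.
Hypothesis en : enumerates_2faces Delta tri.
Hypothesis co : consistently_oriented tri.

Local Notation pt := (@pt R N NT tri).
Local Notation triT := (@triT R N NT tri).

Definition affine_piece Q c k x : R := \sum_m bary (pt Q k) m x * c (tri k m).

Definition piece_grad Q c k : plane := \sum_m c (tri k m) *: bary_grad (pt Q k) m.

Definition piece_const Q c k : R := \sum_m c (tri k m) * bary_const (pt Q k) m.

(** The triangle picked does not matter in a proper mesh, by [weight_eq]. The value 0 outside
    matches the extension by zero in [S10]. *)
Definition interp Q c x : R :=
  if [pick k | `[< triT Q k x >]] is Some k then affine_piece Q c k x else 0.

Lemma affine_pieceE Q c k x :
  affine_piece Q c k x = dot (piece_grad Q c k) x + piece_const Q c k.
Proof.
rewrite /piece_grad dotC dot_sum /piece_const -big_split /=.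
apply: eq_bigr => m _; rewrite bary_affine dotZr dotC; ring.
Qed.

Lemma affine_piece_weight Q c k x : affine_piece Q c k x = \sum_i weight tri Q k i x * c i.
Proof.
rewrite /affine_piece (partition_big (tri k) xpredT) //=; apply: eq_bigr => i _.
by rewrite /weight mulr_suml; apply: eq_bigr => m /eqP ->.
Qed.

Lemma interp_out Q c x : (forall k, ~ triT Q k x) -> interp Q c x = 0.
Proof. by move=> nx; rewrite /interp; case: pickP => // k /asboolP /nx. Qed.

Lemma fst_cvg x : y.1 @[y --> x] --> x.1.
Proof. exact: cvg_fst. Qed.

Lemma snd_cvg x : y.2 @[y --> x] --> x.2.
Proof. exact: cvg_snd. Qed.

Lemma nbhs_plane_filter x : Filter (nbhs x).
Proof. exact: _. Qed.

Lemma bary_continuous Q k m : continuous (bary (pt Q k) m).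
Proof. by move=> x; exact: (bary_cvg _ (@fst_cvg x) (@snd_cvg x)). Qed.

Lemma bary_near Q x k m : 0 < bary (pt Q k) m x -> \forall y \near x, 0 < bary (pt Q k) m y.
Proof. move=> h; exact: (cvgr_gt _ (@bary_continuous Q k m x) 0 h). Qed.

Lemma bary_near_lt Q x k m : bary (pt Q k) m x < 0 -> \forall y \near x, bary (pt Q k) m y < 0.
Proof. move=> h; exact: (cvgr_lt _ (@bary_continuous Q k m x) 0 h). Qed.

Lemma not_triT_near Q x k : ~ triT Q k x -> \forall y \near x, ~ triT Q k y.
Proof.
move=> nx; have [m xm] : exists m, bary (pt Q k) m x < 0.
  apply/existsP; apply: contrapT => /negP/existsPn h; apply: nx => m.
  by rewrite leNgt h.
by apply: filterS (bary_near_lt xm) => y ym /(_ m); rewrite leNgt ym.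
Qed.

Lemma triT_interior_near Q x k : (forall m, 0 < bary (pt Q k) m x) ->
  \forall y \near x, forall m, 0 < bary (pt Q k) m y.
Proof. by move=> xk; exact: (filter_forall _ (fun m => bary_near (xk m))). Qed.

Lemma OmegaP Q x : pos_areas tri Q -> Omega tri Q x <-> exists k, triT Q k x.
Proof.
move=> pos; split=> [[k _ /(conv_face_full _ _ pos) xk]|[k xk]]; exists k => //.
exact/(conv_face_full _ _ pos).
Qed.

Lemma not_Omega_near Q x : pos_areas tri Q -> ~ Omega tri Q x ->
  \forall y \near x, ~ Omega tri Q y.
Proof.
move=> pos nx.
have H k : \forall y \near x, ~ triT Q k y.
  by apply: not_triT_near => xk; apply: nx; apply/OmegaP => //; exists k.
apply: filterS (filter_forall _ H) => y Hy /(OmegaP _ pos)[k].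
exact: Hy.
Qed.

Lemma frontier_Omega Q x : pos_areas tri Q -> frontier (Omega tri Q) x ->
  Omega tri Q x /\ ~ (\forall y \near x, Omega tri Q y).
Proof.
move=> pos [xc xi]; split; last by move=> h; apply: xi.
apply: contrapT => /(not_Omega_near pos) h.
by have [y [yO ny]] := xc _ h.
Qed.

Lemma affine_piece_cvg Q c k x (T : Type) (F : set_system T) (FF : Filter F) (u : T -> plane) :
  (u t).1 @[t --> F] --> x.1 -> (u t).2 @[t --> F] --> x.2 ->
  affine_piece Q c k (u t) @[t --> F] --> affine_piece Q c k x.
Proof.
move=> u1 u2; apply: cvg_sumr => m; apply: cvgM; last exact: cvg_cst.
exact: bary_cvg.
Qed.

Section FixQ.
Variable Q : 'M[R]_(2, N).
Hypothesis pos : pos_areas tri Q.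
Hypothesis INT : meets_properly tri Q.

Let a0 k : area2 (pt Q k) != 0 := area2_neq0 k pos.

Lemma interpE c k x : triT Q k x -> interp Q c x = affine_piece Q c k x.
Proof.
move=> xk; rewrite /interp; case: pickP => [l /asboolP xl|/(_ k) /asboolP //].
rewrite !affine_piece_weight; apply: eq_bigr => i _.
by rewrite (weight_eq en i pos INT xl xk).
Qed.

Lemma affine_piece_vertex c k m : affine_piece Q c k (pt Q k m) = c (tri k m).
Proof.
rewrite /affine_piece (bigD1 m) //= bary_vertex // eqxx mul1r big1 ?addr0 // => n nm.
by rewrite bary_vertex // (negbTE nm) mul0r.
Qed.

Lemma interp_vertex c i : interp Q c (vtx Q i) = c i.
Proof.
have [k [m im]] := vertex_in_face cc en i; rewrite im -/(pt Q k m).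
by rewrite (@interpE _ k) ?affine_piece_vertex //; exact: tri_hull_vertex.
Qed.

Lemma piecewise_continuous (f : plane -> R) :
  (forall k, exists c, forall x, triT Q k x -> f x = affine_piece Q c k x) ->
  {within Omega tri Q, continuous f}.
Proof.
move=> fk; apply/subspace_continuousP => x xO; apply/cvgrPdist_lt => e e0.
have H k : \forall y \near x, triT Q k y -> `|f x - f y| < e.
  have [xk|/not_triT_near] := pselect (triT Q k x); last first.
    by apply: filterS => y ny /ny.
  have [c cE] := fk k.
  have H : affine_piece Q c k y @[y --> x] --> affine_piece Q c k x.
    exact: (@affine_piece_cvg Q c k x _ (nbhs x) _ id (@fst_cvg x) (@snd_cvg x)).
  have /cvgrPdist_lt/(_ e e0) := H; apply: filterS => y yE yk.
  by rewrite !cE.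
apply: filterS (filter_forall _ H) => y Hy /(OmegaP _ pos)[k]; exact: Hy.
Qed.

Lemma affine_piece_linear (g : plane) (d : R) k x :
  affine_piece Q (fun i => dot g (vtx Q i) + d) k x = dot g x + d.
Proof.
rewrite -[in RHS](bary_comb (a0 k) x) dot_sum -[d in RHS]mul1r.
rewrite -(bary_sum (a0 k) x) mulr_suml -big_split /=; apply: eq_bigr => m _.
by rewrite dotZr mulrDr.
Qed.

(** Interiors of triangles, interior vertices and the relative interiors of inner edges all have
    neighbourhoods inside [Omega], so [x] is carried by boundary vertices. *)
Lemma frontier_point x k : frontier (Omega tri Q) x -> triT Q k x ->
  forall i, i \in face tri k -> i \notin boundary_vertices tri -> weight tri Q k i x = 0.
Proof.
move=> /(frontier_Omega pos)[xO xi] xk.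
have [m xm] : exists m, bary (pt Q k) (m + 2) x = 0.
  have [/existsP[m /eqP m0]|/existsPn h] :=
    boolP [exists m, bary (pt Q k) (m + 2) x == 0]; first by exists m.
  exfalso; apply: xi; have : forall m, 0 < bary (pt Q k) m x.
    by move=> m; rewrite lt_def xk andbT; have := h (m + 1); rewrite ord3_add1_3.
  move=> /triT_interior_near; apply: filterS => y yk; apply/OmegaP => //.
  by exists k => m; exact: ltW.
have xE : x = bary (pt Q k) m x *: pt Q k m + bary (pt Q k) (m + 1) x *: pt Q k (m + 1).
  by rewrite -{1}(bary_comb (a0 k) x) (sum3_shift _ m) xm scale0r addr0.
have sum1 : bary (pt Q k) m x + bary (pt Q k) (m + 1) x = 1.
  by have := bary_sum (a0 k) x; rewrite (sum3_shift _ m) xm addr0.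
have vertex_case n : x = pt Q k n -> tri k n \notin boundary_vertices tri -> False.
  move=> xn nB; apply: xi.
  have := interior_vertex_covered cc en co pos (nbhs_plane_filter x) nB xn (@fst_cvg x) (@snd_cvg x).
  by apply: filterS => y [l yl _]; apply/OmegaP => //; exists l.
move=> i /faceP[n ->] nB; rewrite (weight_tri en).
have [xm0|xm0] := eqVneq (bary (pt Q k) m x) 0.
  have xr : x = pt Q k (m + 1).
    by move: sum1 xE; rewrite xm0 add0r => ->; rewrite scale0r add0r scale1r.
  rewrite {1}xr bary_vertex //; case: eqP => // E; exfalso.
  by apply: (vertex_case _ xr); rewrite -E.
have [xm1|xm1] := eqVneq (bary (pt Q k) (m + 1) x) 0.
  have xr : x = pt Q k m.
    by move: sum1 xE; rewrite xm1 addr0 => ->; rewrite scale0r addr0 scale1r.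
  rewrite {1}xr bary_vertex //; case: eqP => // E; exfalso.
  by apply: (vertex_case _ xr); rewrite -E.
case: (ord3_shift m n) => nE; last by rewrite nE.
  have : (tri k m, tri k (m + 1)) \notin boundary_edges tri.
    by apply: contra nB => /boundary_edge_vertices[]; rewrite nE.
  move=> /(interior_edge co)[l [n' [_ E1 E2]]]; exfalso; apply: xi.
  have p0 : 0 < bary (pt Q k) m x by rewrite lt_def xm0 xk.
  have p1 : 0 < bary (pt Q k) (m + 1) x by rewrite lt_def xm1 xk.
  have := interior_edge_covered pos (nbhs_plane_filter x) E1 E2 xm p0 p1 (@fst_cvg x) (@snd_cvg x).
  by apply: filterS => y [yk|yl]; apply/OmegaP => //; [exists k|exists l].
have : (tri k m, tri k (m + 1)) \notin boundary_edges tri.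
  by apply: contra nB => /boundary_edge_vertices[]; rewrite nE.
move=> /(interior_edge co)[l [n' [_ E1 E2]]]; exfalso; apply: xi.
have p0 : 0 < bary (pt Q k) m x by rewrite lt_def xm0 xk.
have p1 : 0 < bary (pt Q k) (m + 1) x by rewrite lt_def xm1 xk.
have := interior_edge_covered pos (nbhs_plane_filter x) E1 E2 xm p0 p1 (@fst_cvg x) (@snd_cvg x).
by apply: filterS => y [yk|yl]; apply/OmegaP => //; [exists k|exists l].
Qed.

Lemma S10_interp c : (forall i, i \in boundary_vertices tri -> c i = 0) ->
  S10 tri Q (interp Q c).
Proof.
move=> cB; split.
- by apply: piecewise_continuous => k; exists c => x; exact: interpE.
- move=> k; exists (piece_grad Q c k), (piece_const Q c k) => x.
  by move=> /(conv_face_full _ _ pos) xk; rewrite (interpE _ xk) affine_pieceE.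
- move=> x xF; have [/(OmegaP _ pos)[k xk] _] := frontier_Omega pos xF.
  rewrite (interpE _ xk) affine_piece_weight big1 // => i _.
  have [iB|iB] := boolP (i \in boundary_vertices tri); first by rewrite cB // mulr0.
  have [ik|ik] := boolP (i \in face tri k); last by rewrite weight_notin // mul0r.
  by rewrite frontier_point // mul0r.
- by move=> x xO; apply: interp_out => k xk; apply: xO; apply/OmegaP => //; exists k.
Qed.

(** Another triangle containing the point would share both ends of the edge, so near the point
    [Omega] is only triangle [k], which lies on one side. *)
Lemma boundary_edge_frontier k m (s : R) : (tri k m, tri k (m + 1)) \in boundary_edges tri ->
  0 < s -> s < 1 ->
  frontier (Omega tri Q) (s *: pt Q k m + (1 - s) *: pt Q k (m + 1)).
Proof.
move=> eB s0 s1; set x := _ + _.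
have s1' : 0 < 1 - s by rewrite subr_gt0.
case: (ord3_shift_neq m) => /negbTE m01 /negbTE m02 /negbTE m12.
have m10 : (m + 1 == m) = false by rewrite eq_sym.
have m20 : (m + 2 == m) = false by rewrite eq_sym.
have m21 : (m + 2 == m + 1) = false by rewrite eq_sym.
have bm n : bary (pt Q k) n x = s * (n == m)%:R + (1 - s) * (n == m + 1)%:R.
  by rewrite bary_conv !bary_vertex.
have xk : triT Q k x.
  by move=> n; rewrite bm addr_ge0 // mulr_ge0 ?ler0n // ltW.
split; first by apply: subset_closure; apply/OmegaP => //; exists k.
move=> xi.
have xl l : l != k -> ~ triT Q l x.
  move=> lk xl; have kl : k != l by rewrite eq_sym.
  have mem n : bary (pt Q k) n x != 0 -> tri k n \in face tri l.
    by move=> h; apply: contraNT h => h; apply/eqP; exact: INT kl _ xk xl _ h.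
  have ml : tri k m \in face tri l.
    by apply: mem; rewrite bm eqxx m01 mulr1 mulr0 addr0 gt_eqF.
  have m1l : tri k (m + 1) \in face tri l.
    by apply: mem; rewrite bm eqxx m10 mulr1 mulr0 add0r gt_eqF.
  move: eB; rewrite inE => /andP[_ /cards1P[k' kE]].
  have kk' : k = k'.
    apply/finset.set1P; rewrite -kE inE; apply/fintype.subsetP => i.
    by rewrite !inE => /orP[] /eqP ->; rewrite mem_face.
  have lk' : l = k'.
    apply/finset.set1P; rewrite -kE inE; apply/fintype.subsetP => i.
    by rewrite !inE => /orP[] /eqP ->.
  by move: lk; rewrite lk' -kk' eqxx.
(* These points cross the edge: their coordinate at vertex [m + 2] is [- t]. *)
pose z (t : R) := (1 + t) *: x + (- t) *: pt Q k (m + 2).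
have z1 : (z t).1 @[t --> (0 : R)^'+] --> x.1.
  have id0 : s @[s --> (0 : R)^'+] --> (0 : R) by exact: cvg_at_right_filter.
  have : (1 + t) * x.1 + (- t) * (pt Q k (m + 2)).1 @[t --> (0 : R)^'+] -->
     (1 + 0) * x.1 + (- 0) * (pt Q k (m + 2)).1.
    apply: cvgD; apply: cvgM; try exact: cvg_cst; last exact: cvgN.
    by apply: cvgD => //; exact: cvg_cst.
  by rewrite addr0 mul1r oppr0 mul0r addr0.
have z2 : (z t).2 @[t --> (0 : R)^'+] --> x.2.
  have id0 : s @[s --> (0 : R)^'+] --> (0 : R) by exact: cvg_at_right_filter.
  have : (1 + t) * x.2 + (- t) * (pt Q k (m + 2)).2 @[t --> (0 : R)^'+] -->
     (1 + 0) * x.2 + (- 0) * (pt Q k (m + 2)).2.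
    apply: cvgD; apply: cvgM; try exact: cvg_cst; last exact: cvgN.
    by apply: cvgD => //; exact: cvg_cst.
  by rewrite addr0 mul1r oppr0 mul0r addr0.
have zx : z t @[t --> (0 : R)^'+] --> x.
  by rewrite [x]surjective_pairing; exact: (cvg_pair z1 z2).
have H l : \forall y \near x, l != k -> ~ triT Q l y.
  have [->|/xl/not_triT_near] := eqVneq l k; last first.
    by apply: filterS => y ny _.
  by apply: filterS (@filterT _ (nbhs x) _).
have HF : \forall y \near x, Omega tri Q y /\ forall l, l != k -> ~ triT Q l y.
  exact: (filterI xi (filter_forall _ H)).
have [t [t0 [/(OmegaP _ pos)[l zl] nzl]]] : exists t : R, 0 < t /\
    (Omega tri Q (z t) /\ forall l, l != k -> ~ triT Q l (z t)).
  apply: (@filter_ex _ (0 : R)^'+ _); apply: filterI; last exact: zx _ HF.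
  exact: nbhs_right_gt.
have [lk|lk] := eqVneq l k; last exact: nzl lk zl.
subst l; have := zl (m + 2).
rewrite /z -{1}[- t](addrK 1) (_ : - t + 1 - 1 = 1 - (1 + t)); last by ring.
rewrite bary_conv bm m20 m21 !mulr0 addr0 mulr0 add0r bary_vertex //.
by rewrite eqxx mulr1 subr_ge0 -[X in _ <= X]addr0 lerD2l leNgt t0.
Qed.

Lemma S10_boundary_vertex (y : plane -> R) i : S10 tri Q y -> i \in boundary_vertices tri ->
  y (vtx Q i) = 0.
Proof.
move=> [_ yaff yF _] /boundary_vertexP[e eB ie].
have [k [m [E1 E2]]] := boundary_edge_face eB.
have [g [d gE]] := yaff k.
have eB' : (tri k m, tri k (m + 1)) \in boundary_edges tri.
  by rewrite -E1 -E2 -surjective_pairing.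
have mid (s : R) : 0 < s -> s < 1 ->
    s * y (pt Q k m) + (1 - s) * y (pt Q k (m + 1)) = 0.
  move=> s0 s1; have /yF := boundary_edge_frontier eB' s0 s1.
  have gT x : triT Q k x -> y x = dot g x + d by move=> /(conv_face_full _ _ pos); exact: gE.
  have vT n : triT Q k (pt Q k n) by exact: tri_hull_vertex.
  rewrite !gT //; last first.
    by move=> n; rewrite bary_conv addr_ge0 // mulr_ge0 ?vT // ?subr_ge0 ltW.
  by rewrite dotDr !dotZr => <-; ring.
(* An affine function on the edge that vanishes at two of its inner points vanishes at the ends. *)
have h1 := mid 3%:R^-1; have h2 := mid 2%:R^-1.
have {}h1 := h1 (ltac:(lra)) (ltac:(lra)); have {}h2 := h2 (ltac:(lra)) (ltac:(lra)).
by case: ie => ->; [rewrite E1 -/(pt Q k m)|rewrite E2 -/(pt Q k (m + 1))]; lra.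
Qed.

Lemma S10_nodal (y : plane -> R) : S10 tri Q y -> y = interp Q (fun i => y (vtx Q i)).
Proof.
move=> yS; have [_ yaff _ yO] := yS; apply/funext => x.
have [[k xk]|nx] := pselect (exists k, triT Q k x); last first.
  rewrite interp_out; last by move=> k xk; apply: nx; exists k.
  by apply: yO => /(OmegaP _ pos).
have [g [d gE]] := yaff k.
have gT z : triT Q k z -> y z = dot g z + d by move=> /(conv_face_full _ _ pos); exact: gE.
rewrite (interpE _ xk) gT // -(affine_piece_linear g d k x).
apply: eq_bigr => m _; congr (_ * _); rewrite -gT //; exact: tri_hull_vertex.
Qed.

Lemma grad_interp c k x : (forall m, 0 < bary (pt Q k) m x) ->
  grad (interp Q c) x = piece_grad Q c k.
Proof.
move=> xk; have H v : 'D_v (interp Q c) x = dot (piece_grad Q c k) v.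
  have near0 : \forall h \near (0 : R)^', forall m, 0 < bary (pt Q k) m (h *: v + x).
    have z1 : (h *: v + x).1 @[h --> (0 : R)^'] --> x.1.
      have id0 : s @[s --> (0 : R)^'] --> (0 : R) by exact: nbhs_dnbhs.
      have : h * v.1 + x.1 @[h --> (0 : R)^'] --> 0 * v.1 + x.1.
        by apply: cvgD; [apply: cvgM => //|]; exact: cvg_cst.
      by rewrite mul0r add0r.
    have z2 : (h *: v + x).2 @[h --> (0 : R)^'] --> x.2.
      have id0 : s @[s --> (0 : R)^'] --> (0 : R) by exact: nbhs_dnbhs.
      have : h * v.2 + x.2 @[h --> (0 : R)^'] --> 0 * v.2 + x.2.
        by apply: cvgD; [apply: cvgM => //|]; exact: cvg_cst.
      by rewrite mul0r add0r.
    apply: filter_forall => m; have := xk m; apply: cvgr_gt.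
    exact: (@bary_cvg _ _ _ tri Q _ _ _ _ x k m z1 z2).
  apply: cvg_lim; first exact: norm_hausdorff.
  have xT : triT Q k x by move=> m; exact: ltW.
  apply: (@cvg_trans _ ((fun=> dot (piece_grad Q c k) v) @ (0 : R)^')); last exact: cvg_cst.
  apply: near_eq_cvg; near=> h.
  have h0 : h != 0 by near: h; exact: nbhs_dnbhs_neq.
  have hT : triT Q k (h *: v + x) by move=> m; apply: ltW; move: m; near: h.
  have -> : (interp Q c \o shift x) (h *: v) = interp Q c (h *: v + x) by [].
  rewrite (interpE _ xT) (interpE _ hT) !affine_pieceE dotDr dotZr.
  by rewrite -[RHS]/(h^-1 * _); field.
by rewrite /grad !H /dot /= !mulr1 !mulr0 addr0 add0r -surjective_pairing.
Unshelve. all: by end_near. Qed.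

End FixQ.

End Interpolation.

(** * Integrals and null sets *)

Section NullSets.
Context d (T : measurableType d) (R : realType).
Variable mu : {measure set T -> \bar R}.
Import HBNNSimple.

(* [f] need not be measurable: truncating to the complement of [N] a simple
   function below [f] does not change its integral. *)
Lemma integral_setD_null (D N : set T) (f : T -> \bar R) :
  measurable N -> mu N = 0%E ->
  (\int[mu]_(x in D) f x = \int[mu]_(x in D `\` N) f x)%E.
Proof.
move=> mN N0.
have mC : measurable (~` N) by exact: measurableC.
have ge0 (g : T -> \bar R) : (forall x, 0 <= g x)%E ->
    (\int[mu]_(x in D) g x = \int[mu]_(x in D `\` N) g x)%E.
  move=> g0; rewrite integral_mkcond [RHS]integral_mkcond.
  have gD0 A x : (0 <= (g \_ A) x)%E by rewrite /patch; case: ifP.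
  rewrite !ge0_integralTE //; apply/eqP; rewrite eq_le; apply/andP; split.
    apply: ge_ereal_sup => _ [h /= hg <-]; apply: ereal_sup_ubound.
    exists (proj_nnsfun h mC).
      suff H x : ((((h : T -> R) \_ (~` N)) x)%:E <= (g \_ (D `\` N)) x)%E.
        by move=> x; have := H x; rewrite (mrestrict h mC).
      rewrite /patch in_setD in_setC; have := hg x; rewrite /patch.
      by case: (x \in N); rewrite ?andbF // andbT.
    rewrite -!integralT_nnsfun.
    rewrite [RHS](ge0_negligible_integral mN) //; last 2 first.
    - by apply/measurable_EFinP; exact: measurable_funP.
    - by move=> x _; rewrite lee_fin.
    rewrite setTD [RHS]integral_mkcond; apply: eq_integral => x _.
    by rewrite -(mrestrict h mC) /patch; case: ifP.
  apply: ereal_sup_le => _ [h /= hg <-]; exists h => // x.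
  apply: le_trans (hg x) _; rewrite /patch in_setD.
  by case: ifP => [/andP[-> _]//|_]; case: ifP.
by rewrite integralE [RHS]integralE !ge0.
Qed.

Lemma Rintegral_setD_null (D N : set T) (f : T -> R) :
  measurable N -> mu N = 0%E ->
  \int[mu]_(x in D) f x = \int[mu]_(x in D `\` N) f x.
Proof. by move=> mN N0; rewrite /Rintegral (integral_setD_null _ _ mN). Qed.

End NullSets.

(** * Lebesgue measure in the plane *)

Section PlaneMeasure.
Context {R : realType}.
Notation plane := (R * R)%type.
Notation mplane := (measurableTypeR R * measurableTypeR R)%type.
Notation mu := (@lebesgue2 R).

Lemma measurable_affine (g : plane) (d : R) :
  measurable_fun [set: mplane] (fun x : mplane => dot g x + d : R).
Proof.
apply: measurable_funD; last exact: measurable_cst.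
by apply: measurable_funD; apply: measurable_funM; try exact: measurable_cst;
  [exact: measurable_fst|exact: measurable_snd].
Qed.

Lemma lebesgue2_setX (A B : set (measurableTypeR R)) : measurable A -> measurable B ->
  mu (A `*` B) = (lebesgue_measure A * lebesgue_measure B)%E.
Proof. by move=> mA mB; apply: product_measure1E. Qed.

(** Vertical sections of the line are single points unless the line is itself vertical; then it is a
    null point times an axis. *)
Lemma line_null (g : plane) (d : R) : g != 0 ->
  measurable ([set x | dot g x + d = 0] : set mplane) /\
  mu [set x | dot g x + d = 0] = 0%E.
Proof.
move=> g0.
have mL : measurable ([set x | dot g x + d = 0] : set mplane).
  have := measurable_affine g d; move=> /(_ measurableT [set (0 : R)] (measurable_set1 _)).
  by rewrite setTI.
split=> //.
have [g2|g2] := eqVneq g.2 0; last first.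
  apply: integral0_eq => s _ /=.
  rewrite (_ : xsection _ s = [set - (d + g.1 * s) / g.2]) ?lebesgue_measure_set1 //.
  apply/seteqP; split=> t /=; rewrite /xsection /= inE /= /dot /=.
    move=> E; apply: (mulIf g2); rewrite mulfVK //; move: E; lra.
  by move=> ->; field.
have g1 : g.1 != 0.
  by apply: contraNneq g0 => g1; rewrite [g]surjective_pairing g1 g2.
rewrite (_ : [set _ | _] = [set - d / g.1] `*` setT).
  by rewrite lebesgue2_setX // lebesgue_measure_set1 mul0e.
apply/seteqP; split=> -[s t] /=; rewrite /dot /= g2 mul0r addr0.
  by move=> E; split=> //; apply: (mulIf g1); rewrite mulfVK //; move: E; lra.
by move=> [-> _]; field.
Qed.

Lemma box_measure (a a' b b' : R) : a <= a' -> b <= b' ->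
  measurable (rectangle a a' b b' : set mplane) /\
  mu (rectangle a a' b b') = ((a' - a) * (b' - b))%:E.
Proof.
move=> aa bb.
have -> : rectangle a a' b b' = `[a, a']%classic `*` `[b, b']%classic.
  by apply/seteqP; split=> -[s t] /=; rewrite !in_itv.
split; first exact: measurableX.
rewrite lebesgue2_setX // !lebesgue_measure_itv /= !lte_fin.
have [aa'|] := ltP a a'; last first.
  move=> a'a; have -> : a' = a by apply/eqP; rewrite eq_le aa a'a.
  by rewrite mul0e subrr mul0r.
have [bb'|] := ltP b b'; last first.
  move=> b'b; have -> : b' = b by apply/eqP; rewrite eq_le bb b'b.
  by rewrite mule0 subrr mulr0.
by rewrite -!EFinB -EFinM.
Qed.

End PlaneMeasure.

Section RintegralSum.
Context d (T : measurableType d) (R : realType).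
Variable mu : {measure set T -> \bar R}.

Lemma Rintegral_sum (I : finType) (D : set T) (f : I -> T -> R) : measurable D ->
  (forall i, mu.-integrable D (EFin \o f i)) ->
  \int[mu]_(x in D) (\sum_i f i x) = \sum_i \int[mu]_(x in D) f i x.
Proof.
move=> mD fi; rewrite /Rintegral.
under eq_integral do rewrite -sumEFin.
rewrite (@integral_sum _ _ _ mu D mD I (fun i => EFin \o f i)) //.
by rewrite sum_fine // => i _; apply: integrable_fin_num (fi i).
Qed.

End RintegralSum.

(** * Moments of the barycentric coordinates *)

Section Moments.
Context {R : realType} {N NT : nat}.
Context (Delta : {set {set 'I_N}}) (tri : 'I_NT -> 'I_3 -> 'I_N).
Notation plane := (R * R)%type.
Notation mplane := (measurableTypeR R * measurableTypeR R)%type.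
Notation mu := (@lebesgue2 R).
Implicit Types (Q : 'M[R]_(2, N)) (x y w : plane) (k l : 'I_NT) (c : 'I_N -> R).
Hypothesis en : enumerates_2faces Delta tri.

Local Notation pt := (@pt R N NT tri).
Local Notation triT := (@triT R N NT tri).

Variables (a a' b b' : R).
Hypotheses (aa : a <= a') (bb : b <= b').
Let B : set mplane := rectangle a a' b b'.

Let mB : measurable B := (box_measure aa bb).1.

Lemma measurable_bary Q k m : measurable_fun [set: mplane] (bary (pt Q k) m : mplane -> R).
Proof.
rewrite (_ : bary _ _ = fun x => dot (bary_grad (pt Q k) m) x + bary_const (pt Q k) m).
  exact: measurable_affine.
by apply/funext => x; rewrite bary_affine.
Qed.

Lemma measurable_triT Q k : measurable (triT Q k : set mplane).
Proof.
have mH m : measurable ([set x | 0 <= bary (pt Q k) m x] : set mplane).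
  have := measurable_bary Q k m; move=> /(_ measurableT `[0, +oo[%classic (measurable_itv _)).
  rewrite setTI (_ : _ @^-1` _ = [set x | 0 <= bary (pt Q k) m x]) //.
  by apply/seteqP; split=> x /=; rewrite in_itv /= andbT.
rewrite (_ : triT Q k = [set x | 0 <= bary (pt Q k) 0 x] `&`
  ([set x | 0 <= bary (pt Q k) 1 x] `&` [set x | 0 <= bary (pt Q k) 2 x])).
  by apply: measurableI => //; exact: measurableI.
by apply/seteqP; split=> [x xk|x [x0 [x1 x2]]]; [do !split; exact: xk|exact: ord3P].
Qed.

Definition in_box Q := forall i, rectangle a a' b b' (vtx Q i).

Lemma triT_box Q k x : pos_areas tri Q -> in_box Q -> triT Q k x -> B x.
Proof.
move=> pos Qb /(conv_face_full _ _ pos) xk; apply: xk; split.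
  apply/convex_setP => y z t [/andP[y1 y2] /andP[y3 y4]] [/andP[z1 z2] /andP[z3 z4]] t0 t1.
  have t1' : 0 <= 1 - t by rewrite subr_ge0.
  by split; rewrite !pairE; apply/andP; split; nra.
by move=> _ [i _ <-]; exact: Qb.
Qed.

Lemma triT_finite Q k : pos_areas tri Q -> in_box Q -> (mu (triT Q k) < +oo)%E.
Proof.
move=> pos Qb; apply: (@le_lt_trans _ _ (mu B)).
  apply: le_measure; rewrite ?inE //; first exact: measurable_triT.
  by move=> x; exact: triT_box.
by rewrite (box_measure aa bb).2 ltry.
Qed.

Lemma bary_le1 Q k m x : pos_areas tri Q -> triT Q k x -> `|bary (pt Q k) m x| <= 1.
Proof.
move=> pos xk; rewrite ger0_norm // -(bary_sum (area2_neq0 k pos) x) (bigD1 m) //= lerDl.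
by apply: sumr_ge0.
Qed.

Lemma bary_grad_neq0 Q k m : pos_areas tri Q -> bary_grad (pt Q k) m != 0.
Proof.
move=> pos; have a0 := area2_neq0 k pos; apply/eqP => g0.
have := bary_vertex a0 m m; have := bary_vertex a0 m (m + 1).
rewrite !bary_affine g0 !dot0l !add0r eqxx => ->.
by case: (ord3_shift_neq m) => /negbTE -> _ _ /eqP; rewrite eq_sym oner_eq0.
Qed.

Section Weight.
Variables (g : mplane -> R) (M : R).
Hypothesis mg : measurable_fun [set: mplane] g.
Hypothesis gM : forall x, `|g x| <= M.

Lemma weight_integrable Q k m : pos_areas tri Q -> in_box Q ->
  mu.-integrable (triT Q k) (EFin \o (fun x => g x * bary (pt Q k) m x)).
Proof.
move=> pos Qb; apply: measurable_bounded_integrable.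
- exact: measurable_triT.
- exact: triT_finite.
- apply: measurable_funTS; apply: measurable_funM => //; exact: measurable_bary.
- exists M; split; rewrite ?num_real // => z Mz x /= xk.
  rewrite normrM; apply: (le_trans _ (ltW Mz)).
  rewrite -[leRHS]mulr1; apply: ler_pM => //; exact: bary_le1.
Qed.

Definition moment Q k m : R := \int[mu]_(x in triT Q k) (g x * bary (pt Q k) m x).

(** Extended by zero, the integrands are bounded by [M] on the box and converge off the three edge
    lines of the limit triangle, where alone the indicator of the triangle may fail to converge. *)
Lemma moment_cvg (q : nat -> 'M[R]_(2, N)) Q k m :
  (forall n, pos_areas tri (q n)) -> (forall n, in_box (q n)) ->
  pos_areas tri Q -> in_box Q ->
  (forall i j, q n i j @[n --> \oo] --> Q i j) ->
  moment (q n) k m @[n --> \oo] --> moment Q k m.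
Proof.
move=> qpos qb pos Qb qQ.
pose h Q' : mplane -> \bar R := (EFin \o (fun x => g x * bary (pt Q' k) m x)) \_ (triT Q' k).
have hE Q' : pos_areas tri Q' -> in_box Q' -> moment Q' k m = fine (\int[mu]_(x in B) h Q' x)%E.
  move=> pos' b'Q; rewrite /moment /Rintegral /h -integral_mkcondr; congr (fine (integral _ _ _)).
  by apply/seteqP; split=> [x xk|x []//]; split=> //; exact: triT_box xk.
have mh Q' : measurable_fun B (h Q').
  apply: measurable_funTS; apply/(measurable_restrictT _ (measurable_triT _ _)).
  apply/measurable_EFinP; apply: measurable_funTS; apply: measurable_funM => //.
  exact: measurable_bary.
have hM Q' x : pos_areas tri Q' -> (`|h Q' x| <= M%:E)%E.
  move=> pos'; rewrite /h /patch; case: ifPn => [|_].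
    rewrite inE => xk /=; rewrite lee_fin normrM -[leRHS]mulr1.
    by apply: ler_pM => //; exact: bary_le1.
  by rewrite abse0 lee_fin (le_trans _ (gM x)).
have baryq m' (x : plane) : bary (pt (q n) k) m' x @[n --> \oo] --> bary (pt Q k) m' x.
  apply: cvgM.
    by apply: cross_cvg; apply: cvgB; try exact: cvg_cst; exact: qQ.
  by apply: cvgV; [exact: area2_neq0|exact: area2_cvg].
pose L m' : set mplane :=
  [set x | dot (bary_grad (pt Q k) m') x + bary_const (pt Q k) m' = 0].
have L0 m' := line_null (bary_const (pt Q k) m') (bary_grad_neq0 k m' pos).
have hcvg x : (forall m', bary (pt Q k) m' x != 0) -> h (q n) x @[n --> \oo] --> h Q x.
  move=> xn0; have [xk|xk] := pselect (triT Q k x).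
    have xpos m' : 0 < bary (pt Q k) m' x by rewrite lt_def xn0 xk.
    have near1 : \forall n \near \oo, triT (q n) k x.
      have H m' : \forall n \near \oo, 0 < bary (pt (q n) k) m' x.
        exact: (cvgr_gt _ (@baryq m' x) 0 (xpos m')).
      by apply: filterS (filter_forall _ H) => n Hn m'; exact: ltW.
    apply: (@cvg_trans _ ((fun n => (g x * bary (pt (q n) k) m x)%:E) @ \oo)).
      apply: near_eq_cvg; apply: filterS near1 => n nk.
      by rewrite /h /patch mem_set.
    rewrite /h /patch mem_set //=; apply: cvg_EFin; first exact: nearW.
    by apply: cvgM; [exact: cvg_cst|exact: baryq].
  have [m' xm'] : exists m', bary (pt Q k) m' x < 0.
    apply/existsP; apply: contrapT => /negP/existsPn h'; apply: xk => m'.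
    by rewrite leNgt h'.
  have near1 : \forall n \near \oo, ~ triT (q n) k x.
    have near0 : \forall n \near \oo, bary (pt (q n) k) m' x < 0.
      exact: (cvgr_lt _ (@baryq m' x) 0 xm').
    by apply: filterS near0 => n nm' /(_ m'); rewrite leNgt nm'.
  apply: (@cvg_trans _ ((fun n : nat => 0%E : \bar R) @ \oo)).
    apply: near_eq_cvg; apply: filterS near1 => n nk.
    by rewrite /h /patch memNset.
  by rewrite /h /patch memNset //; exact: cvg_cst.
have [] := @dominated_convergence _ mplane R mu B mB (fun n => h (q n)) (h Q) (cst M%:E).
- by move=> n; exact: mh.
- exact: mh.
- have mL12 : measurable (L 1 `|` L 2) := measurableU _ _ (L0 1).1 (L0 2).1.
  exists (L 0 `|` (L 1 `|` L 2)); split.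
  + exact: (measurableU _ _ (L0 0).1 mL12).
  + rewrite null_set_setU //; [exact: (L0 0).1|exact: (L0 0).2|].
    by rewrite null_set_setU //; [exact: (L0 1).1|exact: (L0 2).1|exact: (L0 1).2|exact: (L0 2).2].
  + move=> x /= nx; apply: contrapT => /not_orP[n0 /not_orP[n1 n2]]; apply: nx => _.
    apply: hcvg; apply: ord3P; rewrite bary_affine; apply/eqP => E;
      by [apply: n0|apply: n1|apply: n2].
- apply/integrableP; split; first exact: measurable_cst.
  rewrite integral_cst //= (box_measure aa bb).2; exact: ltry.
- by apply: aeW => x n _; apply: hM.
move=> hint _ hlim.
rewrite hE //; under eq_cvg do rewrite hE //.
by apply: fine_cvg; rewrite fineK //; exact: integrable_fin_num.
Qed.

Lemma Rintegral_affine_piece Q c k : pos_areas tri Q -> in_box Q ->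
  \int[mu]_(x in triT Q k) (g x * affine_piece tri Q c k x) =
  \sum_m c (tri k m) * moment Q k m.
Proof.
move=> pos Qb.
transitivity (\int[mu]_(x in triT Q k) \sum_m c (tri k m) * (g x * bary (pt Q k) m x)).
  apply: eq_Rintegral => x _; rewrite /affine_piece mulr_sumr; apply: eq_bigr => m _.
  by ring.
rewrite Rintegral_sum; last 2 first.
- exact: measurable_triT.
- move=> m; have := weight_integrable k m pos Qb.
  move=> /(integrableZl (measurable_triT Q k) (c (tri k m))); apply: eq_integrable.
    exact: measurable_triT.
  by move=> x _ /=; rewrite EFinM.
apply: eq_bigr => m _; rewrite RintegralZl //; first exact: measurable_triT.
exact: weight_integrable.
Qed.

End Weight.

Section Decomposition.
Variable Q : 'M[R]_(2, N).
Hypothesis pos : pos_areas tri Q.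
Hypothesis INT : meets_properly tri Q.

Let edge_lines : set mplane := \bigcup_(km in [set` index_enum ('I_NT * 'I_3)%type])
  [set x | dot (bary_grad (pt Q km.1) km.2) x + bary_const (pt Q km.1) km.2 = 0].

Let edge_lines_null : measurable edge_lines /\ mu edge_lines = 0%E.
Proof.
rewrite /edge_lines bigcup_seq.
apply: (@big_ind _ (fun A : set mplane => measurable A /\ mu A = 0%E)).
- by rewrite measure0.
- move=> A A' [mA A0] [mA' A'0]; split; first exact: measurableU.
  by rewrite null_set_setU.
- by move=> [k m] _ /=; apply: line_null; exact: bary_grad_neq0.
Qed.

(** Off the edge lines a point of [Omega] is interior to exactly one triangle. Prescribing [f] only
    there admits gradients, which have no meaningful value on edges. *)
Lemma Rintegral_Omega (f : mplane -> R) (fk : 'I_NT -> mplane -> R) :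
  (forall k x, (forall m, 0 < bary (pt Q k) m x) -> f x = fk k x) ->
  (forall k, mu.-integrable (triT Q k) (EFin \o fk k)) ->
  \int[mu]_(x in Omega tri Q) f x = \sum_k \int[mu]_(x in triT Q k) fk k x.
Proof.
move=> ffk fki; have [mE E0] := edge_lines_null.
rewrite Rintegral_mkcond (Rintegral_setD_null _ _ mE E0).
transitivity (\int[mu]_(x in [set: mplane] `\` edge_lines) \sum_k ((fk k) \_ (triT Q k)) x).
  apply: eq_Rintegral => x; rewrite inE => -[_ xE].
  have xn0 k m : bary (pt Q k) m x != 0.
    apply/eqP => xm; apply: xE; exists (k, m); first by rewrite /= mem_index_enum.
    by rewrite /= -bary_affine.
  rewrite /patch; case: ifPn => [|xO]; last first.
    rewrite big1 // => k _; rewrite memNset // => xk; move: xO; rewrite notin_setE; apply.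
    by apply/OmegaP => //; exists k.
  rewrite inE => /(OmegaP _ pos)[k xk].
  rewrite (bigD1 k) //= mem_set // big1 ?addr0; last first.
    move=> l lk; rewrite memNset // => xl.
    have kl : k != l by rewrite eq_sym.
    have [m ml] := nonshared_vertex en kl.
    by have := xn0 k m; rewrite (INT kl xk xl ml) eqxx.
  by apply: ffk => m; rewrite lt_def xn0 xk.
rewrite -(Rintegral_setD_null _ _ mE E0) Rintegral_sum //.
  by apply: eq_bigr => k _; rewrite [RHS]Rintegral_mkcond.
move=> k; rewrite (_ : _ \o _ = (EFin \o fk k) \_ (triT Q k)).
  by apply/(integrable_mkcond _ (measurable_triT Q k)).
by apply/funext => x; rewrite /patch /=; case: ifP.
Qed.

End Decomposition.

End Moments.

(** * Poincare inequality by vertical slices *)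

Section Poincare.
Context {R : realType} {N NT : nat}.
Context (Delta : {set {set 'I_N}}) (tri : 'I_NT -> 'I_3 -> 'I_N).
Notation plane := (R * R)%type.
Notation mplane := (measurableTypeR R * measurableTypeR R)%type.
Notation mu := (@lebesgue2 R).
Notation leb := (@lebesgue_measure R).
Implicit Types (Q : 'M[R]_(2, N)) (x y w : plane) (k l : 'I_NT) (c : 'I_N -> R).
Hypothesis cc : connectivity_complex Delta.
Hypothesis en : enumerates_2faces Delta tri.
Hypothesis co : consistently_oriented tri.

Local Notation pt := (@pt R N NT tri).
Local Notation triT := (@triT R N NT tri).

Variables (a a' b b' : R).

Lemma measure_bigsetU_le (I : finType) (A : I -> set (measurableTypeR R)) :
  (forall i, measurable (A i)) ->
  (leb (\big[setU/set0]_i A i) <= \sum_i leb (A i))%E.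
Proof.
move=> mA; suff [] : measurable (\big[setU/set0]_i A i : set (measurableTypeR R)) /\
  (leb (\big[setU/set0]_i A i) <= \sum_i leb (A i))%E by [].
elim/big_rec2 : _ => [|i y A' _ [mA' A'y]]; first by rewrite measure0.
split; first exact: measurableU.
by apply: (le_trans (measureU2 _ (mA i) mA')); exact: leeD2l.
Qed.

Section FixQ.
Variables (Q : 'M[R]_(2, N)) (c : 'I_N -> R).
Hypothesis pos : pos_areas tri Q.
Hypothesis INT : meets_properly tri Q.
Hypothesis Qb : in_box a a' b b' Q.
Hypothesis cB : forall i, i \in boundary_vertices tri -> c i = 0.

(** Zero values on the frontier make the extension by zero continuous on the whole plane, as the
    intermediate value theorem on vertical lines requires. *)
Lemma interp_continuous : continuous (interp tri Q c).
Proof.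
have [yc _ yF yO] := S10_interp cc en co pos INT cB.
move=> x; apply/cvgrPdist_lt => e e0.
have [xO|nx] := pselect (Omega tri Q x); last first.
  apply: filterS (not_Omega_near pos nx) => y ny.
  by rewrite !yO // subrr normr0.
have H : \forall y \near x, Omega tri Q y -> `|interp tri Q c x - interp tri Q c y| < e.
  have /cvgrPdist_lt/(_ e e0) := (subspace_continuousP _ _).1 yc x xO.
  by [].
have [xi|xni] := pselect (\forall y \near x, Omega tri Q y).
  by apply: filterS2 H xi => y; apply.
have x0 : interp tri Q c x = 0.
  by apply: yF; split => //; exact: subset_closure.
apply: filterS H => y Hy; have [/Hy //|ny] := pselect (Omega tri Q y).
by rewrite x0 yO // subrr normr0.
Qed.

Let slice k (s : R) : set R := [set t | triT Q k (s, t)].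

Let sliceE k s : xsection (triT Q k) s = slice k s.
Proof. by apply/seteqP; split=> t; rewrite /xsection /= inE. Qed.

Let mslice k s : measurable (slice k s : set (measurableTypeR R)).
Proof. by rewrite -sliceE; apply: measurable_xsection; exact: measurable_triT. Qed.

Let slice_box k s t : slice k s t -> b <= t <= b'.
Proof. by move=> /(triT_box pos Qb)[]. Qed.

Let slice_fin k s : leb (slice k s) \is a fin_num.
Proof.
rewrite ge0_fin_numE //; apply: (@le_lt_trans _ _ (leb `[b, b']%classic)).
  by apply: le_measure; rewrite ?inE // => t /slice_box; rewrite /= in_itv.
by rewrite lebesgue_measure_itv /=; case: ifP => _; rewrite ?ltry // -EFinB ltry.
Qed.

Let slice_conv k s t t' r : slice k s t -> slice k s t' -> t <= r -> r <= t' -> slice k s r.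
Proof.
move=> tk tk' tr rt' m; have := tk m; have := tk' m.
have E r' : bary (pt Q k) m (s, r') = (bary_grad (pt Q k) m).1 * s +
  (bary_grad (pt Q k) m).2 * r' + bary_const (pt Q k) m by rewrite bary_affine.
rewrite !E => h1 h2.
have [tt'|t't] := ltP t t'; last first.
  have -> : r = t by apply/eqP; rewrite eq_le tr (le_trans rt').
  exact: h2.
set A := bary_const _ _ in h1 h2 *; set u := (bary_grad _ _).1 in h1 h2 *.
set v := (bary_grad _ _).2 in h1 h2 *.
have : 0 <= (t' - r) * (u * s + v * t + A) + (r - t) * (u * s + v * t' + A).
  by rewrite addr_ge0 // mulr_ge0 // subr_ge0.
rewrite (_ : _ + _ = (t' - t) * (u * s + v * r + A)); last by ring.
by rewrite pmulr_rge0 // subr_gt0.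
Qed.

Let slice_dist k s t t' : slice k s t -> slice k s t' -> `|t - t'| <= fine (leb (slice k s)).
Proof.
wlog tt' : t t' / t <= t' => [H|] tk tk'.
  have [/H|/ltW/H] := leP t t'; first exact.
  by rewrite distrC; apply.
rewrite -lee_fin fineK // distrC ger0_norm ?subr_ge0 //.
have <- : leb `[t, t']%classic = (t' - t)%:E.
  rewrite lebesgue_measure_itv /= lte_fin; case: ltP => [//|t't].
  by rewrite (_ : t' = t) ?subrr //; apply/eqP; rewrite eq_le tt' t't.
apply: le_measure; rewrite ?inE // => r; rewrite /= in_itv /= => /andP[tr rt'].
exact: slice_conv tk tk' tr rt'.
Qed.

Definition slice_length k x : R := fine (leb (xsection (triT Q k) x.1)).

(* By the intermediate value theorem the values of the interpolant below [x]
   sweep [0, y x], so that interval is covered by the images of the slices. *)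
Lemma interp_le_slices x :
  `|interp tri Q c x| <= \sum_k `|(piece_grad tri Q c k).2| * slice_length k x.
Proof.
have [xO|nx] := pselect (Omega tri Q x); last first.
  rewrite interp_out; last by move=> k xk; apply: nx; apply/OmegaP => //; exists k.
  by rewrite normr0 sumr_ge0 // => k _; rewrite mulr_ge0 // fine_ge0.
case: x xO => s t0 xO; rewrite /slice_length /=.
pose f (t : R) := interp tri Q c (s, t).
have fc : continuous f.
  move=> t; have H : (s, t') @[t' --> t] --> (s, t).
    have c1 : (fun=> s) @ t --> s by exact: cvg_cst.
    have c2 : id @ t --> t by exact: cvg_id.
    exact: (@cvg_pair _ _ _ (nbhs t) (nbhs s) (nbhs t) _ _ _ _ _ c1 c2).
  exact: (cvg_comp _ _ H (@interp_continuous (s, t))).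
(* The vertical path starts one unit below the box, where the interpolant is zero. *)
have bt0 : b - 1 <= t0.
  have [k xk] := (OmegaP _ pos).1 xO; have /andP[h _] := slice_box xk.
  by apply: le_trans h; rewrite gerBl.
have f0 : f (b - 1) = 0.
  apply: interp_out => k /slice_box /andP[+ _].
  by rewrite lerBrDr gerDl ler10.
pose d k := `|(piece_grad tri Q c k).2| * fine (leb (slice k s)).
(* Values on slice [k] differ by at most slope times length, so this interval of length [d k]
   contains them all. *)
pose J k : set R := if `[< slice k s !=set0 >] then
  `[inf (f @` slice k s), inf (f @` slice k s) + d k]%classic else set0.
have d0 k : 0 <= d k by rewrite mulr_ge0 // fine_ge0.
have fJ k t : slice k s t -> J k (f t).
  move=> tk; rewrite /J asboolT; last by exists t.
  have lip t' : slice k s t' -> `|f t - f t'| <= d k.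
    move=> tk'; rewrite /f !(interpE en pos INT _ tk) !(interpE en pos INT _ tk').
    rewrite !affine_pieceE /dot /= (_ : _ - _ = (piece_grad tri Q c k).2 * (t - t')); last by ring.
    by rewrite normrM ler_wpM2l // slice_dist.
  have lb : lbound (f @` slice k s) (f t - d k).
    by move=> _ [t' tk' <-]; rewrite lerBlDr -lerBlDl; apply: le_trans (lip _ tk'); exact: ler_norm.
  rewrite /= in_itv /=; apply/andP; split.
    by apply: ge_inf; [exists (f t - d k)|exists t].
  by rewrite -lerBlDr; apply: lb_le_inf => //; exists (f t), t.
(* The singleton accounts for the parts of the vertical line outside [Omega]. *)
have cover : `[Num.min 0 (f t0), Num.max 0 (f t0)]%classic `<=`
    [set 0] `|` \big[setU/set0]_k J k.
  move=> v; rewrite /= in_itv /= => v01.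
  have [|t _ <-] := IVT bt0 (continuous_subspaceT fc) (v := v); first by rewrite f0.
  have [/(OmegaP _ pos)[k tk]|nt] := pselect (Omega tri Q (s, t)).
    by right; rewrite (bigD1 k) //=; left; apply: fJ.
  left; apply: interp_out => k tk; apply: nt; apply/OmegaP => //; by exists k.
have mJ k : measurable (J k : set (measurableTypeR R)).
  by rewrite /J; case: ifP.
have lebJ k : (leb (J k) <= (d k)%:E)%E.
  rewrite /J; case: ifP => _; last by rewrite measure0 lee_fin.
  rewrite lebesgue_measure_itv /= lte_fin; case: ifP => _; last by rewrite lee_fin.
  by rewrite -EFinB addrAC subrr add0r.
have mU : measurable (\big[setU/set0]_k J k : set (measurableTypeR R)).
  by apply: bigsetU_measurable => k _.
have : (leb `[Num.min 0%R (f t0), Num.max 0%R (f t0)]%classic <= \sum_k (d k)%:E)%E.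
  apply: (@le_trans _ _ (leb ([set 0%R] `|` \big[setU/set0]_k J k))).
    by apply: le_measure; rewrite ?inE //; exact: measurableU.
  have U2 : (leb ([set 0%R] `|` \big[setU/set0]_k J k) <=
      leb [set 0%R] + leb (\big[setU/set0]_k J k))%E.
    by apply: measureU2 => //; exact: measurable_set1.
  apply: (le_trans U2); rewrite lebesgue_measure_set1 add0e.
  by apply: (le_trans (measure_bigsetU_le mJ)); apply: lee_sum => k _.
rewrite sumEFin (_ : leb _ = (`|f t0|)%:E) ?lee_fin; last first.
  rewrite lebesgue_measure_itv /= lte_fin.
  have [ft|ft|ft] := ltgtP 0 (f t0).
  - by rewrite ft -EFinB subr0 ger0_norm // ltW.
  - by rewrite ft -EFinB sub0r ltr0_norm.
  - by rewrite -ft ltxx normr0.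
by move=> h; apply: le_trans h _; apply: ler_sum => k _; rewrite sliceE.
Qed.

End FixQ.
End Poincare.

(** * Integrals of finite element functions *)

Section Discrete.
Context {R : realType} {N NT : nat}.
Context (Delta : {set {set 'I_N}}) (tri : 'I_NT -> 'I_3 -> 'I_N).
Notation plane := (R * R)%type.
Notation mplane := (measurableTypeR R * measurableTypeR R)%type.
Notation mu := (@lebesgue2 R).
Notation leb := (@lebesgue_measure R).
Implicit Types (Q : 'M[R]_(2, N)) (x y w : plane) (k l : 'I_NT) (c d : 'I_N -> R).
Hypothesis cc : connectivity_complex Delta.
Hypothesis en : enumerates_2faces Delta tri.
Hypothesis co : consistently_oriented tri.

Local Notation pt := (@pt R N NT tri).
Local Notation triT := (@triT R N NT tri).

Variables (a a' b b' : R).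
Hypotheses (aa : a <= a') (bb : b <= b').
Let B : set mplane := rectangle a a' b b'.

Definition vol Q k : R := fine (mu (triT Q k)).

Section FixQ.
Variable Q : 'M[R]_(2, N).
Hypothesis pos : pos_areas tri Q.
Hypothesis Qb : in_box a a' b b' Q.

Let vol_fin k : mu (triT Q k) \is a fin_num.
Proof. by rewrite ge0_fin_numE //; exact: triT_finite Qb. Qed.

(** A square around the centroid fits into the triangle. *)
Lemma vol_gt0 k : 0 < vol Q k.
Proof.
have a0 := area2_neq0 k pos.
pose z : plane := \sum_m 3%:R^-1 *: pt Q k m.
have zb m : 0 < bary (pt Q k) m z.
  by rewrite bary_lincomb_vertex ?invr_gt0 // sum3E; field.
have /nbhs_ballP[e /= e0 eT] := triT_interior_near zb.
pose h := e / 2.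
have h0 : 0 < h by rewrite divr_gt0.
have he : h < e by rewrite /h; lra.
have sub : rectangle (z.1 - h) (z.1 + h) (z.2 - h) (z.2 + h) `<=` triT Q k.
  move=> x [x1 x2] m; apply: ltW; apply: eT; split; rewrite /ball /= distrC ltr_distl.
    by apply/andP; split; lra.
  by apply/andP; split; lra.
have zz1 : z.1 - h <= z.1 + h by lra.
have zz2 : z.2 - h <= z.2 + h by lra.
have [mb bE] := box_measure zz1 zz2.
rewrite /vol -lte_fin fineK //; apply: (@lt_le_trans _ _ (mu (rectangle (z.1 - h) (z.1 + h) (z.2 - h) (z.2 + h)))).
  by rewrite bE lte_fin mulr_gt0 //; lra.
by apply: le_measure; rewrite ?inE //; exact: measurable_triT.
Qed.

Lemma vol_le k : vol Q k <= (a' - a) * (b' - b).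
Proof.
rewrite -lee_fin fineK // -(box_measure aa bb).2.
apply: le_measure; rewrite ?inE //; [exact: measurable_triT|exact: (box_measure aa bb).1|].
by move=> x; exact: triT_box.
Qed.

(** The coordinates sum to one; in this form continuity of the volume follows from [moment_cvg]. *)
Lemma vol_moment k : vol Q k = \sum_m moment tri (fun=> 1) Q k m.
Proof.
have m1 : measurable_fun [set: mplane] (fun=> 1 : R) by exact: measurable_cst.
have b1 : forall x : mplane, `|(fun=> 1 : R) x| <= 1 by move=> x; rewrite normr1.
transitivity (\sum_m 1 * moment tri (fun=> 1) Q k m); last first.
  by apply: eq_bigr => m _; rewrite mul1r.
rewrite -(Rintegral_affine_piece aa bb m1 b1 (fun=> 1) k pos Qb).
rewrite -[LHS]mul1r -Rintegral_cst //; last exact: measurable_triT.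
apply: eq_Rintegral => x _; rewrite mul1r /affine_piece.
by under eq_bigr do rewrite mulr1; rewrite bary_sum // area2_neq0.
Qed.

Let slice_ge0 l x : 0 <= slice_length tri Q l x.
Proof. exact: fine_ge0. Qed.

Let slice_fin l (s : R) : leb (xsection (triT Q l) s) \is a fin_num.
Proof.
rewrite ge0_fin_numE //; apply: (@le_lt_trans _ _ (leb `[b, b']%classic)).
  apply: le_measure; rewrite ?inE //; first by apply: measurable_xsection; exact: measurable_triT.
  move=> t; rewrite /xsection /= inE => /(triT_box pos Qb)[_].
  by rewrite in_itv.
by rewrite lebesgue_measure_itv /=; case: ifP => _; rewrite ?ltry // -EFinB ltry.
Qed.

Lemma slice_length_le l x : slice_length tri Q l x <= b' - b.
Proof.
rewrite -lee_fin fineK //; apply: (@le_trans _ _ (leb `[b, b']%classic)).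
  apply: le_measure; rewrite ?inE //; first by apply: measurable_xsection; exact: measurable_triT.
  move=> t; rewrite /xsection /= inE => /(triT_box pos Qb)[_].
  by rewrite in_itv.
by rewrite lebesgue_measure_itv /=; case: ifP => _; rewrite ?lee_fin ?subr_ge0 // -EFinB.
Qed.

Let slice_meas l : measurable_fun [set: mplane] (fun x : mplane => leb (xsection (triT Q l) x.1)).
Proof.
have := @measurable_fun_xsection _ _ _ _ R leb _ (measurable_triT tri Q l).
by move=> h; exact: (measurableT_comp h (@measurable_fst _ _ _ _)).
Qed.

Let slice_integrable k l : mu.-integrable (triT Q k) (EFin \o slice_length tri Q l).
Proof.
apply: measurable_bounded_integrable; [exact: measurable_triT|exact: triT_finite Qb| |].
  apply: measurable_funTS; apply/measurable_EFinP.
  rewrite (_ : _ \o _ = fun x => leb (xsection (triT Q l) x.1)); first exact: slice_meas.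
  by apply/funext => x /=; rewrite /slice_length fineK.
exists (b' - b); split; rewrite ?num_real // => z Mz x /= xk.
rewrite ger0_norm //; apply: (le_trans _ (ltW Mz)); exact: slice_length_le.
Qed.

(** Slice lengths depend on the first coordinate only. Enlarging triangle [k] to a horizontal strip
    of height [b' - b], Tonelli turns their integral into the measure of triangle [l]. *)
Lemma integral_slice_length k l :
  \int[mu]_(x in triT Q k) slice_length tri Q l x <= (b' - b) * vol Q l.
Proof.
rewrite -lee_fin EFinM /vol (fineK (vol_fin l)) /Rintegral fineK; last first.
  by apply: (integrable_fin_num _ (slice_integrable k l)); exact: measurable_triT.
pose F (x : mplane) := (leb (xsection (triT Q l) x.1) * (\1_(`[b, b']%classic : set R) x.2)%:E)%E.
have mF : measurable_fun [set: mplane] F.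
  apply: emeasurable_funM; first exact: slice_meas.
  apply/measurable_EFinP.
  by apply: (measurableT_comp _ (@measurable_snd _ _ _ _)); exact: measurable_indic.
have F0 x : (0 <= F x)%E by rewrite mule_ge0 // lee_fin.
have FE : (\int[mu]_x F x = (b' - b)%:E * mu (triT Q l))%E.
  have itvE : (\int[leb]_t (\1_(`[b, b']%classic : set R) t)%:E = (b' - b)%:E)%E.
    rewrite integral_indic // setIT; apply: etrans (lebesgue_measure_itv _) _ => /=.
    rewrite lte_fin; case: ltP => [_|h]; first by rewrite EFinB.
    by rewrite (_ : b' = b) ?subrr //; apply/eqP; rewrite eq_le h bb.
  have inner s : (\int[leb]_t F (s, t) = leb (xsection (triT Q l) s) * (b' - b)%:E)%E.
    rewrite -itvE -ge0_integralZl //.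
    by apply/measurable_EFinP; exact: measurable_indic.
  transitivity (\int[leb]_s \int[leb]_t F (s, t))%E; first exact: fubini_tonelli1.
  under eq_integral do rewrite inner.
  rewrite ge0_integralZr //.
  - by rewrite muleC.
  - exact: measurable_fun_xsection (measurable_triT tri Q l).
  - by rewrite lee_fin subr_ge0.
apply: (@le_trans _ _ (\int[mu]_x F x)%E); last by rewrite FE.
rewrite integral_mkcond; apply: ge0_le_integral => //.
- by move=> x _; rewrite /patch; case: ifP => // _; rewrite lee_fin.
- apply/(measurable_restrictT _ (measurable_triT _ _ _)).
  exact: measurable_int (slice_integrable k l).
move=> x _; rewrite /patch; case: ifP => [|_]; last exact: F0.
rewrite inE => xk; rewrite /F /slice_length /= fineK // indicE mem_set ?mule1 //.
by rewrite /= in_itv; have [_] := triT_box pos Qb xk.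
Qed.

Hypothesis INT : meets_properly tri Q.

Lemma affine_piece_integrable (g : mplane -> R) (M : R) c k :
  measurable_fun [set: mplane] g -> (forall x, `|g x| <= M) ->
  mu.-integrable (triT Q k) (EFin \o (fun x => g x * affine_piece tri Q c k x)).
Proof.
move=> mg gM; apply: measurable_bounded_integrable.
- exact: measurable_triT.
- exact: triT_finite Qb.
- apply: measurable_funTS; apply: measurable_funM => //.
  rewrite (_ : affine_piece _ _ _ _ =
    fun x => dot (piece_grad tri Q c k) x + piece_const tri Q c k).
    exact: measurable_affine.
  by apply/funext => x; rewrite affine_pieceE.
- exists (M * \sum_m `|c (tri k m)|); split; rewrite ?num_real // => z Mz x /= xk.
  rewrite normrM; apply: (le_trans _ (ltW Mz)); apply: ler_pM => //.
  apply: le_trans (ler_norm_sum _ _ _) _; apply: ler_sum => m _.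
  by rewrite normrM ler_piMl // bary_le1.
Qed.

Lemma Rintegral_Omega_pieces (g : mplane -> R) (M : R) c :
  measurable_fun [set: mplane] g -> (forall x, `|g x| <= M) ->
  \int[mu]_(x in Omega tri Q) (g x * interp tri Q c x) =
  \sum_k \int[mu]_(x in triT Q k) (g x * affine_piece tri Q c k x).
Proof.
move=> mg gM; apply: (Rintegral_Omega en pos INT
  (fk := fun k x => g x * affine_piece tri Q c k x)).
- move=> k x xk; have xT : triT Q k x by move=> m; exact: ltW.
  by rewrite (interpE en pos INT c xT).
- by move=> k; exact: affine_piece_integrable.
Qed.

Lemma Rintegral_Omega_interp (g : mplane -> R) (M : R) c :
  measurable_fun [set: mplane] g -> (forall x, `|g x| <= M) ->
  \int[mu]_(x in Omega tri Q) (g x * interp tri Q c x) =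
  \sum_k \sum_m c (tri k m) * moment tri g Q k m.
Proof.
move=> mg gM; rewrite (Rintegral_Omega_pieces _ mg gM); apply: eq_bigr => k _.
exact: (Rintegral_affine_piece aa bb mg gM).
Qed.

(** The pointwise slice bound is integrated over each of the [NT] triangles. The result is a
    weighted 1-norm of the vertical slopes, with a constant independent of the shapes. *)
Lemma load_bound (g : mplane -> R) (M : R) c :
  measurable_fun [set: mplane] g -> (forall x, `|g x| <= M) ->
  (forall i, i \in boundary_vertices tri -> c i = 0) ->
  `|\int[mu]_(x in Omega tri Q) (g x * interp tri Q c x)| <=
  NT%:R * (M * (b' - b)) * \sum_k `|(piece_grad tri Q c k).2| * vol Q k.
Proof.
move=> mg gM cB; rewrite (Rintegral_Omega_pieces _ mg gM).
have M0 : 0 <= M by apply: le_trans (gM 0); exact: normr_ge0.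
pose G k := `|(piece_grad tri Q c k).2|.
pose Phi x := \sum_l M * G l * slice_length tri Q l x.
have iPhi k l : mu.-integrable (triT Q k) (EFin \o (fun x => M * G l * slice_length tri Q l x)).
  have := slice_integrable k l.
  move=> /(integrableZl (measurable_triT tri Q k) (M * G l)); apply: eq_integrable.
    exact: measurable_triT.
  by move=> x _ /=; rewrite EFinM.
have piece k : `|\int[mu]_(x in triT Q k) (g x * affine_piece tri Q c k x)| <=
    M * (b' - b) * \sum_l G l * vol Q l.
  have igk := affine_piece_integrable c k mg gM.
  apply: le_trans (le_normr_Rintegral (measurable_triT tri Q k) igk) _.
  apply: (@le_trans _ _ (\int[mu]_(x in triT Q k) Phi x)).
    apply: le_Rintegral; first exact: measurable_triT.
    - exact: (integrable_norm igk).
    - rewrite (_ : _ \o _ = fun x => (\sum_l (M * G l * slice_length tri Q l x)%:E)%E).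
        apply: integrable_sum => [|l _]; [exact: measurable_triT|exact: iPhi].
      by apply/funext => x; rewrite /= sumEFin.
    - move=> x xk; rewrite normrM -(interpE en pos INT c xk) /Phi.
      under eq_bigr do rewrite -mulrA; rewrite -mulr_sumr.
      by apply: ler_pM => //; exact: (interp_le_slices cc en co pos INT Qb cB).
  rewrite Rintegral_sum //; last exact: measurable_triT.
  rewrite mulr_sumr; apply: ler_sum => l _.
  rewrite RintegralZl //; last exact: measurable_triT.
  rewrite -!mulrA ler_wpM2l // [leRHS]mulrCA ler_wpM2l // /G //.
  exact: integral_slice_length.
apply: le_trans (ler_norm_sum _ _ _) _.
apply: le_trans (ler_sum _ (fun k _ => piece k)) _.
by rewrite sumr_const card_ord -[leLHS]mulr_natl -[leRHS]mulrA; exact: lexx.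
Qed.

Lemma Rintegral_grad c d :
  \int[mu]_(x in Omega tri Q) dot (grad (interp tri Q c) x) (grad (interp tri Q d) x) =
  \sum_k vol Q k * dot (piece_grad tri Q c k) (piece_grad tri Q d k).
Proof.
rewrite (Rintegral_Omega en pos INT
  (fk := fun k _ => dot (piece_grad tri Q c k) (piece_grad tri Q d k))).
- apply: eq_bigr => k _; rewrite Rintegral_cst; first by rewrite mulrC.
  exact: measurable_triT.
- by move=> k x xk; rewrite !(grad_interp en pos INT _ xk).
- move=> k; apply: measurable_bounded_integrable.
  + exact: measurable_triT.
  + exact: triT_finite Qb.
  + exact: measurable_cst.
  + exists `|dot (piece_grad tri Q c k) (piece_grad tri Q d k)|; split; first exact: num_real.
    by move=> z /ltW zM x _.
Qed.

End FixQ.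

(** The representative is set to zero on the exceptional null set of the essential bound, which
    makes it bounded everywhere. *)
Lemma Linfty_weight (r : plane -> R) : in_Linfty r (rectangle a a' b b') ->
  exists (g : mplane -> R) (M : R), [/\ measurable_fun [set: mplane] g,
    (forall x, `|g x| <= M) &
    forall Q (v : plane -> R), pos_areas tri Q -> in_box a a' b b' Q ->
      \int[mu]_(x in Omega tri Q) (r x * v x) = \int[mu]_(x in Omega tri Q) (g x * v x)].
Proof.
pose f : mplane -> R := r \_ B.
move=> /andP[mf nf].
have {}mf : measurable_fun [set: mplane] f by rewrite inE in mf.
have {}nf : ('N[mu]_+oo[EFin \o f] < +oo)%E by rewrite inE in nf.
(* The supremum norm is defined by cases on whether the whole space has positive measure. *)
have mu0 : (0 < mu [set: mplane])%E.
  have [mb bE] := @box_measure R 0 1 0 1 ler01 ler01.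
  apply: (@lt_le_trans _ _ (mu (rectangle 0 1 0 1))); first by rewrite bE lte_fin subr0 mulr1.
  by apply: le_measure; rewrite ?inE.
have [M [N0 [mN0 N00 NM]]] : exists M : R, {ae mu, forall x, `|f x| <= M}.
  move: nf; rewrite unlock mu0 => nf.
  have := @ess_sup_ge _ _ _ mu (abse \o (EFin \o f)).
  case E : (ess_sup mu (abse \o (EFin \o f))) nf => [M| |] // _ h.
    by exists M; apply: filterS h => x /=; rewrite lee_fin.
  by exists 0; apply: filterS h => x /=.
pose g : mplane -> R := f \_ (~` N0).
exists g, (Num.max M 0); split.
- apply/(measurable_restrictT _ (measurableC mN0)).
  exact: measurable_funTS.
- move=> x; rewrite /g /patch; case: ifPn; last by rewrite normr0 le_max lexx orbT.
  rewrite inE => xN; rewrite le_max; apply/orP; left; apply: contrapT => h.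
  by apply: xN; apply: NM.
- move=> Q v pos Qb.
  rewrite (Rintegral_setD_null _ _ mN0 N00) [RHS](Rintegral_setD_null _ _ mN0 N00).
  apply: eq_Rintegral => x; rewrite inE => -[/(OmegaP _ pos)[k xk] xN].
  rewrite /g /patch mem_set // /f /patch mem_set //; exact: triT_box xk.
Qed.

End Discrete.

(** * The identity and the cut-off *)

Section Cutoff.
Context {R : realType}.

(* Both the identity and the cut-off are, on [0, +oo[, restrictions of a
   continuous function and eventually the identity. *)
Definition penalizer (h : R -> R) :=
  (exists2 g : R -> R, continuous g & forall s, 0 <= s -> g s = h s) /\
  (exists s1, forall s, s1 <= s -> h s = s).

Lemma penalizer_id : penalizer id.
Proof. by split; [exists id => // s; exact: cvg_id|exists 0]. Qed.

Lemma penalizer_cutoff chi : cutoff chi -> penalizer chi.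
Proof.
move=> [[g [gc _] gE] [s0 [s1 [_ _ _ chi1]]]]; split; last by exists s1.
by exists g => // x; exact: gc.
Qed.

(** A cut-off may become negative before it turns into the identity; on that compact range
    continuity bounds it below. *)
Lemma penalizer_lower h : penalizer h -> exists m, 0 <= m /\ forall s, 0 <= s -> - m <= h s.
Proof.
move=> [[g gc gE] [s1 h1]]; pose s2 := Num.max s1 0.
have s20 : 0 <= s2 by rewrite le_max lexx orbT.
have [c _ cmin] := EVT_min s20 (continuous_subspaceT gc).
exists `|g c|; split=> // s s0; have [ss|ss] := leP s s2.
  rewrite -gE //; apply: (@le_trans _ _ (g c)); first by rewrite lerNl ler_normr lexx orbT.
  by apply: cmin; rewrite in_itv /= s0.
rewrite h1; last by rewrite (le_trans _ (ltW ss)) // le_max lexx.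
by rewrite (le_trans _ s0) // oppr_le0.
Qed.

Lemma penalizer_inv h (H : R) : penalizer h -> exists2 d, 0 < d &
  forall s, 0 < s -> h s^-1 <= H -> d <= s.
Proof.
(* Beyond [Z] the function [h] is the identity and exceeds [H]; the 1 keeps [Z] positive. *)
move=> [_ [s1 h1]]; pose Z := Num.max 1 (Num.max s1 H).
have Z0 : 0 < Z by rewrite lt_max ltr01.
exists Z^-1; first by rewrite invr_gt0.
move=> s s0 hs; rewrite -[leRHS]invrK lef_pV2 ?posrE ?invr_gt0 //.
rewrite /Z; have [ss|/ltW ss] := leP s1 s^-1; last by rewrite !le_max ss orbT.
by move: hs; rewrite h1 // !le_max => ->; rewrite !orbT.
Qed.

End Cutoff.

(** * Bounds and continuity of the penalty *)

Section Penalty.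
Context {R : realType} {N NT : nat}.
Context (Delta : {set {set 'I_N}}) (tri : 'I_NT -> 'I_3 -> 'I_N).
Notation plane := (R * R)%type.
Implicit Types (Q : 'M[R]_(2, N)) (x y w : plane) (k l : 'I_NT).
Hypothesis cc : connectivity_complex Delta.
Hypothesis en : enumerates_2faces Delta tri.
Variable nrm : plane -> R.
Hypothesis reg : regularized_norm1 Delta tri nrm.
Variables (alpha1 alpha2 alpha3 alpha4 : R) (Qref : 'M[R]_(2, N)) (h : R -> R).
Hypotheses (al1 : 0 < alpha1) (al2 : 0 < alpha2) (al3 : 0 < alpha3) (al4 : 0 < alpha4).
Hypothesis ph : penalizer h.

Let phi := penalty_with tri alpha1 alpha2 alpha3 alpha4 nrm Qref h.
Let EB := boundary_edges tri.
Let VB := boundary_vertices tri.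
Let wgt : R := (#|EB|%:R * #|VB|%:R)^-1.
Let shape Q := \sum_(k < NT) NT%:R^-1 * (alpha1 * inv_psi tri Q k).
Let inv_area Q := alpha2 / (\sum_(k < NT) tri_area tri Q k).
Let dist Q := \sum_(e in EB) \sum_(i in VB | (i != e.1) && (i != e.2))
  wgt * (alpha3 * h (edge_dist nrm Q i e.1 e.2)^-1).

Lemma inv_psi_ge0 Q k : pos_areas tri Q -> 0 <= inv_psi tri Q k.
Proof.
move=> pos; apply: divr_ge0; first exact: sum_sqr_edges_ge0.
apply: mulr_ge0; last exact: ltW (pos k).
by apply: mulr_ge0; rewrite ?ler0n // sqrtr_ge0.
Qed.

Let dist_gt0 Q e i : Mplus Delta tri Q -> e \in EB -> i != e.1 -> i != e.2 ->
  0 < edge_dist nrm Q i e.1 e.2.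
Proof. by case: reg => r1 r2 r3 _; exact: (Mplus_edge_dist_gt0 cc en r1 r2 r3). Qed.

Let wgt_ge0 : 0 <= wgt.
Proof. by rewrite /wgt invr_ge0 mulr_ge0 ?ler0n. Qed.

(** Shifted by the lower bound of [h], all summands are nonnegative, so each one is dominated by the
    shifted sum. [L] is the total shift. *)
Let dist_lower : exists L, forall Q, Mplus Delta tri Q -> - L <= dist Q /\
  forall e i, e \in EB -> i \in VB -> i != e.1 -> i != e.2 ->
    wgt * (alpha3 * h (edge_dist nrm Q i e.1 e.2)^-1) <= dist Q + L.
Proof.
have [m [m0 mh]] := penalizer_lower ph.
pose L := \sum_(e in EB) \sum_(i in VB | (i != e.1) && (i != e.2)) wgt * (alpha3 * m).
have am0 : 0 <= wgt * (alpha3 * m) by rewrite !mulr_ge0 // ltW.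
exists L => Q MQ.
pose F e i := wgt * (alpha3 * h (edge_dist nrm Q i e.1 e.2)^-1) + wgt * (alpha3 * m).
have F0 e i : e \in EB -> (i != e.1) && (i != e.2) -> 0 <= F e i.
  move=> eB /andP[i1 i2]; rewrite /F -!mulrDr !mulr_ge0 //; first exact: ltW.
  by rewrite -lerBlDr sub0r mh // invr_ge0 ltW // dist_gt0.
have FE : dist Q + L = \sum_(e in EB) \sum_(i in VB | (i != e.1) && (i != e.2)) F e i.
  rewrite /dist /L -big_split; apply: eq_bigr => e _.
  by rewrite -big_split.
have S0 e : e \in EB -> 0 <= \sum_(i in VB | (i != e.1) && (i != e.2)) F e i.
  by move=> eB; apply: sumr_ge0 => i /andP[_]; exact: F0.
split; first by rewrite lerNl -subr_ge0 opprK addrC FE; apply: sumr_ge0 => e; exact: S0.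
move=> e i eB iB i1 i2; apply: (@le_trans _ _ (F e i)); first by rewrite lerDl.
rewrite FE (bigD1 e) //= (bigD1 i) /=; last by rewrite iB i1 i2.
rewrite -addrA lerDl addr_ge0 //; last first.
  by apply: sumr_ge0 => e' /andP[]; move=> /S0.
by apply: sumr_ge0 => j /andP[/andP[_]]; move=> /(F0 _ _ eB).
Qed.

Let penaltyE Q : phi Q = shape Q + inv_area Q + dist Q + alpha4 / 2 * frobenius (Q - Qref) ^+ 2.
Proof. by []. Qed.

Let shape_term_ge0 Q k : pos_areas tri Q -> 0 <= NT%:R^-1 * (alpha1 * inv_psi tri Q k).
Proof.
move=> pos; apply: mulr_ge0; first by rewrite invr_ge0 ler0n.
by apply: mulr_ge0; [exact: ltW|exact: inv_psi_ge0].
Qed.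

Let shape_ge0 Q : pos_areas tri Q -> 0 <= shape Q.
Proof. by move=> pos; apply: sumr_ge0 => k _; exact: shape_term_ge0. Qed.

Let inv_area_ge0 Q : pos_areas tri Q -> 0 <= inv_area Q.
Proof. by move=> pos; rewrite divr_ge0 ?sumr_ge0 // => [|k _]; exact: ltW. Qed.

Let frob_ge0 Q : 0 <= alpha4 / 2 * frobenius (Q - Qref) ^+ 2.
Proof. by rewrite mulr_ge0 ?sqr_ge0 // divr_ge0 // ltW. Qed.

Lemma penalty_lower : exists L, forall Q, Mplus Delta tri Q -> L <= phi Q.
Proof.
have [L LP] := dist_lower; exists (- L) => Q MQ; have [dL _] := LP _ MQ.
have [pos _] := (Mplus_proper cc en _).1 MQ.
rewrite penaltyE; have := shape_ge0 pos; have := inv_area_ge0 pos; have := frob_ge0 Q.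
by lra.
Qed.

Lemma penalty_coercive (K : R) : exists C d d' : R, [/\ 0 < d, 0 < d' &
  forall Q, Mplus Delta tri Q -> phi Q <= K ->
  [/\ forall k, inv_psi tri Q k <= C, d <= \sum_k tri_area tri Q k &
      forall e i, e \in EB -> i \in VB -> i != e.1 -> i != e.2 ->
        d' <= edge_dist nrm Q i e.1 e.2]].
Proof.
have [L LP] := dist_lower.
have [d' d'0 d'P] := penalizer_inv ((K + L) / alpha3 / wgt) ph.
pose K' := Num.max 1 (K + L).
have K'0 : 0 < K' by rewrite lt_max ltr01.
have KK' : K + L <= K' by rewrite le_max lexx orbT.
(* Every term of the penalty is at most [K + L], since the distance term is at least [- L] and the
   others are nonnegative. The constants solve this bound for each quantity; [K'] guards against a
   nonpositive [K + L]. *)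
exists ((K + L) / alpha1 * NT%:R), (alpha2 / K'), d'; split; rewrite ?divr_gt0 //.
move=> Q MQ QK; have [dL dT] := LP _ MQ.
have [pos _] := (Mplus_proper cc en _).1 MQ.
have s1 := shape_ge0 pos; have s2 := inv_area_ge0 pos; have s3 := frob_ge0 Q.
move: QK; rewrite penaltyE => QK.
have [k0 _] : exists k : 'I_NT, true.
  have [[/finset.set0Pn[F FD] _ _ _] _ _] := cc.
  by have [k _] := Delta_sub_face cc en FD; exists k.
have NT0 : 0 < NT%:R :> R by rewrite ltr0n; case: (NT) k0 => [[]|].
split.
- move=> k; have : NT%:R^-1 * (alpha1 * inv_psi tri Q k) <= K + L.
    apply: (@le_trans _ _ (shape Q)); last by lra.
    rewrite /shape (bigD1 k) //= lerDl; apply: sumr_ge0 => l _; exact: shape_term_ge0.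
  by rewrite ler_pdivrMl // mulrC -ler_pdivlMr // (_ : _ * _ * _ = (K + L) / alpha1 * NT%:R) //; ring.
- have A0 : 0 < \sum_k tri_area tri Q k.
    by rewrite (bigD1 k0) //= ltr_wpDr // sumr_ge0 // => k _; exact: ltW.
  rewrite ler_pdivrMr // mulrC -ler_pdivrMr //; apply: le_trans KK'.
  by rewrite -/(inv_area Q); lra.
- move=> e i eB iB i1 i2; apply: d'P; first exact: dist_gt0.
  have w0 : 0 < wgt.
    rewrite /wgt invr_gt0 mulr_gt0 // ltr0n; apply/card_gt0P; [by exists e|by exists i].
  rewrite ler_pdivlMr // ler_pdivlMr // -mulrA mulrC -mulrA.
  by apply: le_trans (dT e i eB iB i1 i2) _; lra.
Qed.

Lemma penalty_cvg (T : Type) (F : set_system T) (FF : ProperFilter F)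
    (q : T -> 'M[R]_(2, N)) Q :
  (forall i j, q t i j @[t --> F] --> Q i j) -> Mplus Delta tri Q ->
  (forall t, Mplus Delta tri (q t)) -> phi (q t) @[t --> F] --> phi Q.
Proof.
move=> qQ MQ qM; have [pos _] := (Mplus_proper cc en _).1 MQ.
have [[g gc gE] _] := ph; case: (reg) => _ _ _ rC.
under eq_cvg do rewrite penaltyE; rewrite penaltyE.
apply: cvgD; first apply: cvgD; first apply: cvgD.
- apply: cvg_sumr => k; apply: cvgM; first exact: cvg_cst.
  by apply: cvgM; [exact: cvg_cst|exact: (inv_psi_cvg FF qQ (pos k))].
- have [k0 _] : exists k : 'I_NT, true.
    have [[/finset.set0Pn[G GD] _ _ _] _ _] := cc.
    by have [k _] := Delta_sub_face cc en GD; exists k.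
  have A0 : 0 < \sum_k tri_area tri Q k.
    by rewrite (bigD1 k0) //= ltr_wpDr // sumr_ge0 // => k _; exact: ltW.
  apply: cvgM; first exact: cvg_cst.
  apply: cvgV; first by rewrite gt_eqF.
  by apply: cvg_sumr => k; exact: tri_area_cvg.
- have cvg_cond (I : finType) (P : pred I) (f : I -> T -> R) (l : I -> R) :
      (forall i, P i -> f i t @[t --> F] --> l i) ->
      \sum_(i | P i) f i t @[t --> F] --> \sum_(i | P i) l i.
    move=> fl; rewrite big_mkcond; under eq_cvg do rewrite big_mkcond.
    by apply: cvg_sumr => i; case: ifP => [/fl //|_]; exact: cvg_cst.
  apply: (@cvg_cond) => e eB; apply: (@cvg_cond) => i /andP[iB /andP[i1 i2]].
  apply: cvgM; first exact: cvg_cst.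
  apply: cvgM; first exact: cvg_cst.
  have d0 := dist_gt0 MQ eB i1 i2.
  rewrite -gE ?invr_ge0 ?(ltW d0) //.
  (* Continuity of [h] is known only through its extension [g], which agrees with it on the
     nonnegative inverse distances. *)
  have E : \forall t \near F, g (edge_dist nrm (q t) i e.1 e.2)^-1 =
      h (edge_dist nrm (q t) i e.1 e.2)^-1.
    by apply: nearW => t; rewrite gE // invr_ge0 ltW // dist_gt0.
  apply: cvg_trans (near_eq_cvg E) _.
  apply: (cvg_comp _ g); last exact: gc.
  apply: cvgV; first by rewrite gt_eqF.
  apply: (cvg_comp q (fun Q => edge_dist nrm Q i e.1 e.2) (entries_cvg FF qQ)).
  by have [+ _] := rC e i eB iB i1 i2; exact.
- apply: cvgM; first exact: cvg_cst.
  have frobE Q' : frobenius Q' ^+ 2 = \sum_i \sum_j Q' i j ^+ 2.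
    by rewrite /frobenius sqr_sqrtr // !sumr_ge0 // => i _; apply: sumr_ge0 => j _; exact: sqr_ge0.
  under eq_cvg do rewrite frobE; rewrite frobE.
  apply: cvg_sumr => i; apply: cvg_sumr => j.
  have H : (q t - Qref) i j @[t --> F] --> (Q - Qref) i j.
    rewrite !mxE; under eq_cvg do rewrite !mxE.
    by apply: cvgB; [exact: qQ|exact: cvg_cst].
  exact: cvgM.
Qed.

End Penalty.

(** All components converge at once along an ultrafilter; picking the j-th index within [j.+1%:R^-1]
    of the limits gives a sequence. The condition [j <= f j] stands in for monotonicity and suffices
    for limits at infinity. *)
Lemma bounded_subseq (R : realType) (I : finType) (u : nat -> I -> R) (M : R) :
  (forall n i, `|u n i| <= M) -> exists (f : nat -> nat) (l : I -> R),
  (forall j, (j <= f j)%N) /\ forall i, u (f j) i @[j --> \oo] --> l i.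
Proof.
move=> uM; have [U [UU ooU]] := @ultraFilterLemma nat \oo _.
have [l lP] : exists l : I -> R, forall i, u n i @[n --> U] --> l i.
  have H i : exists l : R, u n i @[n --> U] --> l by exact: ultra_cvg UU (uM ^~ i).
  by exists (fun i => projT1 (cid (H i))) => i; case: cid.
have near_l j : U [set n | (j <= n)%N /\ forall i, `|l i - u n i| < j.+1%:R^-1].
  apply: filterI; first by apply: ooU; exact: nbhs_infty_ge.
  apply: filter_forall => i; have /cvgrPdist_lt := lP i; apply.
  by rewrite invr_gt0 ltr0n.
have fP j := cid (@filter_ex _ U (@ultra_proper _ _ UU) _ (near_l j)).
exists (fun j => projT1 (fP j)), l; split=> [j|i]; first by case: (fP j) => n [].
apply/cvgrPdist_lt => e e0.
have near0 : \forall j \near \oo, @harmonic R j < e by exact: (cvgr_lt _ (@cvg_harmonic R) e e0).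
apply: filterS near0 => j; apply: lt_trans.
by case: (fP j) => n [_ /= H]; exact: H.
Qed.

(** * The discrete state equation *)

Section DiscreteProblem.
Context {R : realType} {N NT : nat}.
Context (Delta : {set {set 'I_N}}) (tri : 'I_NT -> 'I_3 -> 'I_N).
Notation plane := (R * R)%type.
Notation mplane := (measurableTypeR R * measurableTypeR R)%type.
Notation mu := (@lebesgue2 R).
Implicit Types (Q : 'M[R]_(2, N)) (x y w : plane) (k l : 'I_NT) (c d : 'I_N -> R).
Hypothesis cc : connectivity_complex Delta.
Hypothesis en : enumerates_2faces Delta tri.
Hypothesis co : consistently_oriented tri.

Local Notation pt := (@pt R N NT tri).
Local Notation triT := (@triT R N NT tri).
Local Notation G := (@piece_grad R N NT tri).
Let VB := boundary_vertices tri.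

Variables (a a' b b' : R).
Hypotheses (aa : a <= a') (bb : b <= b').
Variables (g : mplane -> R) (M : R).
Hypothesis mg : measurable_fun [set: mplane] g.
Hypothesis gM : forall x, `|g x| <= M.

Definition vanishing c := forall i, i \in VB -> c i = 0.

Definition energy Q c d := \sum_k vol tri Q k * dot (G Q c k) (G Q d k).

Definition load (f : mplane -> R) Q d := \sum_k \sum_m d (tri k m) * moment tri f Q k m.

Definition discrete_solution Q c :=
  vanishing c /\ forall d, vanishing d -> energy Q c d = load g Q d.

Section FixQ.
Variable Q : 'M[R]_(2, N).
Hypothesis MQ : Mplus Delta tri Q.
Hypothesis Qb : in_box a a' b b' Q.

Let pos : pos_areas tri Q := ((Mplus_proper cc en Q).1 MQ).1.
Let INT : meets_properly tri Q := ((Mplus_proper cc en Q).1 MQ).2.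

(** Functions in [S10] are the interpolants of nodal vectors that vanish at boundary vertices, so
    both equations have the same test functions. *)
Lemma discrete_solution_state (r : plane -> R) c :
  (forall v, \int[mu]_(x in Omega tri Q) (r x * v x) = \int[mu]_(x in Omega tri Q) (g x * v x)) ->
  vanishing c ->
  state_equation tri r Q (interp tri Q c) <-> discrete_solution Q c.
Proof.
move=> rg cB; split=> [st|[_ sol] v vS].
  split=> // d dB; have := st _ (S10_interp cc en co pos INT dB).
  by rewrite (Rintegral_grad en aa bb pos Qb INT) rg
    (Rintegral_Omega_interp en aa bb pos Qb INT _ mg gM).
have vE := S10_nodal en pos INT vS; rewrite vE.
rewrite (Rintegral_grad en aa bb pos Qb INT) rg
  (Rintegral_Omega_interp en aa bb pos Qb INT _ mg gM).
by apply: sol => i; exact: (S10_boundary_vertex pos INT vS).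
Qed.

Lemma load_le c : vanishing c ->
  forall (f : mplane -> R) (K : R), measurable_fun [set: mplane] f -> (forall x, `|f x| <= K) ->
  `|load f Q c| <= NT%:R * (K * (b' - b)) * \sum_k `|(G Q c k).2| * vol tri Q k.
Proof.
move=> cB f K mf fK; rewrite /load -(Rintegral_Omega_interp en aa bb pos Qb INT c mf fK).
exact: (load_bound cc en co aa bb pos Qb INT mf fK cB).
Qed.

Lemma nodal_bound c i : vanishing c -> `|c i| <= (b' - b) * \sum_k `|(G Q c k).2|.
Proof.
move=> cB; rewrite -(interp_vertex cc en pos INT c i).
apply: le_trans (interp_le_slices cc en co pos INT Qb cB _) _.
rewrite mulrC mulr_suml; apply: ler_sum => k _; rewrite ler_wpM2l //.
exact: (slice_length_le bb pos Qb).
Qed.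

Let vpos k : 0 < vol tri Q k := vol_gt0 aa bb pos Qb k.

Lemma energy_eq0 c : vanishing c -> energy Q c c = 0 -> forall i, c i = 0.
Proof.
move=> cB /eqP; rewrite psumr_eq0 => [/allP c0|k _]; last by rewrite mulr_ge0 ?dot_ge0 ?ltW.
have G0 k : G Q c k = 0.
  have := c0 k (mem_index_enum _); rewrite /= mulf_eq0 gt_eqF //=.
  by move=> /eqP/dot_eq0.
move=> i; have := nodal_bound i cB.
rewrite big1 ?mulr0; last by move=> k _; rewrite G0 normr0.
by rewrite normr_le0 => /eqP.
Qed.

(* With P := NT * M * (b' - b), Young's inequality
   P |G.2| <= P^2 / 2 + |G|^2 / 2 absorbs half of the energy. *)
Lemma solution_grad_bound c : discrete_solution Q c ->
  \sum_k `|(G Q c k).2| * vol tri Q k <=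
  (1 + (NT%:R * (M * (b' - b))) ^+ 2) * (NT%:R * ((a' - a) * (b' - b))).
Proof.
move=> [cB sol]; set P := NT%:R * (M * (b' - b)).
pose V := \sum_k vol tri Q k.
have V0 : 0 <= V by apply: sumr_ge0 => k _; exact: ltW.
have VV : V <= NT%:R * ((a' - a) * (b' - b)).
  apply: le_trans (ler_sum _ (fun k _ => vol_le aa bb pos Qb k)) _.
  by rewrite sumr_const card_ord mulr_natl.
set S := \sum_k _; set E := energy Q c c.
have sq k : (G Q c k).2 ^+ 2 <= dot (G Q c k) (G Q c k).
  by rewrite /dot -!expr2 lerDr sqr_ge0.
have SE (t : R) : t * S <= (t ^+ 2 * V + E) / 2.
  rewrite /S /V /E /energy !mulr_sumr -big_split /= mulr_suml; apply: ler_sum => k _.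
  have : 0 <= (t - `|(G Q c k).2|) ^+ 2 by exact: sqr_ge0.
  rewrite sqrrB real_normK ?num_real // => h.
  rewrite mulrA (_ : (_ + _) / 2 = (t ^+ 2 + dot (G Q c k) (G Q c k)) / 2 * vol tri Q k); last by ring.
  apply: ler_wpM2r; first exact: ltW.
  by move: h (sq k); rewrite mulr2n; set D := dot _ _ => h sqk; lra.
have EP : E <= P * S.
  rewrite /E sol //; apply: le_trans (ler_norm _) _.
  exact: load_le.
(* With [t := P] the energy is at most [P ^+ 2 * V]; with [t := 1] this bounds [S]. *)
have := SE P; have := SE 1; rewrite expr1n !mul1r => S1 SP.
have P0 : 0 <= P ^+ 2 by exact: sqr_ge0.
apply: (@le_trans _ _ ((1 + P ^+ 2) * V)); last by rewrite ler_wpM2l // addr_ge0.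
have := mulr_ge0 P0 V0; lra.
Qed.

Lemma discrete_solvable : exists c, discrete_solution Q c.
Proof.
pose e (j : 'I_N) : 'I_N -> R := fun i => (i == j)%:R.
have Gsum d k : G Q d k = \sum_j d j *: G Q (e j) k.
  rewrite /piece_grad; under [RHS]eq_bigr do rewrite scaler_sumr.
  rewrite [RHS]exchange_big /=; apply: eq_bigr => m _.
  rewrite (bigD1 (tri k m)) //= big1 ?addr0 => [|j jm].
    by rewrite /e eqxx scale1r.
  by rewrite /e eq_sym (negbTE jm) scale0r scaler0.
have energy_sumr c d : energy Q c d = \sum_j d j * energy Q c (e j).
  rewrite /energy; under [RHS]eq_bigr do rewrite mulr_sumr.
  rewrite [RHS]exchange_big /=; apply: eq_bigr => k _.
  rewrite (Gsum d) dot_sum mulr_sumr; apply: eq_bigr => j _.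
  by rewrite dotZr mulrCA.
have energyC c d : energy Q c d = energy Q d c.
  by apply: eq_bigr => k _; rewrite dotC.
have load_sum d : load g Q d = \sum_j d j * load g Q (e j).
  rewrite /load; under [RHS]eq_bigr do rewrite mulr_sumr.
  rewrite [RHS]exchange_big /=; apply: eq_bigr => k _.
  under [RHS]eq_bigr do rewrite mulr_sumr.
  rewrite [RHS]exchange_big /=; apply: eq_bigr => m _.
  rewrite (bigD1 (tri k m)) //= big1 ?addr0 => [|j jm].
    by rewrite /e eqxx mul1r.
  by rewrite /e eq_sym (negbTE jm) mul0r mulr0.
(* Boundary columns are those of the identity, which makes the system square on all nodes. Its
   kernel consists of vanishing vectors of zero energy, so uniqueness yields solvability. *)
pose A : 'M[R]_N := \matrix_(i, j) if j \in VB then (i == j)%:R else energy Q (e i) (e j).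
have mulA (v : 'rV[R]_N) j : (v *m A) 0 j =
    if j \in VB then v 0 j else energy Q (v 0) (e j).
  rewrite mxE; case: ifPn => jB.
    rewrite (bigD1 j) //= big1 ?addr0 => [|i ij]; first by rewrite mxE jB eqxx mulr1.
    by rewrite mxE jB (negbTE ij) mulr0.
  rewrite energyC energy_sumr; apply: eq_bigr => i _.
  by rewrite mxE (negbTE jB) energyC.
have Aunit : A \in unitmx.
  rewrite -row_free_unit; apply: inj_row_free => v vA.
  have vB : vanishing (v 0).
    by move=> j jB; have := mulA v j; rewrite vA mxE jB.
  apply/rowP => i; rewrite mxE; apply: (energy_eq0 vB).
  rewrite energy_sumr big1 // => j _.
  have [jB|jB] := boolP (j \in VB); first by rewrite vB ?mul0r.
  by have := mulA v j; rewrite vA mxE (negbTE jB) => <-; rewrite mulr0.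
pose F : 'rV[R]_N := \row_j if j \in VB then 0 else load g Q (e j).
pose c := (F *m invmx A) 0; exists c.
have cA j : (if j \in VB then c j else energy Q c (e j)) = F 0 j.
  by rewrite -mulA mulmxKV.
split=> [j jB|d dB]; first by have := cA j; rewrite jB mxE jB.
rewrite energy_sumr load_sum; apply: eq_bigr => j _.
have [jB|jB] := boolP (j \in VB); first by rewrite dB ?mul0r.
by have := cA j; rewrite (negbTE jB) mxE (negbTE jB) => ->.
Qed.

End FixQ.
End DiscreteProblem.

(** * Convergence of discrete solutions *)

Lemma cvg_subseq (R : realType) (u : nat -> R) (l : R) (f : nat -> nat) :
  (forall j, (j <= f j)%N) -> u n @[n --> \oo] --> l -> u (f j) @[j --> \oo] --> l.
Proof.
move=> fj ul; apply: (cvg_comp f u) ul => A [n _ nA].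
by exists n => // j /= nj; apply: nA => /=; exact: leq_trans (fj j).
Qed.

Lemma cvg_gt0_inv_bounded (R : realType) (u : nat -> R) (l : R) : 0 < l ->
  u n @[n --> \oo] --> l -> exists W, forall n, (u n)^-1 <= W.
Proof.
move=> l0 ul; have ul' : (u n)^-1 @[n --> \oo] --> l^-1 by apply: cvgV; rewrite ?gt_eqF.
have : cvgn (fun n => (u n)^-1) by apply/cvg_ex; exists l^-1.
move=> /cvg_seq_bounded/bounded_fun_has_ubound[W WP].
by exists W => n; apply: WP; exists n.
Qed.

Section Limits.
Context {R : realType} {N NT : nat}.
Context (tri : 'I_NT -> 'I_3 -> 'I_N).
Notation plane := (R * R)%type.
Notation mplane := (measurableTypeR R * measurableTypeR R)%type.
Implicit Types (Q : 'M[R]_(2, N)) (k l : 'I_NT) (c d : 'I_N -> R).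
Variables (a a' b b' : R).
Hypotheses (aa : a <= a') (bb : b <= b').
Variables (q : nat -> 'M[R]_(2, N)) (Q : 'M[R]_(2, N)).
Hypothesis qQ : forall i j, q n i j @[n --> \oo] --> Q i j.
Hypotheses (qpos : forall n, pos_areas tri (q n)) (pos : pos_areas tri Q).
Hypotheses (qb : forall n, in_box a a' b b' (q n)).

Lemma in_box_limit : in_box a a' b b' Q.
Proof.
move=> i; have c1 := vtx1_cvg qQ (i := i); have c2 := vtx2_cvg qQ (i := i).
split; apply/andP; split;
  [apply: (cvgr_to_ge c1)|apply: (cvgr_to_le c1)
  |apply: (cvgr_to_ge c2)|apply: (cvgr_to_le c2)];
  by apply: nearW => n; have [/andP[? ?] /andP[? ?]] := qb n i.
Qed.

Lemma piece_grad_fst Q' c k :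
  (piece_grad tri Q' c k).1 = \sum_m c (tri k m) * (bary_grad (pt tri Q' k) m).1.
Proof. by apply: (big_morph fst) => // -[? ?] [? ?]. Qed.

Lemma piece_grad_snd Q' c k :
  (piece_grad tri Q' c k).2 = \sum_m c (tri k m) * (bary_grad (pt tri Q' k) m).2.
Proof. by apply: (big_morph snd) => // -[? ?] [? ?]. Qed.

Lemma piece_grad_cvg (cn : nat -> 'I_N -> R) c k :
  (forall i, cn n i @[n --> \oo] --> c i) ->
  (piece_grad tri (q n) (cn n) k).1 @[n --> \oo] --> (piece_grad tri Q c k).1 /\
  (piece_grad tri (q n) (cn n) k).2 @[n --> \oo] --> (piece_grad tri Q c k).2.
Proof.
move=> cnc.
have areaV : (area2 (pt tri (q n) k))^-1 @[n --> \oo] --> (area2 (pt tri Q k))^-1.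
  by apply: cvgV; [exact: area2_neq0|exact: area2_cvg].
split.
  rewrite piece_grad_fst; under eq_cvg do rewrite piece_grad_fst.
  apply: cvg_sumr => m; apply: cvgM => //; apply: cvgM => //.
  by apply: cvgB; exact: vtx2_cvg.
rewrite piece_grad_snd; under eq_cvg do rewrite piece_grad_snd.
apply: cvg_sumr => m; apply: cvgM => //; apply: cvgM => //.
by apply: cvgB; exact: vtx1_cvg.
Qed.

Lemma load_cvg (f : mplane -> R) (K : R) (cn : nat -> 'I_N -> R) c :
  measurable_fun [set: mplane] f -> (forall x, `|f x| <= K) ->
  (forall i, cn n i @[n --> \oo] --> c i) ->
  load tri f (q n) (cn n) @[n --> \oo] --> load tri f Q c.
Proof.
move=> mf fK cnc; apply: cvg_sumr => k; apply: cvg_sumr => m; apply: cvgM => //.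
by apply: (moment_cvg aa bb mf fK) => //; exact: in_box_limit.
Qed.

Lemma vol_cvg k : vol tri (q n) k @[n --> \oo] --> vol tri Q k.
Proof.
rewrite (vol_moment aa bb pos in_box_limit).
under eq_cvg do rewrite (vol_moment aa bb (qpos _) (qb _)).
apply: cvg_sumr => m.
have m1 : measurable_fun [set: mplane] (fun=> 1 : R) by exact: measurable_cst.
have b1 : forall x : mplane, `|(fun=> 1 : R) x| <= 1 by move=> x; rewrite normr1.
by apply: (moment_cvg aa bb m1 b1) => //; exact: in_box_limit.
Qed.

Lemma energy_cvg (cn : nat -> 'I_N -> R) c d :
  (forall i, cn n i @[n --> \oo] --> c i) ->
  energy tri (q n) (cn n) d @[n --> \oo] --> energy tri Q c d.
Proof.
move=> cnc; apply: cvg_sumr => k; apply: cvgM; first exact: vol_cvg.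
have [c1 c2] := piece_grad_cvg k cnc.
have [d1 d2] := @piece_grad_cvg (fun=> d) d k (fun i => cvg_cst _).
by apply: cvgD; apply: cvgM.
Qed.

Lemma discrete_solution_limit (g : mplane -> R) (M : R) (cn : nat -> 'I_N -> R) c :
  measurable_fun [set: mplane] g -> (forall x, `|g x| <= M) ->
  (forall i, cn n i @[n --> \oo] --> c i) ->
  (forall n, discrete_solution tri g (q n) (cn n)) -> discrete_solution tri g Q c.
Proof.
move=> mg gM cnc sol; split=> [i iB|d dB].
  have c0 : cn n i @[n --> \oo] --> (0 : R).
    by under eq_cvg do rewrite (sol _).1 //; exact: cvg_cst.
  have ci := cnc i; exact: (cvg_unique (@norm_hausdorff _ _) ci c0).
have E : energy tri (q n) (cn n) d @[n --> \oo] --> load tri g Q d.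
  under eq_cvg do rewrite (sol _).2 //.
  by apply: (load_cvg mg gM) => i; exact: cvg_cst.
have E' := energy_cvg cnc (d := d); exact: (cvg_unique (@norm_hausdorff _ _) E' E).
Qed.

End Limits.

(** * Existence of a discrete minimizer *)

Section Minimizer.
Context {R : realType} {N NT : nat}.
Context (Delta : {set {set 'I_N}}) (tri : 'I_NT -> 'I_3 -> 'I_N).
Notation plane := (R * R)%type.
Notation mplane := (measurableTypeR R * measurableTypeR R)%type.
Notation mu := (@lebesgue2 R).
Implicit Types (Q : 'M[R]_(2, N)) (k l : 'I_NT) (c d : 'I_N -> R).
Hypothesis cc : connectivity_complex Delta.
Hypothesis en : enumerates_2faces Delta tri.
Hypothesis co : consistently_oriented tri.
Variable nrm : plane -> R.
Hypothesis reg : regularized_norm1 Delta tri nrm.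
Variables (alpha1 alpha2 alpha3 alpha4 : R) (Qref : 'M[R]_(2, N)) (h : R -> R).
Hypotheses (al1 : 0 < alpha1) (al2 : 0 < alpha2) (al3 : 0 < alpha3) (al4 : 0 < alpha4).
Hypothesis ph : penalizer h.
Let phi := penalty_with tri alpha1 alpha2 alpha3 alpha4 nrm Qref h.

Variables (a a' b b' : R).
Hypotheses (aa : a <= a') (bb : b <= b').
Variables (g : mplane -> R) (M : R).
Hypothesis mg : measurable_fun [set: mplane] g.
Hypothesis gM : forall x, `|g x| <= M.
Let D := box_meshes Delta tri Qref a a' b b'.
Hypothesis DQref : D Qref.

Let one : mplane -> R := fun=> 1.
Let m_one : measurable_fun [set: mplane] one.
Proof. exact: measurable_cst. Qed.
Let one_le x : `|one x| <= 1.
Proof. by rewrite normr1. Qed.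

Let value Q c := load tri one Q c + phi Q.
(** The bound of [solution_grad_bound], which is the same for all meshes in [D]. *)
Let S0 := (1 + (NT%:R * (M * (b' - b))) ^+ 2) * (NT%:R * ((a' - a) * (b' - b))).

Let DM Q : D Q -> Mplus Delta tri Q.
Proof. by move=> [/Mesh_sub]. Qed.

Let Dpos Q : D Q -> pos_areas tri Q.
Proof. by move=> /DM/(Mplus_proper cc en)[]. Qed.

Let load_one_le Q c : D Q -> discrete_solution tri g Q c ->
  `|load tri one Q c| <= NT%:R * (1 * (b' - b)) * S0.
Proof.
move=> DQ sol; have MQ := DM DQ.
apply: le_trans (load_le cc en co aa bb MQ DQ.2 sol.1 m_one one_le) _.
apply: ler_wpM2l; first by rewrite mul1r mulr_ge0 ?ler0n // subr_ge0.
exact: (solution_grad_bound cc en co aa bb mg gM MQ DQ.2 sol).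
Qed.

Lemma mesh_subseq (K : R) (q : nat -> 'M[R]_(2, N)) :
  (forall n, D (q n)) -> (forall n, phi (q n) <= K) ->
  exists (f : nat -> nat) Q, [/\ forall j, (j <= f j)%N, D Q &
    forall i j, q (f n) i j @[n --> \oo] --> Q i j].
Proof.
move=> Dq qK.
have [C [d [d' [d0 d'0 dP]]]] := penalty_coercive cc en reg Qref al1 al2 al3 al4 ph K.
have qB n (ij : 'I_2 * 'I_N) : `|q n ij.1 ij.2| <= (`|a| + `|a'|) + (`|b| + `|b'|).
  case: ij => i j /=; have [/andP[x1 x2] /andP[x3 x4]] := (Dq n).2 j.
  have i01 : i = 0 \/ i = 1 by case: i => [[|[|]]] // ?; [left|right]; exact/val_inj.
  have na (x y z : R) : x <= y -> y <= z -> `|y| <= `|x| + `|z|.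
    move=> xy yz; rewrite ler_norml; apply/andP; split.
      by have := ler_norm (- x); rewrite normrN; have := normr_ge0 z; lra.
    by have := ler_norm z; have := normr_ge0 x; lra.
  case: i01 => ->.
    by apply: le_trans (na _ _ _ x1 x2) _; rewrite lerDl addr_ge0.
  by apply: le_trans (na _ _ _ x3 x4) _; rewrite lerDr addr_ge0.
have [f [l [fj lP]]] := bounded_subseq qB.
pose Q : 'M[R]_(2, N) := \matrix_(i, j) l (i, j).
have qQ i j : q (f n) i j @[n --> \oo] --> Q i j by rewrite mxE; exact: (lP (i, j)).
exists f, Q; split=> //.
(* An ultrafilter finer than the filter at infinity has the same mesh limit and makes the separating
   normals converge. *)
have [U [UU ooU]] := @ultraFilterLemma nat \oo _.
have qQU i j : q (f n) i j @[n --> U] --> Q i j.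
  by move=> A /qQ; exact: ooU.
have [_ r2 _ _] := reg.
have MQ : Mplus Delta tri Q.
  apply: (Mplus_limit cc en co r2 UU qQU (C := C) d0 d'0).
  - by move=> n; exact: DM.
  - by move=> n k; have [+ _ _] := dP _ (DM (Dq (f n))) (qK _).
  - by move=> n; have [_ + _] := dP _ (DM (Dq (f n))) (qK _).
  - by move=> n e i; have [_ _ +] := dP _ (DM (Dq (f n))) (qK _); exact.
split; last by apply: (in_box_limit qQ) => n i; exact: (Dq (f n)).2.
by apply: (Mesh_limit cc en co _ qQ) => // n; exact: (Dq (f n)).1.
Qed.

(** The energy estimate weighs slopes with volumes. As the limit triangles have positive volume, the
    inverse volumes are bounded along the sequence, which removes the weights. *)
Lemma nodal_subseq (q : nat -> 'M[R]_(2, N)) Q (cn : nat -> 'I_N -> R) :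
  (forall n, D (q n)) -> D Q -> (forall i j, q n i j @[n --> \oo] --> Q i j) ->
  (forall n, discrete_solution tri g (q n) (cn n)) ->
  exists (f : nat -> nat) c, (forall j, (j <= f j)%N) /\
    forall i, cn (f n) i @[n --> \oo] --> c i.
Proof.
move=> Dq DQ qQ sol; have MQ := DM DQ.
have vq k : exists W, forall n, (vol tri (q n) k)^-1 <= W.
  have v0 := vol_gt0 aa bb (Dpos DQ) DQ.2 k.
  apply: (cvg_gt0_inv_bounded v0).
  by apply: (vol_cvg aa bb qQ) => [n||n]; [exact: Dpos|exact: Dpos|exact: (Dq n).2].
pose W k := projT1 (cid (vq k)).
have WP k n : (vol tri (q n) k)^-1 <= W k by rewrite /W; case: cid.
have W0 k : 0 <= W k.
  apply: le_trans (WP k 0%N); rewrite invr_ge0 ltW //.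
  exact: (vol_gt0 aa bb (Dpos (Dq _)) (Dq _).2).
pose WW := \sum_k W k.
apply: (@bounded_subseq _ _ cn ((b' - b) * (WW * S0))) => n i.
have MQn := DM (Dq n).
apply: le_trans (nodal_bound cc en co bb MQn (Dq n).2 i (sol n).1) _.
apply: ler_wpM2l; first by rewrite subr_ge0.
apply: (@le_trans _ _ (WW * \sum_k `|(piece_grad tri (q n) (cn n) k).2| * vol tri (q n) k)).
  rewrite mulr_sumr; apply: ler_sum => k _; rewrite mulrCA ler_peMr //.
  have v0 := vol_gt0 aa bb (Dpos (Dq n)) (Dq n).2 k.
  rewrite -ler_pdivrMr // div1r; apply: le_trans (WP k n) _.
  by rewrite /WW (bigD1 k) //= lerDl sumr_ge0.
apply: ler_wpM2l; first exact: sumr_ge0.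
exact: (solution_grad_bound cc en co aa bb mg gM MQn (Dq n).2 (sol n)).
Qed.

Lemma discrete_minimizer : exists Q c, [/\ D Q, discrete_solution tri g Q c &
  forall Q' c', D Q' -> discrete_solution tri g Q' c' -> value Q c <= value Q' c'].
Proof.
pose E : set R := [set v | exists Q c, [/\ D Q, discrete_solution tri g Q c & v = value Q c]].
pose J0 := NT%:R * (1 * (b' - b)) * S0.
have [L LP] := penalty_lower cc en reg Qref al1 al2 al3 al4 ph.
have Elb : lbound E (- J0 + L).
  move=> _ [Q [c [DQ sol ->]]]; apply: lerD; last exact: LP (DM DQ).
  by have := load_one_le DQ sol; rewrite ler_norml => /andP[].
have Einf : has_inf E.
  split; last by exists (- J0 + L).
  have [c sol] := discrete_solvable cc en co aa bb g (DM DQref) DQref.2.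
  by exists (value Qref c), Qref, c.
have seq n : exists Qc : 'M[R]_(2, N) * ('I_N -> R), [/\ D Qc.1,
    discrete_solution tri g Qc.1 Qc.2 & value Qc.1 Qc.2 <= inf E + @harmonic R n].
  have n0 : 0 < @harmonic R n by rewrite /harmonic /= invr_gt0 ltr0n.
  have [_ [Q [c [DQ sol ->]]] /ltW vQ] := inf_adherent n0 Einf.
  by exists (Q, c).
pose q n := (projT1 (cid (seq n))).1; pose cn n := (projT1 (cid (seq n))).2.
have Dq n : D (q n) by rewrite /q; case: cid => ? [].
have sol n : discrete_solution tri g (q n) (cn n) by rewrite /q /cn; case: cid => ? [].
have vn n : value (q n) (cn n) <= inf E + @harmonic R n by rewrite /q /cn; case: cid => ? [].
(* Values exceed the infimum by at most 1, and the integral of the state is at least [- J0]. *)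
have qK n : phi (q n) <= inf E + 1 + J0.
  have := load_one_le (Dq n) (sol n); rewrite ler_norml => /andP[h1 _].
  have h2 := vn n; have h3 : @harmonic R n <= 1 by rewrite /harmonic /= invf_le1 ?ler1n ?ltr0n.
  move: h1 h2; rewrite /value -/J0; lra.
have [f [Q [fj DQ qQ]]] := mesh_subseq Dq qK.
have [f' [c [f'j cnc]]] := nodal_subseq (fun n => Dq (f n)) DQ qQ (fun n => sol (f n)).
pose F n := f (f' n).
have qQF i j : q (F n) i j @[n --> \oo] --> Q i j := cvg_subseq f'j (qQ i j).
have Fpos n : pos_areas tri (q (F n)) := Dpos (Dq _).
have Fbox n : in_box a a' b b' (q (F n)) := (Dq _).2.
exists Q, c; split=> //.
  exact: (discrete_solution_limit aa bb qQF Fpos (Dpos DQ) Fbox mg gM cnc (fun n => sol (F n))).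
have vle : value Q c <= inf E + 0.
  apply: (@cvg_ler _ _ \oo _ (fun n => value (q (F n)) (cn (F n)))
    (fun n => inf E + @harmonic R n)).
  - apply: cvgD; first exact: (load_cvg aa bb qQF Fpos (Dpos DQ) Fbox m_one one_le cnc).
    by apply: (penalty_cvg cc en reg ph _ qQF) => [|n]; exact: DM.
  - by apply: cvgD; [exact: cvg_cst|exact: cvg_harmonic].
  - move=> n; apply: le_trans (vn (F n)) _; rewrite lerD2l /harmonic /=.
    rewrite lef_pV2 ?posrE ?ltr0n // ler_nat ltnS.
    exact: leq_trans (f'j n) (fj _).
move=> Q' c' DQ' sol'; apply: le_trans vle _; rewrite addr0.
by apply: ge_inf; [exists (- J0 + L)|exists Q', c'].
Qed.

End Minimizer.

Theorem proposition3p7 (R : realType) (N NT : nat)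
    (Delta : {set {set 'I_N}}) (tri : 'I_NT -> 'I_3 -> 'I_N)
    (Qref : 'M[R]_(2, N))
    (alpha1 alpha2 alpha3 alpha4 : R) (nrm : R * R -> R)
    (phi : 'M[R]_(2, N) -> R)
    (a a' b b' : R) (r : R * R -> R) :
  connectivity_complex Delta ->
  enumerates_2faces Delta tri ->
  consistently_oriented tri ->
  Mplus Delta tri Qref ->
  regularized_norm1 Delta tri nrm ->
  0 < alpha1 -> 0 < alpha2 -> 0 < alpha3 -> 0 < alpha4 ->
  (phi = penalty tri alpha1 alpha2 alpha3 alpha4 nrm Qref \/
   exists2 chi : R -> R, cutoff chi &
     phi = penalty_cutoff tri alpha1 alpha2 alpha3 alpha4 nrm Qref chi) ->
  a < a' -> b < b' ->
  let D := box_meshes Delta tri Qref a a' b b' in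
  D Qref ->
  in_Linfty r (rectangle a a' b b') ->
  exists (Q : 'M[R]_(2, N)) (y : R * R -> R),
    global_minimizer Delta tri Qref r D phi Q y.
Proof.
move=> cc en co _ reg al1 al2 al3 al4 phiE /ltW aa /ltW bb D DQref rL.
have [h ph {}phiE] : exists2 h : R -> R, penalizer h &
    phi = penalty_with tri alpha1 alpha2 alpha3 alpha4 nrm Qref h.
  case: phiE => [->|[chi hchi ->]]; first by exists id => //; exact: penalizer_id.
  by exists chi => //; exact: penalizer_cutoff.
have [g [M [mg gM rg]]] := Linfty_weight tri rL.
have [Q [c [DQ sol minQ]]] := discrete_minimizer cc en co reg al1 al2 al3 al4 ph aa bb mg gM DQref.
have DM Q' : D Q' -> Mplus Delta tri Q' by move=> [/Mesh_sub].
have Dproper Q' : D Q' -> pos_areas tri Q' /\ meets_properly tri Q'.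
  by move=> /DM/(Mplus_proper cc en).
have rgD Q' v : D Q' -> \int[@lebesgue2 R]_(x in Omega tri Q') (r x * v x) =
    \int[@lebesgue2 R]_(x in Omega tri Q') (g x * v x).
  by move=> DQ'; apply: rg; [exact: (Dproper _ DQ').1|exact: DQ'.2].
have intE Q' c' : D Q' -> \int[@lebesgue2 R]_(x in Omega tri Q') interp tri Q' c' x =
    load tri (fun=> 1) Q' c'.
  move=> DQ'; have [pos INT] := Dproper _ DQ'.
  rewrite /load -(Rintegral_Omega_interp en aa bb pos DQ'.2 INT (g := fun=> 1) (M := 1)) //.
  - by apply: eq_Rintegral => x _; rewrite mul1r.
  - by move=> x; rewrite normr1.
exists Q, (interp tri Q c).
have objE Q' c' : D Q' -> objective tri D phi Q' (interp tri Q' c') =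
    (load tri (fun=> 1) Q' c' + phi Q')%:E.
  by move=> DQ'; rewrite /objective /indicator_oo asboolT // adde0 intE.
split.
  have [pos INT] := Dproper _ DQ; split; first exact: DQ.1.
    exact: (S10_interp cc en co pos INT sol.1).
  by apply/(discrete_solution_state cc en co aa bb mg gM (DM _ DQ) DQ.2) => // [v|];
    [exact: rgD|exact: sol.1].
move=> Q' y' [MQ' yS st]; have [DQ'|nD] := pselect (D Q'); last first.
  (* The other two terms are finite, so outside [D] the objective is infinite. *)
  by rewrite /objective /(indicator_oo _ Q') asboolF // addey // addye // leey.
have [pos INT] := Dproper _ DQ'.
have yE := S10_nodal en pos INT yS.
rewrite yE !objE // lee_fin phiE; apply: minQ => //.
apply/(discrete_solution_state cc en co aa bb mg gM (DM _ DQ') DQ'.2).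
- by move=> v; exact: rgD.
- by move=> i; exact: (S10_boundary_vertex pos INT yS).
- by rewrite -yE.
Qed.
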